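(* Let $d\ge 3$ and $G=T_d\Box\mathbb{Z}$. Then $$p_c(G)=\alpha^{-1}\left(\frac{1}{d-1}\right),$$ where $\alpha^{-1}:[0,\alpha(p_c)]\to[0,p_c]$ is the inverse of the function $\alpha$ restricted to $[0,p_c]$.
   Context: $T_d$ is the $d$-regular tree with a fixed root (origin), and $T_d\Box\mathbb{Z}$ is its Cartesian product with the line $\mathbb{Z}$; vertices are pairs $(x,k)$ with $x\in T_d$, $k\in\mathbb{Z}$, and $o=(\text{root},0)$. In Bernoulli bond percolation with parameter $p\in[0,1]$ each edge is independently open with probability $p$ and closed otherwise; $\mathbb{P}_p$ is the associated probability measure. Clusters are the connected components of the subgraph of open edges. $p_c=p_c(G)=\inf\{p\in[0,1]: \text{there exists an infinite cluster almost surely}\}$. For vertices $x,y$, $(x\leftrightarrow y)$ is the event that there is an open path between $x$ and $y$. Define $$\alpha(p)=\lim_{n\to\infty}\mathbb{P}_p(o\leftrightarrow(v_n,0))^{1/n}=\sup_{n\ge1}\mathbb{P}_p(o\leftrightarrow(v_n,0))^{1/n},$$ where $v_n$ is any vertex of $T_d$ at distance $n$ from the root (the value does not depend on the choice; the limit exists and equals the supremum by supermultiplicativity). The function $\alpha$ is strictly increasing and continuous on $[0,p_c]$ with $\alpha(0)=0$, so that it restricts to a bijection from $[0,p_c]$ onto $[0,\alpha(p_c)]$; $\alpha^{-1}$ denotes the inverse of this bijection. *)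

(* Defs.v *)
From HB Require Import structures.
From mathcomp Require Import all_boot all_order all_algebra.
From mathcomp Require Import all_classical all_reals all_analysis.
From mathcomp Require Import measurable_realfun zify ring lra.

Set Implicit Arguments.
Unset Strict Implicit.
Unset Printing Implicit Defensive.

Import Order.TTheory GRing.Theory Num.Theory.
Import numFieldNormedType.Exports.

Local Open Scope classical_set_scope.
Local Open Scope ring_scope.

(* Graphs are symmetric irreflexive relations on a countable vertex type. *)

Definition graph_dist (V : eqType) (e : rel V) (x y : V) (n : nat) : Prop :=
  (exists p : seq V, [/\ path e x p, last x p = y & size p = n]) /\
  (forall p : seq V, path e x p -> last x p = y -> (n <= size p)%N).

Definition cartesian_product (V W : eqType) (e : rel V) (f : rel W) :
    rel (V * W) :=
  fun u v => ((u.1 == v.1) && f u.2 v.2) || (e u.1 v.1 && (u.2 == v.2)).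

Definition line_adj : rel int := fun k l => `|k - l| == 1.

(* The d-regular tree is the Cayley graph of the free product of d copies of
   Z/2Z: its vertices are the words over 'I_d without two equal consecutive
   letters, and each nonempty word is joined to its tail.  The empty word has d
   children, any other vertex has d - 1 children and a parent. *)
Definition tree (d : nat) :=
  {w : seq 'I_d | sorted (fun i j => i != j) w}.

Definition tree_root (d : nat) : tree d := exist _ [::] isT.

Definition tree_adj (d : nat) : rel (tree d) := fun u v =>
  [exists i : 'I_d, (val v == i :: val u) || (val u == i :: val v)].

Lemma tree_adjC d : symmetric (@tree_adj d).
Proof. by move=> u v; apply: eq_existsb => i; rewrite orbC. Qed.

Lemma tree_adj_irr d : irreflexive (@tree_adj d).
Proof.
by move=> u; apply/existsP => -[i]; rewrite orbb => /eqP/(congr1 size)/= /n_Sn.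
Qed.

Lemma tree_adj_behead d (u v : tree d) : tree_adj u v ->
  (size (val v) <= size (val u))%N -> val v = behead (val u).
Proof. by case/existsP => i /orP[] /eqP -> //=; rewrite ltnn. Qed.

Lemma tree_regular d (u : tree d) :
  exists s : seq (tree d), [/\ uniq s, size s = d & s =i tree_adj u].
Proof.
case: u => w ws.
have cons_ok i :
    ohead w != Some i -> sorted (fun i j : 'I_d => i != j) (i :: w).
  case: w ws => //= j w0 -> ji; rewrite andbT.
  by apply: contraNneq ji => ->; exact: eqxx.
have beh_ok : sorted (fun i j : 'I_d => i != j) (behead w).
  by case: w ws {cons_ok} => //= j w; exact: path_sorted.
pose f (i : 'I_d) : tree d :=
  if insub (i :: w) is Some x then x else exist _ (behead w) beh_ok.
have fE i : val (f i) = if ohead w != Some i then i :: w else behead w.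
  rewrite /f; case: ifP => h; first by rewrite insubT ?cons_ok.
  rewrite insubF//; apply/negP => /=; move: h.
  by case: (w) => //= j t /negbT; rewrite negbK => /eqP[->]; rewrite eqxx.
have fi : injective f.
  move=> i j /(congr1 val); rewrite !fE; do 2 case: ifP.
  - by move=> _ _ [].
  - by move=> _ _ /(congr1 size) /=; rewrite size_behead; lia.
  - by move=> _ _ /(congr1 size) /=; rewrite size_behead; lia.
  - by move=> /negbT/negPn/eqP -> /negbT/negPn/eqP[].
exists (map f (enum 'I_d)); split.
- by rewrite map_inj_uniq// enum_uniq.
- by rewrite size_map size_enum_ord.
move=> x; rewrite [RHS]/in_mem/=;
  apply/mapP/existsP => [[i _ ->]|[i /orP[]/eqP/= e]].
- exists i; rewrite fE /=;
  case: ifP => [_|/negbT/negPn/eqP]; first by rewrite eqxx.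
  by case: (w) => //= j t [->]; rewrite eqxx orbT.
- exists i; rewrite ?mem_enum//; apply: val_inj; rewrite fE; case: ifP => //.
  have /= := valP x; have -> : sval x = i :: w by exact: e.
  case: (w) => //= j t /andP[/negbTE ij _] /negbT/negPn/eqP[/esym/eqP].
  by rewrite ij.
- exists i; rewrite ?mem_enum//; apply: val_inj; rewrite fE.
  by move: e; case: (w) => //= j t [-> ->]; rewrite eqxx.
Qed.

Lemma tree_connected d (u : tree d) :
  exists2 p : seq (tree d), path (@tree_adj d) u p & last u p = tree_root d.
Proof.
case: u => w; elim: w => [|i w IH]  ws;
  first by exists [::] => //; apply: val_inj.
have ws' := path_sorted ws; have [p pp pl] := IH ws'.
exists (exist _ w ws' :: p) => //=; rewrite pp andbT.
by apply/existsP; exists i; rewrite /= eqxx orbT.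
Qed.

Lemma tree_acyclic d (c : seq (tree d)) :
  (2 < size c)%N -> ~~ ucycleb (@tree_adj d) c.
Proof.
move=> c2; apply/negP => /andP[cc cu].
have [x xc xmax] : exists2 x, x \in c &
    forall y, y \in c -> (size (val y) <= size (val x))%N.
  case: c c2 cc cu => // a c _ _ _.
  elim: c a => [|b c IH] a; first by exists a;
    rewrite ?mem_head// => y; rewrite inE => /eqP->.
  have [x xc xm] := IH b.
  have [h|h] := leqP (size (val x)) (size (val a)).
    exists a; first exact: mem_head.
    by move=> y; rewrite inE => /orP[/eqP->//|/xm/leq_trans]; exact.
  exists x; first by rewrite inE xc orbT.
  by move=> y; rewrite inE => /orP[/eqP->|/xm//]; exact: ltnW.
have [i c' rc] := rot_to xc.
have : cycle (@tree_adj d) (x :: c') by rewrite -rc rot_cycle.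
have : uniq (x :: c') by rewrite -rc rot_uniq.
have : (2 < size (x :: c'))%N by rewrite -rc size_rot.
have m y : y \in c' -> (size (val y) <= size (val x))%N.
  by move=> yc; apply: xmax; rewrite -(mem_rot i) rc inE yc orbT.
case: c' m {rc} => // y c' m; case/lastP: c' m => // c' z m _.
rewrite /= rcons_path last_rcons => /andP[_ /andP[yz _]] /andP[xy /andP[_ zx]].
have yE := tree_adj_behead xy (m y (mem_head _ _)).
have zE : val z = behead (val x).
  apply: tree_adj_behead; first by rewrite tree_adjC.
  by apply: m; rewrite inE mem_rcons mem_head orbT.
by move: yz; rewrite (val_inj (etrans yE (esym zE))) mem_rcons mem_head.
Qed.

Definition tree_line (d : nat) : rel (tree d * int) :=
  cartesian_product (@tree_adj d) line_adj.

(* Unoriented edges: the pair of endpoints is listed in the order of an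
   arbitrary enumeration of the vertices. *)
Definition edge (V : countType) (e : rel V) :=
  {xy : V * V | e xy.1 xy.2 && (pickle xy.1 < pickle xy.2)%N}.

Definition edge_cylinder (V : countType) (e : rel V) :
    set (set (edge e -> bool)) :=
  [set A | exists f b, A = [set w : edge e -> bool | w f = b]].

Arguments edge_cylinder {V} e _.

(* Percolation configurations (true = open) with the product sigma-algebra. *)
Definition config (V : countType) (e : rel V) :=
  g_sigma_algebraType (edge_cylinder e).

Definition bernoulli_percolation (R : realType) (V : countType) (e : rel V)
    (p : R) (P : probability (config e) R) : Prop :=
  forall (s : seq (edge e)) (b : edge e -> bool), uniq s ->
    P [set w : config e | forall f, f \in s -> w f = b f] =
      (\prod_(f <- s) (if b f then p else 1 - p))%:E.

(* The measures assumed to satisfy bernoulli_percolation exist: successive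
   Bernoulli(p) bits are extracted from a uniform point of [0, 1[ by the map T
   below, which rescales [0, p[ and [p, 1[ to [0, 1[. *)
Definition lebesgue01 (R : realType) : set (measurableTypeR R) -> \bar R :=
  mrestr (@lebesgue_measure R) (measurable_itv (`[0, 1[ : interval R)).

HB.instance Definition _ (R : realType) := Measure.on (@lebesgue01 R).

Lemma lebesgue01_setT (R : realType) : @lebesgue01 R setT = 1%:E.
Proof.
rewrite /lebesgue01 /mrestr setTI lebesgue_measure_itv/= lte_fin ltr01.
by rewrite -EFinB subr0.
Qed.

HB.instance Definition _ (R : realType) :=
  Measure_isProbability.Build _ _ _ (@lebesgue01 R) (@lebesgue01_setT R).

Section bernoulli_percolation_exists.
Variables (R : realType) (p : R).
Hypothesis p01 : 0 <= p <= 1.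
Let T (x : R) : R := if x < p then x / p else (x - p) / (1 - p).
Let bit (x : R) (n : nat) : bool := iter n T x < p.
Fixpoint match_bits (l : seq (option bool)) (x : R) : bool :=
  if l is o :: l' then oapp (fun b => (x < p) == b) true o &&
    match_bits l' (T x)
  else true.
Let w (o : option bool) : R :=
  oapp (fun b : bool => if b then p else 1 - p) 1 o.
Let S l a r : set R := [set x | a <= x < a + r /\ match_bits l ((x - a) / r)].

Lemma S_measure l a r : 0 <= r -> measurable (S l a r) /\
  lebesgue_measure (S l a r) = (r * \prod_(o <- l) w o)%:E.
Proof.
have [p0 p1] := andP p01.
elim: l a r => [|o l IH] a r r0.
  have -> : S [::] a r = `[a, a + r[%classic.
    by apply/seteqP; split => x /=; rewrite /S /= in_itv/= => // -[].
  split=> //; rewrite lebesgue_measure_itv/= lte_fin big_nil mulr1.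
  case: ltP => h; last by congr _%:E; lra.
  by rewrite -EFinB; congr _%:E; lra.
have rp : 0 <= r * p by rewrite mulr_ge0.
have rq : 0 <= r * (1 - p) by rewrite mulr_ge0// subr_ge0.
pose A := if o == Some false then set0 else S l a (r * p).
pose B := if o == Some true then set0 else S l (a + r * p) (r * (1 - p)).
have SE : S (o :: l) a r = A `|` B.
  apply/seteqP; split => x /=.
    move=> [/andP[ax xr]] /andP[ob].
    have rpos : 0 < r by lra.
    rewrite /T; case: ifP => xp.
      rewrite ltr_pdivrMr// in xp.
      move=> m; left; rewrite /A ifF; last first.
        by apply/negP => /eqP oE; move: ob; rewrite oE /= ltr_pdivrMr// xp.
      split; last by rewrite invfM mulrA.
      by rewrite ax/=; lra.
    have xp' : a + r * p <= x
      by move/negbT: xp; rewrite ltr_pdivrMr// -leNgt; lra.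
    move=> m; right; rewrite /B ifF; last first.
      by apply/negP => /eqP oE; move: ob; rewrite oE /= xp.
    split; first by rewrite xp'/=; lra.
    move: m; congr (is_true (match_bits l _)).
    rewrite invfM mulrA; congr (_ / _); field; lra.
  case.
    rewrite /A; case: eqP => // oF [/andP[ax xr] m].
    have rpp : 0 < r * p by lra.
    have ppos : 0 < p.
      rewrite lt_neqAle p0 andbT.
      by apply: contraTneq rpp => <-; rewrite mulr0 ltxx.
    have rpos : 0 < r by move: rpp; rewrite pmulr_lgt0.
    split; first by rewrite ax/=; nra.
    have xp : (x - a) / r < p by rewrite ltr_pdivrMr//; lra.
    rewrite /= xp /T xp -mulrA -invfM m andbT.
    by case: (o) oF => // -[].
  rewrite /B; case: eqP => // oF [/andP[ax xr] m].
  have rpp : 0 < r * (1 - p) by lra.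
  have ppos : 0 < 1 - p.
    rewrite lt_neqAle subr_ge0 p1 andbT.
    by apply: contraTneq rpp => <-; rewrite mulr0 ltxx.
  have rpos : 0 < r by move: rpp; rewrite pmulr_lgt0.
  split; first by apply/andP; split; lra.
  have xp : ((x - a) / r < p) = false.
    by apply/negbTE; rewrite -leNgt ler_pdivlMr//; lra.
  rewrite /= xp /T xp; apply/andP; split; first by case: (o) oF => // -[].
  move: m; congr (is_true (match_bits l _)).
  rewrite invfM mulrA; congr (_ / _); field; lra.
have [mA eA] : measurable A /\ lebesgue_measure A =
    ((if o == Some false then 0 else r * p) * \prod_(o <- l) w o)%:E.
  rewrite /A; case: ifP => _; last exact: IH.
  by split => //; rewrite mul0r measure0.
have [mB eB] : measurable B /\ lebesgue_measure B =
    ((if o == Some true then 0 else r * (1 - p)) * \prod_(o <- l) w o)%:E.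
  rewrite /B; case: ifP => _; last exact: IH.
  by split => //; rewrite mul0r measure0.
rewrite SE; split; first exact: measurableU.
have -> : lebesgue_measure (A `|` B) =
    (lebesgue_measure A + lebesgue_measure B)%E :> \bar R.
  apply: measureU => //; rewrite -subset0 => x []; rewrite /A /B.
  case: ifP => // _ [/andP[_ h1] _]; case: ifP => // _ [/andP[h2 _] _].
  by move: (lt_le_trans h1 h2); rewrite ltxx.
rewrite eA eB -EFinD big_cons; congr _%:E.
by case: (o) => [[]|] /=; rewrite ?eqxx /=; ring.
Qed.

Lemma match_bitsP l x : match_bits l x <->
  forall i b, nth None l i = Some b -> bit x i = b.
Proof.
elim: l x => [|o l IH] x /=; first by split=> // _ i b; rewrite nth_nil.
split.
  move=> /andP[ob m] [|i] b /=.
    by move=> oE; move: ob; rewrite oE /= => /eqP.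
  by move=> e; move/IH: m => /(_ _ _ e); rewrite /bit iterSr.
move=> h; apply/andP; split.
  by case: o h => [b|//] h /=; apply/eqP; exact: (h 0%N).
apply/IH => i b e; have := h i.+1 b e; by rewrite /bit iterSr.
Qed.

Lemma measurable_T : measurable_fun setT T.
Proof.
apply: measurable_fun_ifT => /=.
- exact: measurable_fun_ltr.
- exact: measurable_funM.
- by apply: measurable_funM => //; exact: measurable_funB.
Qed.

Lemma measurable_bit n b : measurable [set x | bit x n = b].
Proof.
have mi : measurable_fun setT (iter n T).
  elim: n => [|n IH]; first exact: measurable_id.
  by apply: (measurableT_comp measurable_T IH).
have mb : measurable_fun setT (fun x => bit x n) by exact: measurable_fun_ltr.
by rewrite -[X in measurable X]setTI; exact: (mb measurableT [set b]).
Qed.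

Variables (V : countType) (e : rel V).
Let X (x : measurableTypeR R) : config e := fun f => bit x (pickle f).

Let measurable_X : measurable_fun setT X.
Proof.
apply: (@measurability _ _ _ _ setT X (edge_cylinder e)) => //.
move=> _ [_ [f [b ->]] <-]; rewrite setTI; exact: measurable_bit.
Qed.

Let mX : {mfun measurableTypeR R >-> config e} :=
  mfun_Sub (mem_set measurable_X).

Lemma bernoulli_percolation_exists :
  exists P : probability (config e) R, bernoulli_percolation p P.
Proof.
exists (distribution (@lebesgue01 R) mX).
move=> s b us.
pose g i : option bool :=
  obind (fun f => if f \in s then Some (b f) else None)
    (@pickle_inv (edge e : countType) i).
have [n hn] : exists n, forall f, f \in s -> (pickle f < n)%N.
  exists (\max_(f <- s) pickle f).+1 => f fs.
  by rewrite ltnS; apply: leq_bigmax_seq.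
pose l := mkseq g n.
have gK i f : pickle_inv i = Some f :> option (edge e) -> pickle f = i.
  by move=> ei; have := @pickle_invK (edge e : countType) i; rewrite ei.
have gp f : g (pickle f) = if f \in s then Some (b f) else None.
  by rewrite /g pickleK_inv.
rewrite /distribution /pushforward /= /lebesgue01 /mrestr.
have -> : X @^-1` [set w0 | forall f, f \in s -> w0 f = b f] `&`
    `[0, 1[ = S l 0 1.
  apply/seteqP; split => x; rewrite /S /= in_itv /= add0r subr0 divr1.
    move=> [h x01]; split => //; apply/match_bitsP => i c.
    have [ni|ni] := ltnP i n; last by rewrite nth_default// size_mkseq.
    rewrite nth_mkseq// /g; case ei : (pickle_inv i) => [f|//] /=.
    case: ifP => // fs [<-]; rewrite -(h _ fs) /X.
    congr (bit x _); exact/esym/gK.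
  move=> [x01 /match_bitsP h]; split=> // f fs.
  by apply: h; rewrite nth_mkseq ?hn// gp fs.
rewrite (S_measure _ _ _).2// mul1r; congr _%:E.
rewrite /l /mkseq big_map.
rewrite (bigID (fun i => i \in map pickle s)) /= [X in _ * X]big1 ?mulr1;
  last first.
  move=> i is_; rewrite /g; case ei : (pickle_inv i) => [f|//] /=.
  case: ifP => // fs; case/negP: is_; apply/mapP; exists f => //.
  exact/esym/gK.
rewrite -big_filter (perm_big (map pickle s)); last first.
  apply: uniq_perm; first by rewrite filter_uniq// iota_uniq.
    by rewrite map_inj_uniq//; exact: pcan_inj (@pickleK _).
  move=> i; rewrite mem_filter mem_iota add0n/=.
  by case: mapP => //= -[f fs ->]; rewrite hn.
rewrite big_map big_seq [RHS]big_seq; apply: eq_bigr => f fs.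
by rewrite gp fs.
Qed.
End bernoulli_percolation_exists.

Definition open_adj (V : countType) (e : rel V) (w : config e) : rel V :=
  fun x y => oapp w false (insub (x, y)) || oapp w false (insub (y, x)).

Definition open_connected (V : countType) (e : rel V) (w : config e)
    (x y : V) : Prop :=
  exists2 q : seq V, path (open_adj w) x q & last x q = y.

Definition cluster (V : countType) (e : rel V) (w : config e) (x : V) : set V :=
  [set y | open_connected w x y].

(* In the next two definitions, P p is meant to be the Bernoulli(p) percolation
   measure. *)
Definition critical_probability (R : realType) (V : countType) (e : rel V)
    (P : R -> probability (config e) R) : R :=
  inf [set p : R | 0 <= p <= 1 /\
    {ae P p, forall w, exists x, infinite_set (cluster w x)}].

Definition connection_rate (R : realType) (d : nat)
    (P : R -> probability (config (@tree_line d)) R) (v : nat -> tree d)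
    (p : R) : R :=
  limn (fun n : nat =>
    fine (P p [set w | open_connected w (tree_root d, 0) (v n, 0)])
      `^ (n%:R)^-1).

(* Main.v *)
Require Import Defs.
From mathcomp Require Import all_boot all_order all_algebra.
From mathcomp Require Import all_classical all_reals all_analysis.
From mathcomp Require Import zify ring lra.

Set Implicit Arguments.
Unset Strict Implicit.
Unset Printing Implicit Defensive.

Import Order.TTheory GRing.Theory Num.Theory.
Import numFieldNormedType.Exports.

Local Open Scope classical_set_scope.
Local Open Scope ring_scope.

(** Let [tau_p(x, y)] be the probability that [x] and [y] are joined by an open
    path, and [a_n(k)] its value between the origin and a point at height [k]
    above a vertex at distance [n] from the root; the automorphisms of the tree
    make it independent of that vertex ([sphere_transitive], [two_pointE]).
    Harris' inequality and the symmetries give [a_m(k) a_n(l) <= a_(m+n)(k+l)]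
    ([polar_mul]), so that [alpha(p)] exists and [a_n(0) <= alpha(p)^n]
    ([root_limit], [polar_rate]).  The theorem holds because
    [alpha(p) < 1/(d-1)] for [p < pc], while [alpha(pc) = 1/(d-1)]: then [pc] is
    the only point of [[0, pc]] at which [alpha] takes the value [1/(d-1)].

    Below [pc].  For a finite set [L] containing the origin, let [phi_p(L)]
    ([exit_sum]) be the expected number of open edges that leave [L] from the
    cluster of the origin inside [L].  By the argument of Duminil-Copin and
    Tassion, if [phi_p(L) >= 1] for all [L] then the origin percolates with
    positive probability at every larger parameter ([theta_ge]), hence there is
    an infinite cluster almost surely by the zero-one law ([percolates_01]).  So
    [p < pc] gives a set [L] with [phi_p(L) < 1], and iterating the Simon-Lieb
    inequality ([simon_lieb]) makes the sum of [tau_p(o, z)] over far points [z]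
    exponentially small in their distance ([two_point_sum_decay]).  A sphere of
    radius [n] of the tree has about [(d-1)^n] points, whence
    [a_n(0) <= t^n] with [t < 1/(d-1)] ([polar_subcritical]).

    At [pc].  Connection probabilities are suprema of polynomials in [p], so the
    bound [alpha <= 1/(d-1)] passes to [pc] ([alpha_pc_le]).  Suppose now that
    [alpha(pc) < 1/(d-1)].  As [a_n(k)^2 <= a_2n(0) <= alpha^(2n)], the expected
    number of points of a given level joined to the origin is at most a constant
    [K].  Explore the cluster of the origin in the half-space below level [j]:
    if it reaches level [j] in at most [M] points, then with probability at
    least [(1-p)^M] all the edges that lead up from them are closed.  Hence the
    cluster cannot climb for ever, and [a_0(j)] tends to [0] ([line_decay]).
    Since [a_n(k)^2 <= a_0(2k)] too, dominated convergence makes the expected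
    number of points joined to the origin at height [J] small, and a cylinder
    that is high, and much wider than high, has [phi_pc(L) < 1]
    ([cylinder_exit_sum_lt1]).  This persists for [p] slightly larger than [pc] by
    continuity; but then the clusters have bounded expected size
    ([two_point_sum_bound]) and are finite, which contradicts the definition of
    [pc] ([alpha_pc_ge]).

    All estimates concern expectations over a finite list of edges, defined by
    recursion on the list; the measures enter through the events that finitely
    many edges determine ([pr_dep]). *)

(** * Expectations over finitely many edges *)

Section FiniteExpectation.
Variables (R : realType) (E : eqType).
Implicit Types (p : R) (s : seq E) (w : E -> bool) (F G : (E -> bool) -> R).

Definition upd w f b : E -> bool := fun g => if g == f then b else w g.

(** The expectation of [F] when the edges of [s] are independently open with
    probability [p] and the others are frozen in the state [w].  The recursion
    turns independence, Harris' inequality and Russo's formula into inductions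
    on [s]. *)
Fixpoint expect p s F w : R :=
  if s is f :: s' then
    p * expect p s' F (upd w f true) + (1 - p) * expect p s' F (upd w f false)
  else F w.

Definition agree (a : pred E) w w' := forall f, a f -> w f = w' f.

Definition depends (T : Type) (a : pred E) (F : (E -> bool) -> T) :=
  forall w w', agree a w w' -> F w = F w'.

Definition increasing_in F :=
  forall w w', (forall f, w f -> w' f) -> F w <= F w'.

Lemma upd_same w f b : upd w f b f = b.
Proof. by rewrite /upd eqxx. Qed.

Lemma upd_id w f : upd w f (w f) = w.
Proof. by apply/funext => g; rewrite /upd; case: eqP => // ->. Qed.

Lemma upd_comm w f g b c : f != g ->
  upd (upd w f b) g c = upd (upd w g c) f b.
Proof.
move=> fg; apply/funext => h; rewrite /upd.
by case: (eqVneq h g) => // ->; rewrite eq_sym (negbTE fg).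
Qed.

Lemma upd_upd w f b c : upd (upd w f b) f c = upd w f c.
Proof. by apply/funext => h; rewrite /upd; case: eqP. Qed.

Lemma upd_agree a w w' f b : agree a w w' -> agree a (upd w f b) (upd w' f b).
Proof. by move=> h g ag; rewrite /upd; case: eqP => // _; exact: h. Qed.

Lemma agree_upd a w f b : ~~ a f -> agree a (upd w f b) w.
Proof.
by move=> af g ag; rewrite /upd; case: eqP => // gf; rewrite -gf ag in af.
Qed.

Lemma upd_mono w w' f b : (forall f, w f -> w' f) ->
  forall g, upd w f b g -> upd w' f b g.
Proof. by move=> h g; rewrite /upd; case: eqP => // _; exact: h. Qed.

Lemma upd_ft w f g : upd w f false g -> upd w f true g.
Proof. by rewrite /upd; case: eqP. Qed.

Lemma expect_cst p s c w : expect p s (fun=> c) w = c.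
Proof. by elim: s w => //= f s IH w; rewrite !IH; ring. Qed.

Lemma expectD p s F G w :
  expect p s (fun w => F w + G w) w = expect p s F w + expect p s G w.
Proof. by elim: s w => //= f s IH w; rewrite !IH; ring. Qed.

Lemma expectB p s F G w :
  expect p s (fun w => F w - G w) w = expect p s F w - expect p s G w.
Proof. by elim: s w => //= f s IH w; rewrite !IH; ring. Qed.

Lemma expectZ p s c F w : expect p s (fun w => c * F w) w = c * expect p s F w.
Proof. by elim: s w => //= f s IH w; rewrite !IH; ring. Qed.

Lemma expect_sum p s (I : Type) (r : seq I) (P : pred I) (F : I -> _) w :
  expect p s (fun w => \sum_(i <- r | P i) F i w) w =
  \sum_(i <- r | P i) expect p s (F i) w.
Proof.
elim: r => [|i r IH].
  under [RHS]eq_bigr do []; rewrite big_nil -[RHS](expect_cst p s 0 w).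
  by congr (expect _ _ _ _); apply/funext => u; rewrite big_nil.
rewrite big_cons -IH; case: ifP => Pi.
  rewrite -expectD; congr (expect _ _ _ _); apply/funext => u.
  by rewrite big_cons Pi.
by congr (expect _ _ _ _); apply/funext => u; rewrite big_cons Pi.
Qed.

(** The configurations that the recursion produces coincide with [w] off [s].
    When [w] is closed, every open path thus consists of edges of [s]. *)
Lemma expect_le_supp p s F G w : 0 <= p <= 1 ->
  (forall w', agree [pred f | f \notin s] w' w -> F w' <= G w') ->
  expect p s F w <= expect p s G w.
Proof.
move=> /andP[p0 p1]; elim: s w => /= [|f s IH] w h; first exact: h.
have q0 : 0 <= 1 - p by rewrite subr_ge0.
apply: lerD; apply: ler_wpM2l => //; apply: IH => w' aw; apply: h => g /=;
  by rewrite inE negb_or => /andP[gf gs]; rewrite aw//= /upd (negbTE gf).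
Qed.

Lemma expect_le p s F G w : 0 <= p <= 1 -> (forall w', F w' <= G w') ->
  expect p s F w <= expect p s G w.
Proof. by move=> p01 h; apply: expect_le_supp. Qed.

Lemma expect_ge0 p s F w : 0 <= p <= 1 -> (forall w', 0 <= F w') ->
  0 <= expect p s F w.
Proof. by move=> p01 h; rewrite -(expect_cst p s 0 w); apply: expect_le. Qed.

Lemma expect_le1 p s F w : 0 <= p <= 1 -> (forall w', F w' <= 1) ->
  expect p s F w <= 1.
Proof. by move=> p01 h; rewrite -(expect_cst p s 1 w); apply: expect_le. Qed.

Lemma expect_depends p s a F : depends a F -> depends a (expect p s F).
Proof.
move=> h; elim: s => //= f s IH w w' ag.
by rewrite (IH _ _ (upd_agree _ _ ag)) (IH _ _ (upd_agree _ _ ag)).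
Qed.

Lemma depends_upd (T : Type) a (F : _ -> T) w f b : depends a F -> ~~ a f ->
  F (upd w f b) = F w.
Proof. by move=> h af; apply: h; apply: agree_upd. Qed.

Lemma expect_filter p s a F w : depends a F -> expect p s F w = expect p [seq f
  <- s | a f] F w.
Proof.
move=> h; elim: s w => //= f s IH w; case: ifPn => af /=; first by rewrite !IH.
have h' := expect_depends p s h.
by rewrite !(depends_upd _ _ h' af) IH; ring.
Qed.

(** Independence of disjoint families of edges: by induction on [s], the next
    edge influences one of the two factors only. *)
Lemma expect_indep p s a F G w : depends a F -> depends (predC a) G ->
  expect p s (fun w => F w * G w) w = expect p s F w * expect p s G w.
Proof.
move=> hF hG; elim: s w => //= f s IH w; rewrite !IH.
have [af|af] := boolP (a f).
  have h' := expect_depends p s hG.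
  have naf : ~~ predC a f by rewrite /= af.
  by rewrite !(depends_upd _ _ h' naf); ring.
have h' := expect_depends p s hF.
by rewrite !(depends_upd _ _ h' af); ring.
Qed.

Lemma expect_edge p s f w : uniq s ->
  expect p s (fun w => (w f)%:R) w = if f \in s then p else (w f)%:R.
Proof.
elim: s w => //= g s IH w /andP[gs us]; rewrite !IH// inE.
case: (eqVneq f g) => [->|fg] /=.
  by rewrite (negbTE gs) !upd_same mulr1 mulr0 addr0.
rewrite /upd (negbTE fg); case: ifP => _; rewrite -mulrDl.
  by rewrite addrC subrK mul1r.
by rewrite addrC subrK mul1r.
Qed.

Lemma expect_move p f s t F w : f \notin s ->
  expect p (s ++ f :: t) F w = expect p (f :: s ++ t) F w.
Proof.
elim: s w => //= g s IH w; rewrite inE negb_or => /andP[fg fs].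
rewrite !IH//= ![upd (upd w f _) g _]upd_comm//; ring.
Qed.

Lemma expect_perm p s t F w : uniq s -> perm_eq s t ->
  expect p s F w = expect p t F w.
Proof.
elim: s t w => [|f s IH] t w; first by move=> _;
  rewrite perm_sym => /perm_nilP ->.
move=> us pst; have ut : uniq t by rewrite -(perm_uniq pst).
have ft : f \in t by rewrite -(perm_mem pst) mem_head.
case/splitPr: ft ut pst => t1 t2 ut pst.
have ft1 : f \notin t1.
  move: ut; rewrite cat_uniq => /and3P[_ /hasPn/(_ f)]; rewrite mem_head.
  by move/(_ isT).
rewrite (expect_move _ _ _ _ ft1) /=.
have pst' : perm_eq s (t1 ++ t2).
  by rewrite -(perm_cons f) (perm_trans pst)// -cat1s perm_catCA.
by rewrite !(IH (t1 ++ t2))//; case/andP: us.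
Qed.

Lemma increasing_expect p s F : 0 <= p <= 1 -> increasing_in F ->
  increasing_in (expect p s F).
Proof.
move=> /andP[p0 p1] iF; have q0 : 0 <= 1 - p by rewrite subr_ge0.
elim: s => //= f s IH w w' h.
by apply: lerD; apply: ler_wpM2l => //; apply: IH => g; apply: upd_mono.
Qed.

(** Edges of [t] outside [s] start closed, and opening some of them can only
    increase [F]. *)
Lemma expect_sub p s t F w : 0 <= p <= 1 -> increasing_in F ->
  uniq s -> uniq t -> {subset s <= t} ->
  {in t, forall f, f \notin s -> w f = false} ->
  expect p s F w <= expect p t F w.
Proof.
move=> p01 iF us ut st wf.
have pt : perm_eq ([seq f <- t | f \notin s] ++ s) t.
  apply: uniq_perm => //.
    rewrite cat_uniq filter_uniq// us andbT/=; apply/hasPn => f fs.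
    by rewrite mem_filter fs.
  move=> f; rewrite mem_cat mem_filter; case: (boolP (f \in s)) => //= fs.
    by rewrite st.
  by rewrite orbF.
rewrite -(expect_perm p F w _ pt); last by rewrite (perm_uniq pt).
have : all (fun f => ~~ w f) [seq f <- t | f \notin s].
  by apply/allP => f; rewrite mem_filter => /andP[fs ft]; rewrite wf.
elim: [seq _ <- _ | _] => //= f r IH /andP[nwf wr].
apply: (le_trans (IH wr)).
set g := expect p (r ++ s) F.
have -> : upd w f false = w by rewrite -[RHS](upd_id w f) (negbTE nwf).
have : g w <= g (upd w f true).
  apply: increasing_expect => // h; rewrite /upd; case: eqP => //.
case/andP: p01 => p0 p1; nra.
Qed.

(** Harris' inequality.  In the induction, the two conditional expectations are
    monotone in the same direction in the state of the first edge, and two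
    increasing functions of one bit are positively correlated. *)
Lemma harris p s F G w : 0 <= p <= 1 -> increasing_in F -> increasing_in G ->
  expect p s F w * expect p s G w <= expect p s (fun w => F w * G w) w.
Proof.
move=> p01 iF iG; elim: s w => //= f s IH w.
have hF := increasing_expect s p01 iF (@upd_ft w f).
have hG := increasing_expect s p01 iG (@upd_ft w f).
apply: (@le_trans _ _ (p * (expect p s F (upd w f true) * expect p s G (upd w f
  true))
   + (1 - p) * (expect p s F (upd w f false) * expect p s G (upd w f false)))).
  have : 0 <= p * (1 - p) * ((expect p s F (upd w f true) - expect p s F (upd w
    f false))
     * (expect p s G (upd w f true) - expect p s G (upd w f false))).
    by case/andP: p01 => p0 p1; rewrite !mulr_ge0// subr_ge0.
  by move=> h; rewrite -subr_ge0; move: h; congr (_ <= _); ring.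
by case/andP: p01 => p0 p1; apply: lerD; apply: ler_wpM2l => //;
  rewrite subr_ge0.
Qed.

Lemma expect_push p s F w f b : f \notin s ->
  expect p s F (upd w f b) = expect p s (fun w => F (upd w f b)) w.
Proof.
elim: s w => //= g s IH w; rewrite inE negb_or => /andP[fg fs].
by rewrite ![upd (upd w f _) g _]upd_comm// !IH.
Qed.

(** Russo's formula: every edge carries its own copy of [p], and differentiating
    in one copy compares the two states of that edge. *)
Lemma russo p s F w : uniq s ->
  is_derive p (1:R) (fun p => expect p s F w)
   (\sum_(f <- s) expect p s (fun w => F (upd w f true) - F (upd w f false)) w).
Proof.
elim: s w F => [|f s IH] w F /=.
  by move=> _; rewrite big_nil; exact: is_derive_cst.
move=> /andP[fs us].
have I1 := IH (upd w f true) F us.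
have I0 := IH (upd w f false) F us.
apply: is_derive_eq.
have hd b : expect p s (fun u => F (upd u f true) - F (upd u f false)) (upd w f
  b)
    = expect p s F (upd w f true) - expect p s F (upd w f false).
  rewrite !expect_push// -expectB; congr (expect _ _ _ _).
  by apply/funext => u; rewrite !upd_upd.
rewrite big_cons /= !hd big_split /= -!mulr_sumr /GRing.scale /=; ring.
Qed.

Lemma continuous_expect s F w : uniq s -> continuous (fun p => expect p s F w).
Proof.
move=> us p; apply: differentiable_continuous; apply/derivable1_diffP.
by have [] := russo p F w us.
Qed.

Lemma expect_mono_p p p' s F w : 0 <= p -> p <= p' -> p' <= 1 ->
  increasing_in F ->
  expect p s F w <= expect p' s F w.
Proof.
move=> p0 pp p1 iF; have p01 : 0 <= p' <= 1 by apply/andP; split; lra.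
elim: s w => //= f s IH w.
have := increasing_expect s p01 iF (@upd_ft w f).
have := IH (upd w f true); have := IH (upd w f false).
set a := expect p s F _; set b := expect p' s F _; set c := expect p s F _.
set d := expect p' s F _ => h1 h2 h3.
have q0 : 0 <= 1 - p by lra.
have := ler_wpM2l p0 h2; have := ler_wpM2l q0 h1; nra.
Qed.

Lemma expect_map p s (h h' : E -> E) F w : cancel h h' -> cancel h' h ->
  expect p (map h s) F w = expect p s (fun u => F (u \o h')) (w \o h).
Proof.
move=> hK h'K; elim: s w => /= [|f s IH] w.
  by congr F; apply/funext => g /=; rewrite h'K.
have uh b : upd w (h f) b \o h = upd (w \o h) f b.
  by apply/funext => g; rewrite /upd /= (can_eq hK).
by rewrite !IH !uh.
Qed.

Lemma depends_sub (T : Type) (a b : pred E) (F : (E -> bool) -> T) :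
  (forall f, a f -> b f) -> depends a F -> depends b F.
Proof. by move=> ab h w w' ag; apply: h => f /ab; exact: ag. Qed.

Lemma expect_prod p s (r : seq E) c (F : E -> (E -> bool) -> R) w :
  0 <= p <= 1 -> uniq r -> 0 <= c -> (forall f w, 0 <= F f w) ->
  (forall f, depends (pred1 f) (F f)) ->
  (forall f, f \in r -> c <= expect p s (F f) w) ->
  c ^+ size r <= expect p s (fun w => \prod_(f <- r) F f w) w.
Proof.
move=> p01 + c0 F0 dF; elim: r => /= [_ _|f r IH /andP[fr ur] h].
  rewrite expr0 (_ : (fun w => _) = fun=> 1) ?expect_cst//.
  by apply/funext => u; rewrite big_nil.
rewrite (_ : (fun w => _) = fun w => F f w * \prod_(f <- r) F f w); last first.
  by apply/funext => u; rewrite big_cons.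
rewrite (@expect_indep p s (pred1 f) (F f) (fun w => \prod_(g <- r) F g w))//;
  last first.
  move=> u v uv; rewrite big_seq [RHS]big_seq; apply: eq_bigr => g gr.
  apply: dF => k /= /eqP ->; apply: uv => /=.
  by apply: contraNneq fr => <-.
rewrite exprS; apply: ler_pM => //.
- by rewrite exprn_ge0.
- by apply: h; rewrite mem_head.
- by apply: IH => // g gr; apply: h; rewrite inE gr orbT.
Qed.

End FiniteExpectation.

(** The possible values of a random subset of [l] written as a filter of [l], so
    that one can sum over the values of an explored set. *)
Definition sublists (T : eqType) (l : seq T) : seq (seq T) :=
  undup [seq mask (val m) l | m <- enum {: (size l).-tuple bool}].

Lemma sublists_sub (T : eqType) (l S : seq T) : S \in sublists l ->
  {subset S <= l}.
Proof. by rewrite mem_undup => /mapP[m _ ->] x /mem_mask. Qed.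

Lemma filter_sublists (T : eqType) (a : pred T) (l : seq T) :
  [seq x <- l | a x] \in sublists l.
Proof.
rewrite mem_undup filter_mask; apply/mapP.
exists [tuple of map a (in_tuple l)] => //; exact: mem_enum.
Qed.

Lemma sum_sublists (R : realType) (T : eqType) (a : pred T) (l : seq T)
    (F : seq T -> R) :
  \sum_(S <- sublists l) ([seq x <- l | a x] == S)%:R * F S = F ([seq x <- l |
    a x]).
Proof.
rewrite (bigD1_seq ([seq x <- l | a x])) ?filter_sublists ?undup_uniq//= eqxx
  mul1r.
rewrite big1 ?addr0// => S /negbTE; rewrite eq_sym => ->.
by rewrite mul0r.
Qed.

Lemma ler_sum_sub (R : realType) (I : eqType) (r r' : seq I) (F : I -> R) :
  uniq r -> {subset r <= r'} -> (forall i, 0 <= F i) ->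
  \sum_(i <- r) F i <= \sum_(i <- r') F i.
Proof.
move=> ur rr' F0; have -> : \sum_(i <- r) F i = \sum_(i <- undup r' | i \in r)
  F i.
  rewrite -[RHS]big_filter; apply: perm_big; apply: uniq_perm => //.
    by rewrite filter_uniq// undup_uniq.
  move=> i; rewrite mem_filter mem_undup.
  by case: (boolP (i \in r)) => // /rr' ->.
apply: (@le_trans _ _ (\sum_(i <- undup r') F i)).
  rewrite [leRHS](bigID (mem r))/= lerDl; exact: sumr_ge0.
elim: r' {rr'} => [|i r' IH]; first by rewrite big_nil.
rewrite [leRHS]big_cons /=; case: ifP => _; last by rewrite big_cons lerD2l.
by rewrite (le_trans IH)// lerDr.
Qed.

(** * Connections and two-point functions *)

Section Connections.
Variables (V : countType) (e : rel V).
Implicit Types (w : edge e -> bool) (a b : pred V) (x y z : V).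

(** An edge lists its ends in the order of the enumeration of the vertices;
    [ends] forgets this order. *)
Definition ends (f : edge e) x y := (val f == (x, y)) || (val f == (y, x)).

Definition inside a (f : edge e) := a (val f).1 && a (val f).2.

Definition touch a (f : edge e) := a (val f).1 || a (val f).2.

Lemma edgeP (f : edge e) :
  e (val f).1 (val f).2 && (pickle (val f).1 < pickle (val f).2)%N.
Proof. by case: f. Qed.

Lemma endsC f x y : ends f x y = ends f y x.
Proof. by rewrite /ends orbC. Qed.

Lemma ends_inside f x y a : ends f x y -> inside a f = a x && a y.
Proof. by rewrite /inside => /orP[] /eqP -> //=; rewrite andbC. Qed.

Lemma ends_touch f x y a : ends f x y -> touch a f = a x || a y.
Proof. by rewrite /touch => /orP[] /eqP -> //=; rewrite orbC. Qed.

Lemma ends_val f : ends f (val f).1 (val f).2.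
Proof. by rewrite /ends -surjective_pairing eqxx. Qed.

Lemma ends_inj f g x y : ends f x y -> ends g x y -> f = g.
Proof.
have := edgeP f; have := edgeP g=> /andP[_ hg] /andP[_ hf].
move=> /orP[] /eqP ef /orP[] /eqP eg; apply: val_inj => /=;
  rewrite ?ef ?eg//; move: hf hg; rewrite ef eg /= => hf hg.
- by have := ltn_trans hf hg; rewrite ltnn.
- by have := ltn_trans hf hg; rewrite ltnn.
Qed.

Lemma open_adjP w x y :
  reflect (exists2 f, ends f x y & w f) (open_adj w x y).
Proof.
apply: (iffP orP) => [[]|].
- by case: insubP => [f _ ef wf|//]; exists f => //; rewrite /ends ef eqxx.
- by case: insubP => [f _ ef wf|//]; exists f => //; rewrite /ends ef eqxx orbT.
- case=> f /orP[] /eqP ef wf; [left|right].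
    have := edgeP f; rewrite ef => h.
    by rewrite insubT/=; congr (is_true (w _)): wf; apply: val_inj.
  have := edgeP f; rewrite ef => h.
  by rewrite insubT/=; congr (is_true (w _)): wf; apply: val_inj.
Qed.

Lemma open_adjC w x y : open_adj w x y = open_adj w y x.
Proof. by rewrite /open_adj orbC. Qed.

Definition linked a w x y : bool :=
  `[< exists q, [/\ path (open_adj w) x q, last x q = y & all a (x :: q)] >].

Lemma linked_refl a w x : a x -> linked a w x x.
Proof. by move=> ax; apply/asboolP; exists [::]; rewrite /= ax. Qed.

Lemma linked_step a w x y z : linked a w x y -> open_adj w y z -> a z ->
  linked a w x z.
Proof.
move=> /asboolP[q [pq lq aq]] yz az; apply/asboolP; exists (rcons q z).
by rewrite rcons_path pq lq yz last_rcons -rcons_cons all_rcons az aq.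
Qed.

Lemma linked_ind (P : V -> Prop) a w x y : linked a w x y -> P x ->
  (forall u v, linked a w x u -> P u -> open_adj w u v -> a v -> P v) -> P y.
Proof.
move=> /asboolP[q]; elim/last_ind: q y => [|q z IH] y [pq lq aq] Px h.
  by rewrite -lq.
move: pq lq aq; rewrite rcons_path last_rcons -rcons_cons all_rcons.
move=> /andP[pq lz] <- /andP[az aq]; apply: (h (last x q)) => //.
  by apply/asboolP; exists q.
exact: IH.
Qed.

Lemma linked_ends a w x y : linked a w x y -> a x /\ a y.
Proof.
move=> h; have ax : a x by case/asboolP: h => q [_ _ /andP[]].
by split => //; apply: (linked_ind (P := fun z => a z) h).
Qed.

Lemma linked_trans a w x y z : linked a w x y -> linked a w y z ->
  linked a w x z.
Proof.
move=> xy yz; apply: (linked_ind (P := fun z => linked a w x z) yz) =>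
  // u v _ xu uv av.
exact: linked_step uv av.
Qed.

Lemma linked_sym a w x y : linked a w x y -> linked a w y x.
Proof.
move=> xy; have [ax ay] := linked_ends xy.
apply: (linked_ind (P := fun z => linked a w z x) xy); first exact: linked_refl.
move=> u v xu ux uv av; apply: linked_trans ux.
by apply: (linked_step (linked_refl _ av)); [rewrite open_adjC|exact:
  (linked_ends xu).2].
Qed.

Lemma linkedC a w x y : linked a w x y = linked a w y x.
Proof. by apply/idP/idP; exact: linked_sym. Qed.

Lemma linked_sub a a' w w' x y : (forall z, a z -> a' z) ->
  (forall f, inside a f -> w f -> w' f) -> linked a w x y -> linked a' w' x y.
Proof.
move=> aa ww xy; have [ax _] := linked_ends xy.
apply: (linked_ind (P := fun z => linked a' w' x z) xy).
  by apply: linked_refl; exact: aa.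
move=> u v xu IH /open_adjP[f fuv wf] av; apply: (linked_step IH);
  last exact: aa.
apply/open_adjP; exists f => //; apply: ww => //.
by rewrite (ends_inside _ fuv) av (linked_ends xu).2.
Qed.

Lemma linked_monow a w w' x y : (forall f, w f -> w' f) -> linked a w x y ->
  linked a w' x y.
Proof. by move=> h; apply: linked_sub => // f _; exact: h. Qed.

Lemma linked_depends a x y : depends (inside a) (fun w => linked a w x y).
Proof.
move=> w w' ag; apply/idP/idP; apply: linked_sub => // f af;
  by rewrite ag.
Qed.

(** The first edge by which a path leaves [b]: what precedes it stays in [b]. *)
Lemma linked_exit a b w x y : linked a w x y -> b x -> ~~ b y ->
  exists u v, [/\ linked (fun z => a z && b z) w x u, open_adj w u v, a v,
    ~~ b v
    & linked a w v y].
Proof.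
move=> xy bx nby; have [ax _] := linked_ends xy.
have : linked (fun z => a z && b z) w x y \/ exists u v, [/\ linked (fun z =>
  a z && b z) w x u,
    open_adj w u v, a v, ~~ b v & linked a w v y].
  apply: (linked_ind (P := fun y => linked (fun z =>
    a z && b z) w x y \/ exists u v,
    [/\ linked (fun z => a z && b z) w x u, open_adj w u v, a v,
      ~~ b v & linked a w v y]) xy).
    by left; apply: linked_refl; rewrite /= ax.
  move=> u v xu [cu|[u' [v' [h1 h2 h3 h4 h5]]]] uv av; last first.
    by right; exists u', v'; split => //; exact: linked_step uv av.
  case: (boolP (b v)) => bv; first by left; apply: (linked_step cu uv);
    rewrite /= av.
  by right; exists u, v; split => //; exact: linked_refl.
by case=> // /linked_ends[_ /andP[_]]; rewrite (negbTE nby).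
Qed.

(** The last edge by which a path leaves [b], after which it avoids [b]: this is
    the first exit of the reversed path from the complement of [b]. *)
Lemma linked_last_exit a b w x y : linked a w x y -> b x -> ~~ b y ->
  exists u v, [/\ linked a w x u, b u, open_adj w u v & linked (fun z =>
    a z && ~~ b z) w v y].
Proof.
move=> /linked_sym yx bx nby.
have nbx : ~~ predC b x by rewrite /= negbK.
have [v [u [h1 h2 h3 h4 h5]]] := linked_exit yx nby nbx.
exists u, v; split; [exact: linked_sym| by rewrite /= negbK in h4 | |exact:
  linked_sym].
by rewrite open_adjC.
Qed.

Lemma open_connectedE w x y : open_connected w x y <-> linked predT w x y.
Proof.
split => [[q pq lq]|/asboolP[q [pq lq _]]]; last by exists q.
by apply/asboolP; exists q; split => //; apply/allP.
Qed.

End Connections.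
Arguments linked {V e} a w x y.

Definition closed_config (E : Type) : E -> bool := fun=> false.

Section Graph.
Variables (R : realType) (V : countType) (e : rel V).
Variable nb : V -> seq V.
Hypothesis nbP : forall x y, (y \in nb x) = e x y.
Hypothesis e_sym : symmetric e.
Hypothesis e_irr : irreflexive e.
Implicit Types (w : edge e -> bool) (a : pred V) (x y z o : V) (S L : seq V).
Implicit Types (p : R) (s : seq (edge e)).

Let cl0 : edge e -> bool := @closed_config (edge e).

Lemma edge_ends x y : e x y -> exists f : edge e, ends f x y.
Proof.
move=> exy; case: (ltngtP (pickle x) (pickle y)) => h.
- have H : e (x, y).1 (x, y).2 && (pickle (x, y).1 < pickle (x, y).2)%N.
    by rewrite exy h.
  by exists (exist _ (x, y) H); rewrite /ends eqxx.
- have H : e (y, x).1 (y, x).2 && (pickle (y, x).1 < pickle (y, x).2)%N.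
    by rewrite e_sym exy h.
  by exists (exist _ (y, x) H); rewrite /ends eqxx orbT.
- by have := e_irr x; rewrite {2}(pcan_inj (@pickleK V) h) exy.
Qed.

Lemma ends_adj (f : edge e) x y : ends f x y -> e x y.
Proof.
by have /andP[h _] := valP f; move=> /orP[] /eqP E; move: h; rewrite E//= e_sym.
Qed.

Definition mk_edge x y : option (edge e) :=
  if insub (x, y) is Some f then Some f else insub (y, x).

Lemma mk_edgeE (f : edge e) x y : ends f x y -> mk_edge x y = Some f.
Proof.
have := edgeP f; rewrite /mk_edge => /= vf.
case/orP => /eqP E; rewrite E /= in vf; last first.
  case: insubP => [g _ eg|_].
    by congr Some; apply: (@ends_inj _ _ _ _ y x);
      rewrite /ends ?E ?eg eqxx ?orbT.
  rewrite insubT; congr Some; apply: val_inj; exact/esym.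
by rewrite insubT; congr Some; apply: val_inj; exact/esym.
Qed.

Definition touching_edges L : seq (edge e) :=
  undup (flatten [seq pmap (mk_edge x) (nb x) | x <- L]).

Definition inner_edges L := [seq f <- touching_edges L | inside (mem L) f].

Definition bdry L := [seq f <- touching_edges L | ~~ inside (mem L) f].

Lemma touching_edges_uniq L : uniq (touching_edges L).
Proof. exact: undup_uniq. Qed.

Lemma mem_touching_edges L f : f \in touching_edges L = touch (mem L) f.
Proof.
rewrite mem_undup; apply/flatten_mapP/orP => [[x xL]|].
  rewrite mem_pmap => /mapP[y _]; rewrite /mk_edge.
  case: insubP => [g _ eg [->]|_]; first by left; rewrite eg.
  by case: insubP => // g _ eg [->]; right; rewrite eg.
move=> h; case/andP: (edgeP f) => ef _.
case: h => h; [exists (val f).1|exists (val f).2] => //; rewrite mem_pmap.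
  apply/mapP; exists (val f).2; first by rewrite nbP.
  by rewrite (mk_edgeE (ends_val f)).
apply/mapP; exists (val f).1; first by rewrite nbP e_sym.
by rewrite (@mk_edgeE f)// endsC; exact: ends_val.
Qed.

Lemma mem_inner_edges L f : f \in inner_edges L = inside (mem L) f.
Proof.
rewrite mem_filter mem_touching_edges /inside /touch /=.
by case: (_ \in _); case: (_ \in _).
Qed.

Lemma mem_bdry L f : f \in bdry L = touch (mem L) f && ~~ inside (mem L) f.
Proof. by rewrite mem_filter mem_touching_edges andbC. Qed.

Lemma inner_edges_uniq L : uniq (inner_edges L).
Proof. by rewrite filter_uniq// touching_edges_uniq. Qed.

Lemma bdry_uniq L : uniq (bdry L).
Proof. by rewrite filter_uniq// touching_edges_uniq. Qed.

Definition inner L (f : edge e) := if (val f).1 \in L then (val f).1 else (val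
  f).2.

Definition outer L (f : edge e) := if (val f).1 \in L then (val f).2 else (val
  f).1.

Lemma bdryP L f : f \in bdry L ->
  [/\ inner L f \in L, outer L f \notin L & ends f (inner L f) (outer L f)].
Proof.
rewrite mem_bdry /touch /inside /inner /outer /= => /andP[h1 h2].
case: ifP h1 h2 => /= h1 h2 h3; first by split => //; exact: ends_val.
by rewrite h1 h2; split => //; rewrite endsC; exact: ends_val.
Qed.

Lemma ends_bdry L f x y : ends f x y -> x \in L -> y \notin L ->
  [/\ f \in bdry L, inner L f = x & outer L f = y].
Proof.
move=> fxy xL yL; rewrite mem_bdry (ends_touch _ fxy) (ends_inside _ fxy) /=.
rewrite xL (negbTE yL) /inner /outer; case/orP: fxy => /eqP -> /=.
  by rewrite xL.
by rewrite (negbTE yL).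
Qed.

Definition two_point_in p L o x := expect p (inner_edges L) (fun w =>
  (linked (mem L) w o x)%:R : R) cl0.

(** The quantity [phi_p(L)] of Duminil-Copin and Tassion: the expected number of
    open edges that leave [L] from the cluster of [o] inside [L]. *)
Definition exit_sum p L o :=
  \sum_(f <- bdry L) p * two_point_in p L o (inner L f).

Definition two_point_fin p s x y : R := expect p s (fun w =>
  (linked predT w x y)%:R) cl0.

(** The probability that [x] and [y] are joined in the infinite graph
    ([pr_linked]), as the supremum of its finite-volume versions. *)
Definition two_point p x y :=
  sup [set two_point_fin p s x y | s in [set s | uniq s]].

Lemma increasing_linked a x y :
  increasing_in (fun w : edge e -> bool => (linked a w x y)%:R : R).
Proof.
move=> w w' ww; rewrite ler_nat; case: (boolP (linked a w x y)) => // h.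
by rewrite (linked_monow ww h).
Qed.

Lemma depends_linked a x y :
  depends (inside a) (fun w : edge e -> bool => (linked a w x y)%:R : R).
Proof. by move=> w w' ag; rewrite (linked_depends _ _ ag). Qed.

Lemma leb_nat (b c : bool) : (b -> c) -> (b%:R <= c%:R :> R).
Proof. by rewrite ler_nat; case: b; case: c => // /(_ isT). Qed.

Lemma natb_le1 (b : bool) : b%:R <= 1 :> R.
Proof. by case: b. Qed.

Lemma two_point_in_ge0 p L o x : 0 <= p <= 1 -> 0 <= two_point_in p L o x.
Proof. by move=> p01; apply: expect_ge0. Qed.

Lemma exit_sum_ge0 p L o : 0 <= p <= 1 -> 0 <= exit_sum p L o.
Proof.
move=> p01; apply: sumr_ge0 => f _; rewrite mulr_ge0 ?two_point_in_ge0//.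
by case/andP: p01.
Qed.

Section FixedP.
Variable p : R.
Hypothesis p01 : 0 <= p <= 1.

Lemma two_point_fin_ge0 s x y : 0 <= two_point_fin p s x y.
Proof. exact: expect_ge0. Qed.

Lemma two_point_fin_le1 s x y : two_point_fin p s x y <= 1.
Proof. by apply: expect_le1 => // w; exact: natb_le1. Qed.

Lemma two_point_fin_sub s t x y : uniq s -> uniq t -> {subset s <= t} ->
  two_point_fin p s x y <= two_point_fin p t x y.
Proof. by move=> us ut st; apply: expect_sub => //;
  exact: increasing_linked. Qed.

Lemma two_point_has_sup x y : has_sup [set two_point_fin p s x y | s in [set s
  | uniq s]].
Proof.
split; first by exists (two_point_fin p [::] x y); exists [::].
by exists 1 => _ [s _ <-]; exact: two_point_fin_le1.
Qed.

Lemma two_point_fin_le s x y : uniq s -> two_point_fin p s x y <=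
  two_point p x y.
Proof. by move=> us; apply: sup_upper_bound; [exact: two_point_has_sup|exists
  s]. Qed.

Lemma two_point_le x y c : (forall s, uniq s -> two_point_fin p s x y <= c) ->
  two_point p x y <= c.
Proof.
move=> h; apply: sup_le_ub; first by exists (two_point_fin p [::] x y);
  exists [::].
by move=> _ [s us <-]; exact: h.
Qed.

Lemma two_point_ge0 x y : 0 <= two_point p x y.
Proof. exact: le_trans (two_point_fin_ge0 _ _ _) (@two_point_fin_le [::] x
  y isT). Qed.

Lemma two_point_le1 x y : two_point p x y <= 1.
Proof. by apply: two_point_le => s _; exact: two_point_fin_le1. Qed.

Lemma two_point_lt x y c : c < two_point p x y -> exists2 s,
  uniq s & c < two_point_fin p s x y.
Proof.
move=> /(@sup_gt _ _ c)/= [|_ [s us <-] h]; last by exists s.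
exact: (two_point_has_sup x y).1.
Qed.

Lemma two_pointC x y : two_point p x y = two_point p y x.
Proof.
rewrite /two_point /two_point_fin; congr sup; apply: eq_imagel => s _.
by congr expect; apply/funext => w; rewrite linkedC.
Qed.

(** By Harris' inequality, on a finite list of edges large enough for both
    factors. *)
Lemma two_point_mul x y z : two_point p x y * two_point p y z <=
  two_point p x z.
Proof.
have h s t : uniq s -> uniq t -> two_point_fin p s x y * two_point_fin p t y z
  <= two_point p x z.
  move=> us ut; pose r := undup (s ++ t); have ur : uniq r := undup_uniq _.
  have sr : {subset s <= r} by move=> f fs; rewrite mem_undup mem_cat fs.
  have tr : {subset t <= r} by move=> f ft; rewrite mem_undup mem_cat ft orbT.
  apply: le_trans (two_point_fin_le x z ur).
  apply: (@le_trans _ _ (two_point_fin p r x y * two_point_fin p r y z)).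
    by rewrite ler_pM ?two_point_fin_ge0 ?two_point_fin_sub.
  apply: (le_trans (harris _ _ p01 (@increasing_linked _ _ _)
    (@increasing_linked _ _ _))).
  apply: expect_le => // w; rewrite -natrM mulnb; apply: leb_nat => /andP[].
  exact: linked_trans.
have h' s : uniq s -> two_point_fin p s x y * two_point p y z <=
  two_point p x z.
  move=> us; have := two_point_fin_ge0 s x y;
    rewrite le_eqVlt => /orP[/eqP<-|c0].
    by rewrite mul0r two_point_ge0.
  rewrite mulrC -ler_pdivlMr//; apply: two_point_le => t ut.
  by rewrite ler_pdivlMr// mulrC h.
have : (0 == two_point p y z) || (0 < two_point p y z) by rewrite -le_eqVlt
  two_point_ge0.
case/orP => [/eqP<-|c0].
  by rewrite mulr0 two_point_ge0.
rewrite -ler_pdivlMr//; apply: two_point_le => s us.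
by rewrite ler_pdivlMr// h'.
Qed.

Lemma two_point_in_conn s L o x : uniq s ->
  expect p s (fun w => (linked (mem L) w o x)%:R) cl0 <= two_point_in p L o x.
Proof.
move=> us; rewrite (expect_filter p s _ (@depends_linked (mem L) o x)).
apply: expect_sub => //; [exact: increasing_linked|by rewrite
  filter_uniq|exact: inner_edges_uniq|].
by move=> f; rewrite mem_filter mem_inner_edges => /andP[].
Qed.

Lemma two_point_in_connE s L o x : uniq s -> {subset inner_edges L <= s} ->
  expect p s (fun w => (linked (mem L) w o x)%:R) cl0 = two_point_in p L o x.
Proof.
move=> us Ls; apply/eqP; rewrite eq_le two_point_in_conn//=.
by apply: expect_sub => //; [exact: increasing_linked|exact: inner_edges_uniq].
Qed.

Lemma two_point_in_le L o x : two_point_in p L o x <= two_point p o x.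
Proof.
apply: le_trans (two_point_fin_le _ _ (inner_edges_uniq L));
  apply: expect_le => // w.
by apply: leb_nat; apply: linked_sub.
Qed.

End FixedP.
End Graph.

(** * The Simon-Lieb inequality *)

Section Subcritical.
Variables (R : realType) (V : countType) (e : rel V).
Variable nb : V -> seq V.
Hypothesis nbP : forall x y, (y \in nb x) = e x y.
Hypothesis e_sym : symmetric e.
Hypothesis e_irr : irreflexive e.
Implicit Types (w : edge e -> bool) (a : pred V) (x y z o : V) (L : seq V).
Implicit Types (p : R) (s : seq (edge e)).

Let cl0 : edge e -> bool := @closed_config (edge e).
Local Notation bd := (@bdry V e nb).
Local Notation tau_in := (@two_point_in R V e nb).
Local Notation phi := (@exit_sum R V e nb).
Local Notation tau := (@two_point R V e).

Let T L o w := [seq x <- L | linked (mem L) w o x].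

Let mem_T L o w x : (x \in T L o w) = linked (mem L) w o x.
Proof.
rewrite mem_filter; case: (boolP (linked _ _ _ _)) => //= h.
exact: (linked_ends h).2.
Qed.

(** Exploring the cluster of [o] in [L] reveals only edges that touch it. *)
Let T_depends L o (C : seq V) : depends (touch (mem C)) (fun w => T L o w == C).
Proof.
suff h w w' : agree (touch (mem C)) w w' -> T L o w = C -> T L o w' = C.
  move=> w w' ag; apply/eqP/eqP; apply: h => //.
  by move=> f /ag.
move=> ag TC; rewrite -TC; apply: eq_in_filter => x xL.
have tC u v f : linked (mem L) w o u -> ends f u v -> w f = w' f.
  move=> ou fuv; apply: ag; rewrite (ends_touch _ fuv) /=.
  by rewrite -{1}TC mem_T ou.
apply/idP/idP => h; have [oL _] := linked_ends h.
  apply: (linked_ind (P := fun z => linked (mem L) w o z) h);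
    first exact: linked_refl.
  move=> u v _ ou /open_adjP[f fuv wf] vL; apply: (linked_step ou _ vL).
  by apply/open_adjP; exists f => //; rewrite (tC u v).
apply: (linked_ind (P := fun z => linked (mem L) w' o z) h);
  first exact: linked_refl.
move=> u v ou ou' /open_adjP[f fuv wf] vL; apply: (linked_step ou' _ vL).
by apply/open_adjP; exists f => //; rewrite -(tC u v).
Qed.

Let T_inside L o (C : seq V) : depends (inside (mem L)) (fun w => T L o w == C).
Proof.
move=> w w' ag; congr (_ == C); apply: eq_filter => x; exact: linked_depends.
Qed.

(** Condition on the cluster [C] of [o] in [L].  A path from [o] to [z] leaves
    [C] for the last time through an edge that leaves [L], and then avoids [C]:
    the three events at play depend on the edges that touch [C] inside [L], on
    the crossing edge, and on the edges that do not touch [C]. *)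
Lemma simon_lieb p L o z : 0 <= p <= 1 -> o \in L -> z \notin L ->
  tau p o z <= \sum_(f <- bd L) p * tau_in p L o (inner L f) * tau p (outer L
    f) z.
Proof.
move=> p01 oL zL; apply: two_point_le => s us; rewrite /two_point_fin -/cl0.
pose G f (C : seq V) w : R := (inner L f \in C)%:R * ((w f)%:R *
  (linked (fun v => v \notin C) w (outer L f) z)%:R).
have G0 f C w : 0 <= G f C w by rewrite !mulr_ge0.
apply: (@le_trans _ _
    (expect p s (fun w => \sum_(f <- bd L) G f (T L o w) w) cl0)).
  apply: expect_le => // w; case: (boolP (linked predT w o z)) => [h|_];
    last first.
    exact: sumr_ge0.
  have oT : o \in T L o w by rewrite mem_T linked_refl.
  have zT : z \notin T L o w by rewrite mem_T;
    apply: contra zL => /linked_ends[].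
  have [u [v [_ uT' uv vz]]] := linked_last_exit h oT zT.
  have uT : u \in T L o w := uT'.
  have [/andP[_ vT'] _] := linked_ends vz.
  have vT : v \notin T L o w := vT'.
  have uL : u \in L by move: uT; rewrite mem_T => /linked_ends[].
  have vL : v \notin L.
    apply: contra vT => vL; rewrite mem_T (linked_step _ uv)//.
    by move: uT; rewrite mem_T.
  case/open_adjP: uv => f fuv wf.
  have [fb iu ov] := ends_bdry nbP e_sym fuv uL vL.
  rewrite (big_rem f)//= ler_wpDr//; first exact: sumr_ge0.
  have vz' : linked (fun v => v \notin T L o w) w v z by apply: linked_sub vz.
  by rewrite /G iu ov uT wf vz' !mul1r.
rewrite expect_sum big_seq [leRHS]big_seq; apply: ler_sum => f fb.
have [inL onL fio] := bdryP nbP e_sym fb.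
apply: (@le_trans _ _ (expect p s (fun w => \sum_(C <- sublists L)
    (T L o w == C)%:R * G f C w) cl0)).
  by apply: expect_le => // w; rewrite /T sum_sublists.
rewrite expect_sum.
apply: (@le_trans _ _ (\sum_(C <- sublists L)
   (inner L f \in C)%:R * expect p s (fun w => (T L o w == C)%:R) cl0
     * (p * tau p (outer L f) z))).
  apply: ler_sum => C _.
  case: (boolP (inner L f \in C)) => iC; last first.
    rewrite mul0r mul0r (_ : (fun w => (T L o w == C)%:R * G f C w) = fun=> 0)
      ?expect_cst//.
    by apply/funext => w; rewrite /G (negbTE iC) mul0r mulr0.
  have fC : touch (mem C) f by rewrite (ends_touch _ fio); apply/orP; left;
    exact: iC.
  rewrite mul1r (_ : (fun w => (T L o w == C)%:R * G f C w) = (fun w =>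
    ((T L o w == C)%:R * (w f)%:R)
      * (linked (fun v => v \notin C) w (outer L f) z)%:R)); last first.
    by apply/funext => w; rewrite /G iC mul1r mulrA.
  rewrite (@expect_indep _ _ p s (touch (mem C))); last first.
    apply: depends_sub; last exact: depends_linked.
    by move=> g; rewrite /inside /touch /= negb_or.
    move=> w w' ag; rewrite (T_depends L o ag); congr (_ * _).
    by rewrite (ag f fC).
  rewrite (@expect_indep _ _ p s (inside (mem L))
    (fun w => (T L o w == C)%:R) (fun w => (w f)%:R)); last first.
    move=> w w' ag; rewrite (ag f)//=.
    by rewrite (ends_inside _ fio) /= (negbTE onL) andbF.
    by move=> w w' ag; rewrite (T_inside o _ ag).
  rewrite mulrA; apply: ler_pM.
  - by rewrite mulr_ge0// expect_ge0.
  - by rewrite expect_ge0.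
  - rewrite ler_wpM2l ?expect_ge0// expect_edge//; case: ifP => // _ /=.
    by case/andP: p01.
  - apply: le_trans (two_point_fin_le p01 _ _ us); apply: expect_le => // w.
    by apply: leb_nat; apply: linked_sub.
rewrite -mulr_suml [leRHS](_ : _ = tau_in p L o (inner L f) * (p * tau p (outer
  L f) z)).
  apply: ler_wpM2r; first by rewrite mulr_ge0 ?two_point_ge0//; case/andP: p01.
  apply: le_trans (two_point_in_conn nbP e_sym p01 _ o (inner L f) us).
  under eq_bigr do rewrite -expectZ.
  rewrite -expect_sum; apply: expect_le => // w.
  under eq_bigr do rewrite mulrC.
  by rewrite /T (sum_sublists _ _ (fun C => (inner L f \in C)%:R)) -/(T L o w)
    mem_T.
by ring.
Qed.

Definition is_aut (g g' : V -> V) := [/\ cancel g g', cancel g' g &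
  forall x y, e (g x) (g y) = e x y].

Lemma is_aut_sym g g' : is_aut g g' -> is_aut g' g.
Proof. by case=> gK g'K eg; split => // x y; rewrite -{2}(g'K x) -{2}(g'K y)
  eg. Qed.

Lemma is_aut_comp g g' h h' : is_aut g g' -> is_aut h h' ->
  is_aut (g \o h) (h' \o g').
Proof.
case=> gK g'K eg [hK h'K eh]; split; [exact: can_comp|exact: can_comp|].
by move=> x y /=; rewrite eg eh.
Qed.

(** The action of [g] on edges, made total by a default value; when [g] is an
    automorphism the images of two adjacent vertices are adjacent. *)
Definition edge_map (g : V -> V) (f : edge e) : edge e :=
  odflt f (mk_edge e (g (val f).1) (g (val f).2)).

Lemma edge_map_ends g g' f x y : is_aut g g' -> ends f x y ->
  ends (edge_map g f) (g x) (g y).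
Proof.
case=> _ _ eg fxy; have ef := ends_adj e_sym (ends_val f).
have := ef; rewrite -eg => /(edge_ends e_sym e_irr)[h hf].
rewrite /edge_map (mk_edgeE hf) /=; move: fxy => /orP[] /eqP E;
  rewrite E/= in hf => //.
by rewrite endsC.
Qed.

Lemma edge_mapK g g' : is_aut g g' -> cancel (edge_map g) (edge_map g').
Proof.
move=> ag f; have h := edge_map_ends ag (ends_val f).
have := edge_map_ends (is_aut_sym ag) h; case: (ag) => gK _ _.
by rewrite !gK => h'; exact: ends_inj h' (ends_val f).
Qed.

Lemma two_point_aut p g g' x y : 0 <= p <= 1 -> is_aut g g' ->
  tau p (g x) (g y) = tau p x y.
Proof.
move=> p01; suff h g1 g2 u v : is_aut g1 g2 -> tau p (g1 u) (g1 v) <= tau p u v.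
  move=> ag; apply/eqP; rewrite eq_le (h _ _ _ _ ag)//=.
  by case: (ag) => gK _ _; rewrite -{1}(gK x) -{1}(gK y) (h _ _ _ _ (is_aut_sym
    ag)).
move=> ag; apply: two_point_le => s us; have ag' := is_aut_sym ag.
apply: le_trans (_ : two_point_fin p (map (edge_map g2) s) u v <= _);
  last first.
  by apply: two_point_fin_le; rewrite // map_inj_uniq//;
    exact: can_inj (edge_mapK ag').
rewrite /two_point_fin (expect_map _ _ _ _ (edge_mapK ag') (edge_mapK ag)).
apply: expect_le => // w; apply: leb_nat => h.
have [gK g2K _] := ag.
rewrite -[v]gK; apply: (linked_ind
  (P := fun v => linked predT (w \o edge_map g1) u (g2 v)) h).
  by rewrite gK; exact: linked_refl.
move=> x' y' _ IH /open_adjP[f fxy wf] _; apply: (linked_step IH) => //.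
apply/open_adjP; exists (edge_map g2 f); first exact: (edge_map_ends ag' fxy).
by rewrite /= (edge_mapK ag').
Qed.

Definition reach (n : nat) y z :=
  exists q, [/\ path e y q, last y q = z & (size q <= n)%N].

Lemma reach_trans m n x y z : reach m x y -> reach n y z -> reach (m + n) x z.
Proof.
move=> [q [pq lq sq]] [r [pr lr sr]]; exists (q ++ r).
by rewrite cat_path pq lq pr last_cat lq lr size_cat leq_add.
Qed.

Lemma reach_leq m n x y : (m <= n)%N -> reach m x y -> reach n x y.
Proof. by move=> mn [q [pq lq sq]]; exists q; split => //;
  exact: leq_trans mn. Qed.

Lemma reach_aut g g' n x y : is_aut g g' -> reach n x y -> reach n (g x) (g y).
Proof.
move=> [_ _ eg] [q [pq lq sq]]; exists (map g q); split.
- rewrite path_map; apply: sub_path pq => u v /=; by rewrite eg.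
- by rewrite last_map lq.
- by rewrite size_map.
Qed.

Variable p : R.
Hypothesis p01 : 0 <= p <= 1.
Variables (o : V) (L : seq V).
Hypothesis trans : forall y, exists g g', is_aut g g' /\ g o = y.
Hypothesis oL : o \in L.
Hypothesis phi1 : phi p L o < 1.

Let K : R := (size L)%:R / (1 - phi p L o).

(** The Simon-Lieb inequality moved to the base point [g o] and summed over
    [z]. *)
Lemma two_point_sum_step g g' (r : seq V) (P : pred V) : is_aut g g' ->
  (forall z, P z -> g' z \notin L) ->
  \sum_(z <- r | P z) tau p (g o) z <=
  \sum_(f <- bd L) p * tau_in p L o (inner L f) *
     \sum_(z <- r | P z) tau p (g (outer L f)) z.
Proof.
move=> ag h; under [leRHS]eq_bigr do rewrite mulr_sumr.
rewrite exchange_big /=; apply: ler_sum => z /h zL.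
have [gK g'K _] := ag.
rewrite -{1}(g'K z) (two_point_aut _ _ p01 ag).
apply: (le_trans (simon_lieb p01 oL zL)); apply: ler_sum => f _.
by rewrite -[in leLHS](two_point_aut _ _ p01 ag) g'K.
Qed.

(** For a fixed list [r], let [S] be the supremum over [y] of the sum, which is
    finite since [r] is.  The points of [r] in the translate of [L] contribute at
    most [size L], and the others at most [phi p L o * S]. *)
Lemma two_point_sum_bound y (r : seq V) :
  uniq r -> \sum_(z <- r) tau p y z <= K.
Proof.
move=> ur; pose A := [set \sum_(z <- r) tau p y z | y in [set: V]].
have hA : has_sup A.
  split; first by exists (\sum_(z <- r) tau p y z); exists y.
  exists (size r)%:R => _ [x _ <-]; rewrite -sum1_size natr_sum.
  by apply: ler_sum => z _; exact: two_point_le1.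
have leA x : \sum_(z <- r) tau p x z <= sup A.
  by apply: sup_upper_bound => //; exists x.
apply: (le_trans (leA y)).
rewrite /K ler_pdivlMr ?subr_gt0// mulrBr mulr1 lerBlDr.
apply: sup_le_ub; first exact: hA.1.
move=> _ [x _ <-]; have [g [g' [ag <-]]] := trans x.
have [gK g'K _] := ag.
rewrite (bigID (fun z => g' z \in L))/=; apply: lerD.
  apply: (@le_trans _ _ (\sum_(z <- r | g' z \in L) 1%:R)).
    by apply: ler_sum => z _; exact: two_point_le1.
  rewrite -natr_sum sum1_count ler_nat -size_filter.
  rewrite -(size_map g'); apply: uniq_leq_size.
    by rewrite map_inj_uniq ?filter_uniq//; exact: can_inj g'K.
  by move=> _ /mapP[z + ->]; rewrite mem_filter => /andP[].
apply: (le_trans (two_point_sum_step _ ag (fun z h => h))).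
rewrite mulrC /phi mulr_suml; apply: ler_sum => f _; apply: ler_wpM2l.
  by rewrite mulr_ge0 ?two_point_in_ge0//; case/andP: p01.
apply: le_trans (leA (g (outer L f))).
rewrite [leRHS](bigID (fun z => g' z \in L))/= lerDr.
by apply: sumr_ge0 => z _; exact: two_point_ge0.
Qed.

(** Every application of the Simon-Lieb inequality gains a factor [phi p L o] and
    moves the base point by at most [n.+1], so [m] of them can be made before
    reaching points at distance more than [m * n.+1]. *)
Lemma two_point_sum_decay (n : nat) : {in L, forall x, reach n o x} ->
  forall m y (r : seq V), uniq r -> {in r, forall z, ~ reach (m * n.+1) y z} ->
  \sum_(z <- r) tau p y z <= phi p L o ^+ m * K.
Proof.
move=> nL; elim=> [|m IH] y r ur far; first by rewrite expr0 mul1r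
  two_point_sum_bound.
have [g [g' [ag gy]]] := trans y; have [gK g'K _] := ag.
rewrite -gy big_seq.
have h z : z \in r -> g' z \notin L.
  move=> zr; apply/negP => /nL /(reach_aut ag); rewrite g'K gy.
  by move=> /(@reach_leq _ (m.+1 * n.+1)%N) h; apply: (far z zr); apply: h; lia.
apply: (le_trans (two_point_sum_step _ ag h)).
rewrite exprS -mulrA {1}/phi mulr_suml big_seq [leRHS]big_seq.
apply: ler_sum => f fb; apply: ler_wpM2l.
  by rewrite mulr_ge0 ?two_point_in_ge0//; case/andP: p01.
rewrite -big_seq; apply: IH => // z zr hz; apply: (far z zr).
have [iL _ fio] := bdryP nbP e_sym fb.
have w1 : reach n.+1 o (outer L f).
  rewrite -addn1; apply: reach_trans (nL _ iL) _.
  by exists [:: outer L f]; rewrite /= (ends_adj e_sym fio).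
have := reach_aut ag w1; rewrite gy => /reach_trans/(_ hz).
by apply: reach_leq; rewrite mulSn.
Qed.

End Subcritical.

(** * Sharpness of the phase transition *)

Section Sharpness.
Variables (R : realType) (V : countType) (e : rel V).
Variable nb : V -> seq V.
Hypothesis nbP : forall x y, (y \in nb x) = e x y.
Hypothesis e_sym : symmetric e.
Implicit Types (w : edge e -> bool) (a : pred V) (x y z o : V) (L S : seq V).
Implicit Types (p : R) (s : seq (edge e)).

Let cl0 : edge e -> bool := @closed_config (edge e).
Local Notation bd := (@bdry V e nb).
Local Notation etouch := (@touching_edges V e nb).
Local Notation tau_in := (@two_point_in R V e nb).
Local Notation phi := (@exit_sum R V e nb).

Definition escapes L x w : bool := `[< exists2 z, z \notin L & linked predT w x
  z >].

(** Only the edges that touch [L] matter for leaving [L], so this is the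
    probability in the infinite graph as well. *)
Definition theta p L o := expect p (etouch L) (fun w => (escapes L o w)%:R) cl0.

Lemma escapes_linked L x y w : linked predT w x y -> escapes L y w -> escapes L x w.
Proof.
move=> xy /asboolP[z zL yz]; apply/asboolP; exists z => //.
exact: linked_trans xy yz.
Qed.

Lemma escapes_mono L x w w' : (forall f, w f -> w' f) -> escapes L x w ->
  escapes L x w'.
Proof.
move=> ww /asboolP[z zL xz]; apply/asboolP; exists z => //.
exact: linked_monow ww xz.
Qed.

Lemma escapes_notin L x w : x \notin L -> escapes L x w.
Proof. by move=> xL; apply/asboolP; exists x => //; exact: linked_refl. Qed.

Lemma increasing_escapes L x :
  increasing_in (fun w => (escapes L x w)%:R : R).
Proof. by move=> w w' ww; apply: leb_nat; exact: escapes_mono. Qed.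

Lemma linked_adj w x y : open_adj w x y -> linked predT w x y.
Proof. by move=> xy; apply: (linked_step (linked_refl _ _) xy). Qed.

Let W L w := [seq x <- L | ~~ escapes L x w].

Let notin_W L x w : (x \notin W L w) = escapes L x w.
Proof.
rewrite mem_filter negb_and negbK; case: (boolP (x \in L)) => xL.
  by rewrite orbF.
by rewrite orbT escapes_notin.
Qed.

(** The set [W] is revealed by exploring the clusters of the points outside [L],
    which never looks at an edge with both ends in [W]. *)
Let W_depends L S : depends (predC (inside (mem S))) (fun w => W L w == S).
Proof.
suff h w w' : agree (predC (inside (mem S))) w w' -> W L w = S -> W L w' = S.
  move=> w w' ag; apply/eqP/eqP; apply: h => //.
  by move=> f /ag.
move=> ag WS.
have eS u : (u \notin S) = escapes L u w by rewrite -WS notin_W.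
have ww u v : open_adj w u v -> u \notin S -> open_adj w' u v.
  move=> /open_adjP[f fuv wf] uS; apply/open_adjP; exists f => //.
  rewrite -ag//= (ends_inside _ fuv); apply: contra uS; by case/andP.
have ww' u v : open_adj w' u v -> u \notin S -> open_adj w u v.
  move=> /open_adjP[f fuv wf] uS; apply/open_adjP; exists f => //.
  rewrite ag//= (ends_inside _ fuv); apply: contra uS; by case/andP.
rewrite -[RHS]WS; apply: eq_in_filter => x xL; congr (~~ _); apply/idP/idP.
  move=> /asboolP[z zL /linked_sym zx]; case: (boolP (escapes L x w)) => // nx.
  pose b v := v \notin S.
  have zS : b z by rewrite /b eS escapes_notin.
  have xS : ~~ b x by rewrite /b eS.
  have [u [v [h1 h2 _ h4 _]]] := linked_exit zx zS xS.
  have uS : u \notin S by have [_ /andP[]] := linked_ends h1.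
  move: h4; rewrite /b eS => /negP; case.
  apply: (@escapes_linked _ _ u); last by rewrite -eS.
  by rewrite linkedC; apply: linked_adj; exact: ww'.
move=> /asboolP[z zL /linked_sym zx]; apply/asboolP; exists z => //.
rewrite linkedC; apply: (linked_ind (P := fun v => linked predT w' z v) zx).
  exact: linked_refl.
move=> u v zu zu' uv _; apply: (linked_step zu' _ isT); apply: ww => //.
by rewrite eS; apply/asboolP; exists z => //; rewrite linkedC.
Qed.

(** Opening an edge that leaves [W] from the cluster of [o] in [W] lets [o]
    escape. *)
Let pivotal_ge L o w :
  \sum_(S <- sublists L) (W L w == S)%:R *
    ((o \in S)%:R * \sum_(f <- bd S) (linked (mem S) w o (inner S f))%:R) <=
  \sum_(f <- etouch L) ((escapes L o (upd w f true))%:R -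
    (escapes L o (upd w f false))%:R) :> R.
Proof.
rewrite /W sum_sublists -/(W L w).
have d0 f : 0 <= (escapes L o (upd w f true))%:R -
    (escapes L o (upd w f false))%:R :> R.
  rewrite subr_ge0; apply: increasing_escapes => g; exact: upd_ft.
case: (boolP (o \in W L w)) => oW; last by rewrite mul0r sumr_ge0.
rewrite mul1r.
have noW : escapes L o w = false by rewrite -notin_W oW.
apply: le_trans (ler_sum_sub (@bdry_uniq _ e nb (W L w)) _ d0); last first.
  move=> f; rewrite (mem_bdry nbP e_sym) (mem_touching_edges nbP e_sym) =>
    /andP[+ _].
  rewrite /touch /= => /orP[]; rewrite mem_filter => /andP[_ ->] //.
  by rewrite orbT.
rewrite big_seq [leRHS]big_seq; apply: ler_sum => f fb.
have [iW oW' fio] := bdryP nbP e_sym fb.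
case: (boolP (linked _ _ _ _)) => [h|_]; last exact: d0.

have ->: escapes L o (upd w f true).
  apply: (@escapes_linked _ _ (outer (W L w) f)).
    apply: (@linked_trans _ _ _ _ _ (inner (W L w) f)).
      apply: linked_sub h => // g _; rewrite /upd; by case: eqP.
    apply: linked_adj; apply/open_adjP; exists f => //.
    by rewrite upd_same.
  move: oW'; rewrite notin_W; apply: escapes_mono => g.
  by rewrite /upd; case: eqP.
case: (boolP (escapes L o (upd w f false))) => [h'|_]; last by rewrite subr0.
have : escapes L o w.
  by apply: escapes_mono h' => g; rewrite /upd; case: eqP.
by rewrite noW.
Qed.

(** Condition on [W].  Given that [W] is [S], the edges inside [S] are fresh, so
    the expected number of pivotal edges is at least
    [exit_sum p S o / p >= 1] as soon as [o] belongs to [S], that is, as soon as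
    [o] does not escape. *)
Lemma theta_deriv_ge p L o : 0 <= p <= 1 -> o \in L ->
  (forall S, o \in S -> 1 <= phi p S o) ->
  1 - theta p L o <= \sum_(f <- etouch L)
    expect p (etouch L) (fun w => (escapes L o (upd w f true))%:R -
      (escapes L o (upd w f false))%:R) cl0.
Proof.
move=> p01 oL phi1; rewrite -expect_sum.
apply: le_trans (expect_le (etouch L) cl0 p01 (pivotal_ge L o)).
rewrite expect_sum.
apply: (@le_trans _ _ (\sum_(S <- sublists L) (o \in S)%:R *
   expect p (etouch L) (fun w => (W L w == S)%:R) cl0)).
  under eq_bigr do rewrite -expectZ.
  rewrite -expect_sum /theta -[X in X - _](expect_cst p (etouch L) 1 cl0)
    -expectB.
  apply: expect_le => // w.
  have -> : \sum_(S <- sublists L) (o \in S)%:R * (W L w == S)%:R =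
      (o \in W L w)%:R :> R.
    rewrite -[RHS](sum_sublists _ _ (fun S => (o \in S)%:R)).
    by apply: eq_bigr => S _; rewrite mulrC.
  by rewrite -notin_W; case: (o \in _); rewrite ?subrr ?subr0.
rewrite big_seq [leRHS]big_seq; apply: ler_sum => S /sublists_sub SL.
case: (boolP (o \in S)) => oS; last first.
  by rewrite mul0r; apply: expect_ge0 => // w; rewrite mul0r mulr0.
rewrite mul1r (@expect_indep _ _ p _ (predC (inside (mem S)))
  (fun w => (W L w == S)%:R)); last first.
- move=> w w' ag; rewrite !mul1r; apply: eq_bigr => f _.
  rewrite (@linked_depends _ _ (mem S) o (inner S f) w w')// => g gS; apply: ag.
  by rewrite /= negbK.
- by move=> w w' ag; rewrite (W_depends L ag).
rewrite ler_peMr ?expect_ge0//.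
apply: (le_trans (phi1 S oS)).
rewrite (_ : (fun w => true%:R * _) = fun w => \sum_(f <- bd S)
  (linked (mem S) w o (inner S f))%:R); last by apply/funext => w;
    rewrite mul1r.
rewrite expect_sum; apply: ler_sum => f _.
have SsL : {subset inner_edges e nb S <= etouch L}.
  move=> g; rewrite (mem_inner_edges nbP e_sym) (mem_touching_edges nbP e_sym)
    => /andP[h _].
  by apply/orP; left; exact: SL.
rewrite (two_point_in_connE nbP e_sym p01 _ _ (@touching_edges_uniq _ e nb L)
  SsL).
by rewrite ler_piMl ?two_point_in_ge0//; case/andP: p01.
Qed.

Lemma exit_sum_mono p p' S o : 0 <= p -> p <= p' -> p' <= 1 ->
  phi p S o <= phi p' S o.
Proof.
move=> p0 pp p1; apply: ler_sum => f _; apply: ler_pM => //.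
  by apply: two_point_in_ge0; rewrite p0 (le_trans pp).
by apply: expect_mono_p => //; exact: increasing_linked.
Qed.

(** By [russo] and [theta_deriv_ge], [theta' >= 1 - theta] on [[p0, p1]]; the
    mean value theorem and the monotonicity of [theta] give
    [theta(p1) >= (p1 - p0) (1 - theta(p1))]. *)
Lemma theta_ge p0 p1 L o : 0 <= p0 -> p0 < p1 -> p1 <= 1 -> o \in L ->
  (forall S, o \in S -> 1 <= phi p0 S o) ->
  (p1 - p0) / (1 + (p1 - p0)) <= theta p1 L o.
Proof.
move=> p00 p01 p11 oL phi1.
have tc := @continuous_expect R _ (etouch L) (fun w => (escapes L o w)%:R) cl0
  (@touching_edges_uniq _ e nb L).
have [q] := @MVT R (fun p => theta p L o) (fun p => \sum_(f <- etouch L)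
    expect p (etouch L) (fun w => (escapes L o (upd w f true))%:R -
      (escapes L o (upd w f false))%:R) cl0) p0 p1 p01
  (fun q _ => russo q _ cl0 (@touching_edges_uniq _ e nb L))
  (continuous_subspaceT tc).
rewrite in_itv /= => /andP[p0q qp1] tE.
have q01 : 0 <= q <= 1 by apply/andP; split; lra.
have h := @theta_deriv_ge q L o q01 oL
   (fun S oS => le_trans (phi1 S oS) (exit_sum_mono S o p00 (ltW p0q) (andP
     q01).2)).
have m : theta q L o <= theta p1 L o.
  apply: expect_mono_p => //; [lra|lra|exact: increasing_escapes].
have t0 : 0 <= theta p0 L o by apply: expect_ge0 => //; apply/andP; split; lra.
rewrite ler_pdivrMr; last lra.
have d0 : 0 <= p1 - p0 by lra.
have := ler_wpM2r d0 h; rewrite -tE; nra.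
Qed.

Lemma continuous_exit_sum S o : continuous (fun p => phi p S o).
Proof.
rewrite /exit_sum; elim: (bd S) => [|f r IH] p.
  under eq_fun do rewrite big_nil; exact: cvg_cst.
under eq_fun do rewrite big_cons; apply: cvgD; last exact: IH.
apply: cvgM; first exact: cvg_id.
exact: (@continuous_expect R _ _ _ cl0 (@inner_edges_uniq _ e nb S)).
Qed.

End Sharpness.

(** * Events determined by finitely many edges *)

Section Probability.
Variables (R : realType) (d : measure_display) (T : measurableType d).
Variable P : probability T R.
Implicit Types (A B : set T) (F : nat -> set T).

Definition pr A : R := fine (P A).

Lemma prE A : measurable A -> P A = (pr A)%:E.
Proof. by move=> mA; rewrite /pr fineK// fin_num_measure. Qed.

Lemma pr_le A B : measurable A -> measurable B -> A `<=` B -> pr A <= pr B.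
Proof.
by move=> mA mB AB; rewrite -lee_fin -!prE// le_measure// inE.
Qed.

Lemma pr_bigcup F : (forall n, measurable (F n)) ->
  (forall m n, (m <= n)%N -> F m `<=` F n) ->
  (pr \o F) @ \oo --> pr (\bigcup_n F n).
Proof.
move=> mF ndF.
have mU : measurable (\bigcup_n F n) by exact: bigcup_measurable.
apply: fine_cvg; rewrite -prE//; apply: nondecreasing_cvg_mu => //.
by move=> m n mn; apply/subsetPset; exact: ndF.
Qed.

Lemma pr_bigcap F : (forall n, measurable (F n)) ->
  (forall m n, (m <= n)%N -> F n `<=` F m) ->
  (pr \o F) @ \oo --> pr (\bigcap_n F n).
Proof.
move=> mF niF.
have mI : measurable (\bigcap_n F n) by exact: bigcap_measurable.
apply: fine_cvg; rewrite -prE//; apply: nonincreasing_cvg_mu => //.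
  by rewrite ltey_eq fin_num_measure.
by move=> m n mn; apply/subsetPset; exact: niF.
Qed.

Definition independent A B := pr (A `&` B) = pr A * pr B.

Lemma independentC A B : independent A B -> independent B A.
Proof. by rewrite /independent setIC mulrC. Qed.

Lemma independent_bigcup F B : (forall n, measurable (F n)) -> measurable B ->
  (forall m n, (m <= n)%N -> F m `<=` F n) ->
  (forall n, independent (F n) B) -> independent (\bigcup_n F n) B.
Proof.
move=> mF mB ndF iF; rewrite /independent.
have h1 := cvgM (pr_bigcup mF ndF) (cvg_cst (pr B)).
have h2 : (pr \o (fun n => F n `&` B)) @ \oo --> pr ((\bigcup_n F n) `&` B).
  rewrite setI_bigcupl; apply: pr_bigcup => [n|m n mn x [? ?]].
    exact: measurableI.
  by split => //; exact: ndF mn _ _.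
rewrite -(cvg_lim (@Rhausdorff R) (h1 _ _)) -(cvg_lim (@Rhausdorff R) h2).
by congr (lim (_ @ \oo)); apply/funext => n /=; rewrite iF.
Qed.

Lemma independent_bigcap F B : (forall n, measurable (F n)) -> measurable B ->
  (forall m n, (m <= n)%N -> F n `<=` F m) ->
  (forall n, independent (F n) B) -> independent (\bigcap_n F n) B.
Proof.
move=> mF mB niF iF; rewrite /independent.
have h1 := cvgM (pr_bigcap mF niF) (cvg_cst (pr B)).
have h2 : (pr \o (fun n => F n `&` B)) @ \oo --> pr ((\bigcap_n F n) `&` B).
  have -> : (\bigcap_n F n) `&` B = \bigcap_n (F n `&` B).
    apply/seteqP; split=> [x [Fx Bx] n _|x h].
      by split => //; exact: Fx.
    split; last by have [] := h 0%N Logic.I.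
    by move=> n _; have [] := h n Logic.I.
  apply: pr_bigcap => [n|m n mn x [? ?]]; first exact: measurableI.
  by split => //; exact: niF mn _ _.
rewrite -(cvg_lim (@Rhausdorff R) (h1 _ _)) -(cvg_lim (@Rhausdorff R) h2).
by congr (lim (_ @ \oo)); apply/funext => n /=; rewrite iF.
Qed.

End Probability.

Section Bridge.
Variables (R : realType) (V : countType) (e : rel V).
Variables (p : R) (P : probability (config e) R).
Hypothesis hP : bernoulli_percolation p P.
Implicit Types (s t : seq (edge e)) (w b : edge e -> bool).

Let cl0 : edge e -> bool := @closed_config (edge e).

Lemma measurable_edge (f : edge e) c : measurable [set w : config e | w f = c].
Proof. by apply: sub_sigma_algebra; exists f, c. Qed.

Let cyl s b : set (config e) := [set w | forall f, f \in s -> w f = b f].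

Let cyl_cons f s b : cyl (f :: s) b = [set w | w f = b f] `&` cyl s b.
Proof.
apply/seteqP; split => w /=.
  move=> h; split; first by apply: h; rewrite mem_head.
  by move=> g gs; apply: h; rewrite inE gs orbT.
by move=> [h1 h2] g; rewrite inE => /orP[/eqP->|/h2].
Qed.

Let measurable_cyl s b : measurable (cyl s b).
Proof.
elim: s => [|f s IH].
  by rewrite (_ : cyl [::] b = setT)//; apply/seteqP; split.
by rewrite cyl_cons; apply: measurableI => //; exact: measurable_edge.
Qed.

Let weight (c : bool) : R := if c then p else 1 - p.

(** By induction on [s], splitting according to the state of the next edge; the
    edges of [t] are those whose state is already fixed. *)
Let pr_local s t b (A : (edge e -> bool) -> bool) : uniq (t ++ s) ->
  depends (fun f => f \in t ++ s) A ->
  measurable (cyl t b `&` [set w | A w]) /\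
  P (cyl t b `&` [set w | A w]) =
    (\prod_(f <- t) weight (b f) * expect p s (fun w => (A w)%:R) b)%:E.
Proof.
elim: s t b => [|f s IH] t b.
  rewrite cats0 => ut dA.
  have [Ab|nAb] := boolP (A b).
    rewrite (_ : _ `&` _ = cyl t b); last first.
      apply/seteqP; split => [w [] //|w wt]; split => //=.
      by rewrite (dA w b) => // f ft; exact: wt.
    split; first exact: measurable_cyl.
    by rewrite (hP b ut) /= Ab mulr1.
  rewrite (_ : _ `&` _ = set0); last first.
    apply/seteqP; split => [w []/= wt|//]; rewrite (dA w b)// (negbTE nAb)//.
  by rewrite /= (negbTE nAb) mulr0 measure0.
move=> uts dA.
have uts' : uniq ((f :: t) ++ s).
  by rewrite -(perm_uniq (s1 := t ++ f :: s))// -cat1s perm_catCA.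
have dA' : depends (fun g => g \in (f :: t) ++ s) A.
  apply: depends_sub dA => g; rewrite !(mem_cat, inE).
  by case: (g \in t); case: (g == f); case: (g \in s).
have ft : f \notin t.
  by move: uts' => /= /andP[]; rewrite mem_cat negb_or => /andP[].
have [m1 e1] := IH (f :: t) (upd b f true) uts' dA'.
have [m0 e0] := IH (f :: t) (upd b f false) uts' dA'.
have cE c : cyl (f :: t) (upd b f c) = [set w | w f = c] `&` cyl t b.
  rewrite cyl_cons upd_same; congr (_ `&` _).
  apply/seteqP; split => w /= h g gt; have := h g gt; rewrite /upd;
    case: eqP => // gf; by rewrite -gf gt in ft.
have -> : cyl t b `&` [set w | A w] =
    (cyl (f :: t) (upd b f true) `&` [set w | A w]) `|`
    (cyl (f :: t) (upd b f false) `&` [set w | A w]).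
  rewrite !cE -setIUl -setIUl; congr (_ `&` _).
  rewrite (_ : _ `|` _ = setT) ?setTI//; apply/seteqP; split => // w _ /=.
  by case: (w f); [left|right].
split; first exact: measurableU.
rewrite measureU//; last first.
  rewrite -subset0 => w [[]]; rewrite !cE => -[/= -> _] _ [[]] //.
have pE c : \prod_(g <- t) weight (upd b f c g) = \prod_(g <- t) weight (b g).
  rewrite big_seq [RHS]big_seq; apply: eq_bigr => g gt; rewrite /upd.
  by case: eqP => // gf; rewrite -gf gt in ft.
transitivity ((\prod_(g <- f :: t) weight (upd b f true g) *
      expect p s (fun w => (A w)%:R) (upd b f true))%:E +
  (\prod_(g <- f :: t) weight (upd b f false g) *
      expect p s (fun w => (A w)%:R) (upd b f false))%:E)%E.
  by congr (_ + _)%E.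
rewrite -EFinD !big_cons !upd_same !pE /=; congr _%:E; rewrite /weight; ring.
Qed.

Lemma pr_dep s (A : (edge e -> bool) -> bool) : uniq s ->
  depends (fun f => f \in s) A ->
  measurable [set w : config e | A w] /\
  pr P [set w | A w] = expect p s (fun w => (A w)%:R) cl0.
Proof.
move=> us dA; have [] := @pr_local s [::] cl0 A us dA.
rewrite (_ : cyl [::] cl0 = setT) ?setTI; last by apply/seteqP; split.
by move=> mA; rewrite big_nil mul1r /pr => ->.
Qed.

Lemma independent_dep s t (A B : (edge e -> bool) -> bool) : uniq s -> uniq t ->
  {in s, forall f, f \notin t} ->
  depends (fun f => f \in s) A -> depends (fun f => f \in t) B ->
  independent P [set w | A w] [set w | B w].
Proof.
move=> us ut st dA dB; have ust : uniq (s ++ t).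
  rewrite cat_uniq us ut andbT/=; apply/hasPn => f ft; apply/negP => /st.
  by rewrite ft.
have dA' : depends (fun f => f \in s ++ t) A.
  by apply: depends_sub dA => f fs; rewrite mem_cat fs.
have dB' : depends (fun f => f \in s ++ t) B.
  by apply: depends_sub dB => f fs; rewrite mem_cat fs orbT.
rewrite /independent (pr_dep ust dA').2 (pr_dep ust dB').2.
rewrite (_ : _ `&` _ = [set w | A w && B w]); last first.
  by apply/seteqP; split => w /andP.
rewrite (pr_dep (A := fun w => A w && B w) ust _).2; last first.
  by move=> w w' ag; rewrite (dA' _ _ ag) (dB' _ _ ag).
rewrite -(@expect_indep _ _ p (s ++ t) (fun f => f \in s)).
- by congr expect; apply/funext => w; rewrite -natrM mulnb.
- by move=> w w' ag; rewrite (dA _ _ ag).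
- move=> w w' ag; rewrite (dB w w')// => f ft; apply: ag => /=.
  by apply: contraL ft => /st.
Qed.

End Bridge.

(** * Infinite clusters and the zero-one law *)

Section InfiniteClusters.
Variables (R : realType) (V : countType) (e : rel V).
Variable nb : V -> seq V.
Hypothesis nbP : forall x y, (y \in nb x) = e x y.
Hypothesis e_sym : symmetric e.
Variables (p : R) (P : probability (config e) R).
Hypothesis p01 : 0 <= p <= 1.
Hypothesis hP : bernoulli_percolation p P.
Implicit Types (w : edge e -> bool) (a : pred V) (x y z : V).

Let cl0 : edge e -> bool := @closed_config (edge e).
Local Notation tau := (@two_point R V e).

Definition box (k : nat) : seq V := pmap (@pickle_inv V) (iota 0 k).

Lemma mem_box k x : (x \in box k) = (pickle x < k)%N.
Proof.
rewrite mem_pmap; apply/mapP/idP => [[n]|xk].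
  rewrite mem_iota add0n /= => nk xn.
  by have := @pickle_invK V n; rewrite -xn /= => ->.
by exists (pickle x); rewrite ?pickleK_inv// mem_iota add0n.
Qed.

(** A path is finite, so it stays among the first vertices of the enumeration. *)
Lemma linked_box a w x y : linked a w x y ->
  exists k, linked (fun z => a z && (pickle z < k)%N) w x y.
Proof.
move=> xy; have [ax _] := linked_ends xy.
apply: (linked_ind (P := fun y =>
  exists k, linked (fun z => a z && (pickle z < k)%N) w x y) xy).
  by exists (pickle x).+1; apply: linked_refl; rewrite ax leqnn.
move=> u v _ [k xu] uv av; exists (maxn k (pickle v).+1).
apply: (@linked_step _ _ _ _ _ u) => //.
  by apply: linked_sub xu => // z /andP[-> zk]; rewrite leq_max zk.
by rewrite av leq_max leqnn orbT.
Qed.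

Lemma depends_inside_box (T : Type) k (a : pred V) (F : (edge e -> bool) ->
  T) :
  (forall z, a z -> (pickle z < k)%N) -> depends (inside a) F ->
  depends (fun f => f \in [seq f <- inner_edges e nb (box k) | inside a f]) F.
Proof.
move=> ak; apply: depends_sub => f; rewrite mem_filter (mem_inner_edges nbP
  e_sym).
move=> af; rewrite af /=; case/andP: af => h1 h2.
by apply/andP; split; [move: (ak _ h1)|move: (ak _ h2)]; rewrite -mem_box.
Qed.

Lemma measurable_local k a (A : (edge e -> bool) -> bool) :
  (forall z, a z -> (pickle z < k)%N) -> depends (inside a) A ->
  measurable [set w : config e | A w].
Proof.
move=> ak dA; have u : uniq [seq f <- inner_edges e nb (box k) | inside a f].
  by rewrite filter_uniq// inner_edges_uniq.
exact: (pr_dep hP u (depends_inside_box ak dA)).1.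
Qed.

Lemma measurable_linked a x y : measurable [set w : config e | linked a w x y].
Proof.
rewrite (_ : [set w | _] = \bigcup_k [set w : config e |
    linked (fun z => a z && (pickle z < k)%N) w x y]).
  apply: bigcup_measurable => k _; apply: (@measurable_local k (fun z =>
    a z && (pickle z < k)%N)).
    by move=> z /andP[].
  exact: linked_depends.
apply/seteqP; split => w /=; first by move=> /linked_box[k h]; exists k.
by move=> [k _]; apply: linked_sub => // z /andP[].
Qed.

(** The measure of the event is the limit of its versions in boxes, hence at most
    the supremum; conversely each finite-volume event implies it. *)
Lemma pr_linked x y : pr P [set w | linked predT w x y] = tau p x y.
Proof.
apply/eqP; rewrite eq_le; apply/andP; split.
  rewrite (_ : [set w | _] = \bigcup_k [set w : config e |
      linked (fun z => (pickle z < k)%N) w x y]); last first.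
    apply/seteqP; split => w /=; first by move=> /linked_box[k h]; exists k.
    by move=> [k _]; apply: linked_sub.
  have mF k : measurable [set w : config e | linked (fun z =>
    (pickle z < k)%N) w x y].
    exact: measurable_linked.
  have ndF m n : (m <= n)%N ->
      [set w : config e | linked (fun z => (pickle z < m)%N) w x y] `<=`
      [set w | linked (fun z => (pickle z < n)%N) w x y].
    by move=> mn w /=; apply: linked_sub => // z; move/leq_trans; apply.
  have h := @pr_bigcup _ _ _ P _ mF ndF.
  rewrite -(cvg_lim (@Rhausdorff R) h); apply: limr_le; first by apply/cvg_ex;
    eexists; exact: h.
  apply: nearW => k /=.
  have u : uniq [seq f <- inner_edges e nb (box k) | inside (fun z =>
    (pickle z < k)%N) f].
    by rewrite filter_uniq// inner_edges_uniq.
  rewrite (pr_dep hP u (depends_inside_box (fun z h =>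
    h) (@linked_depends _ e _ x y))).2.
  apply: le_trans (two_point_fin_le p01 x y u); apply: expect_le => // w.
  by apply: leb_nat; apply: linked_sub.
apply: two_point_le => s us.
pose A w := linked predT (fun f => (f \in s) && w f) x y.
have dA : depends (fun f => f \in s) A.
  move=> w w' ag; rewrite /A; congr (linked _ _ x y); apply/funext => f.
  by case: (boolP (f \in s)) => //= /ag.
have [mA eA] := pr_dep hP us dA.
apply: (@le_trans _ _ (pr P [set w | A w])).
  rewrite eA; apply: expect_le_supp => // w aw; apply: leb_nat;
    apply: linked_sub => // f _ wf.
  rewrite wf andbT; case: (boolP (f \in s)) => // fs.
  by move: wf; rewrite aw.
apply: pr_le => //; first exact: measurable_linked.
by move=> w; rewrite /A /=; apply: linked_sub => // f _ /andP[].
Qed.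

Lemma pr_open_connected x y : pr P [set w | open_connected w x y] = tau p x y.
Proof.
rewrite -pr_linked; congr (pr P _); apply/seteqP; split => w;
  by move/open_connectedE.
Qed.

Definition percolates : set (config e) :=
  [set w | exists x, infinite_set (Defs.cluster w x)].

(** The local events from which [percolates] is built ([percolatesE]).  The place
    of a vertex in the enumeration stands for its distance to the origin. *)
Let D a (m n : nat) w : bool :=
  `[< exists x z, [/\ (pickle x < m)%N, (n <= pickle z)%N & linked a w x z] >].

Let D_depends a m n : depends (inside a) (D a m n).
Proof.
suff h w w' : agree (inside a) w w' -> D a m n w -> D a m n w'.
  by move=> w w' ag; apply/idP/idP; apply: h => // f /ag.
move=> ag /asboolP[x [z [xm zn xz]]]; apply/asboolP; exists x, z; split => //.
by rewrite -(linked_depends x z ag).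
Qed.

Let D_sub a a' m m' n n' w : (forall z, a z -> a' z) -> (m <= m')%N ->
  (n' <= n)%N -> D a m n w -> D a' m' n' w.
Proof.
move=> aa mm nn /asboolP[x [z [xm zn xz]]]; apply/asboolP; exists x, z; split.
- exact: leq_trans xm mm.
- exact: leq_trans nn zn.
- exact: linked_sub xz.
Qed.

Lemma finite_box (A : set V) : finite_set A -> exists n, forall z, A z ->
  (pickle z < n)%N.
Proof.
move=> /finite_seqP[s ->]; exists (\max_(z <- s) pickle z).+1 => z /= zs.
by rewrite ltnS; apply: leq_bigmax_seq.
Qed.

Lemma infinite_cluster_far w x : infinite_set (Defs.cluster w x) <->
  forall n, exists2 z, (n <= pickle z)%N & linked predT w x z.
Proof.
split=> [inf n|h /finite_box[n hn]].
  apply: contrapT => h; apply: inf; apply: (@sub_finite_set _ _ [set` box n])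
    => //.
  move=> z /open_connectedE xz /=; rewrite mem_box ltnNge; apply/negP => nz.
  by apply: h; exists z.
have [z nz xz] := h n; suff : (pickle z < n)%N by rewrite ltnNge nz.
by apply: hn; apply/open_connectedE.
Qed.

Let D_percolates a w m : (forall n, D a m n w) -> percolates w.
Proof.
move=> h; apply: contrapT => np.
have hN x : exists n, forall z, linked predT w x z -> (pickle z < n)%N.
  have [n hn] := @finite_box (Defs.cluster w x)
    (contrapT (fun inf => np (ex_intro _ x inf))).
  by exists n => z /open_connectedE; exact: hn.
pose N x := sval (cid (hN x)); pose n := \max_(x <- box m) N x.
have /asboolP[x [z [xm nz xz]]] := h n.
have := svalP (cid (hN x)) z (linked_sub (fun _ _ => isT) (fun _ _ h => h) xz).
rewrite ltnNge => /negP; apply; apply: leq_trans nz;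
  apply: (@leq_bigmax_seq _ _ predT N x) => //.
by rewrite mem_box.
Qed.

(** After its last visit to [box K], a path from the box to a far point passes
    through a neighbour of the box; these neighbours are finitely many. *)
Let percolates_D K w : percolates w ->
  exists m, forall n, D (fun z => (K <= pickle z)%N) m n w.
Proof.
case=> x /infinite_cluster_far inf.
pose m := (maxn (pickle x) (\max_(u <- box K) \max_(v <- nb u) pickle v)).+1.
exists m => n; have [z nz xz] := inf (maxn n K).
move: nz; rewrite geq_max => /andP[nz Kz].
suff [v vm vz] : exists2 v, (pickle v < m)%N & linked (fun z => (K <=
  pickle z)%N) w v z.
  by apply/asboolP; exists v, z.
move: Kz; apply: (linked_ind (P := fun z => (K <= pickle z)%N -> exists2 v,
  (pickle v < m)%N & linked (fun z => (K <= pickle z)%N) w v z) xz).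
  by move=> Kx; exists x; [rewrite ltnS leq_maxl|exact: linked_refl].
move=> u v _ IH uv _ Kv; have [Ku|uK] := leqP K (pickle u).
  by have [y ym yu] := IH Ku; exists y => //; exact: linked_step yu uv _.
exists v; last exact: linked_refl.
rewrite ltnS leq_max; apply/orP; right.
apply: (@leq_trans (\max_(v <- nb u) pickle v)).
  apply: leq_bigmax_seq => //; rewrite nbP.
  by case/open_adjP: uv => f fuv _; exact: (ends_adj e_sym fuv).
by apply: (@leq_bigmax_seq _ _ predT (fun u => \max_(v <- nb u) pickle v) u) =>
  //; rewrite mem_box.
Qed.

Let shell k l : pred V := fun z => (k <= pickle z)%N && (pickle z < l)%N.

(** An infinite cluster is still visible off [box k].  For this reason
    [percolates] is independent of the edges inside [box k]. *)
Let percolatesE k :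
  percolates = \bigcup_m \bigcap_n \bigcup_l [set w | D (shell k l) m n w].
Proof.
apply/seteqP; split => w /=.
  move=> /(percolates_D k)[m h]; exists m => // n _.
  have /asboolP[x [z [xm nz /linked_box[l xz]]]] := h n.
  by exists l => //=; apply/asboolP; exists x, z; split.
move=> [m _ h]; apply: (@D_percolates predT _ m) => n.
have [l _ /=] := h n Logic.I; exact: D_sub.
Qed.

Let measurable_D k l m n : measurable [set w : config e | D (shell k l) m n w].
Proof.
apply: (@measurable_local l (shell k l)); last exact: D_depends.
by move=> z /andP[].
Qed.

Lemma measurable_percolates : measurable percolates.
Proof.
rewrite (percolatesE 0); apply: bigcup_measurable => m _.
by apply: bigcap_measurable => // n _; apply: bigcup_measurable.
Qed.

Let independent_percolates k (B : set (config e)) : measurable B ->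
  (forall l m n, independent P [set w | D (shell k l) m n w] B) ->
  independent P percolates B.
Proof.
move=> mB h; rewrite (percolatesE k).
have mDl m n : measurable (\bigcup_l [set w : config e | D (shell k l) m n w]).
  by apply: bigcup_measurable.
apply: independent_bigcup => //.
- by move=> m; apply: bigcap_measurable.
- move=> m m' mm w /= hw n _; have [l _ /= hl] := hw n Logic.I.
  by exists l => //=; apply: D_sub hl.
move=> m; apply: independent_bigcap => //.
- by move=> n n' nn w [l _ /= hl]; exists l => //=; apply: D_sub hl.
move=> n; apply: independent_bigcup => //.
move=> l l' ll w /=; apply: D_sub => // z /andP[h1 h2]; apply/andP; split => //.
exact: leq_trans ll.
Qed.

(** Independent of all the local events, [percolates] is independent of itself. *)
Lemma percolates_01 : pr P percolates = 0 \/ pr P percolates = 1.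
Proof.
have h : independent P percolates percolates.
  apply: (@independent_percolates 0%N); first exact: measurable_percolates.
  move=> k m n; apply: independentC.
  apply: (@independent_percolates k) => // l m' n'.
  have u k' l' : uniq [seq f <- inner_edges e nb (box l') | inside (shell k'
    l') f].
    by rewrite filter_uniq// inner_edges_uniq.
  have sh k' l' z : shell k' l' z -> (pickle z < l')%N by case/andP.
  apply: (independent_dep hP (u _ _) (u _ _) _ (depends_inside_box (@sh k l)
    (@D_depends _ m' n'))
     (depends_inside_box (@sh 0%N k) (@D_depends _ m n))).
  move=> f; rewrite !mem_filter => /andP[/andP[/andP[kf _] _] _].
  apply/negP => /andP[/andP[/andP[_ fk] _] _].
  by move: kf; rewrite leqNgt fk.
move: h; rewrite /independent setIid => /eqP.
rewrite -subr_eq0 -{1}[pr P _]mulr1 -mulrBr mulf_eq0 => /orP[/eqP|];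
  first by left.
by rewrite subr_eq0 => /eqP; right.
Qed.

(** The lower bound survives the limit of large boxes, so [percolates] has
    positive probability, hence probability one. *)
Lemma ae_percolates c o : 0 < c ->
  (forall L : seq V, o \in L -> c <= theta e nb p L o) ->
  {ae P, forall w, exists x, infinite_set (Defs.cluster w x)}.
Proof.
move=> c0 hc; pose J n : set (config e) := [set w | escapes (box n) o w].
have mJ n : measurable (J n).
  rewrite (_ : J n = \bigcup_(i in [set i | (n <= i)%N])
      if @pickle_inv V i is Some z then [set w | linked predT w o z] else set0).
    apply: bigcup_measurable => i _; case: pickle_inv => // z.
    exact: measurable_linked.
  apply/seteqP; split => w.
    move=> /asboolP[z]; rewrite mem_box -leqNgt => zn oz.
    by exists (pickle z) => //; rewrite pickleK_inv.
  move=> [i /= ni]; case E: pickle_inv => [z|//] /= oz.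
  apply/asboolP; exists z => //; rewrite mem_box -leqNgt.
  by have := @pickle_invK V i; rewrite E /= => ->.
have niJ m n : (m <= n)%N -> J n `<=` J m.
  move=> mn w /asboolP[z]; rewrite mem_box -leqNgt => nz oz; apply/asboolP.
  by exists z => //; rewrite mem_box -leqNgt (leq_trans mn).
have JI : \bigcap_n J n `<=` percolates.
  move=> w h; exists o; apply/infinite_cluster_far => n.
  have /asboolP[z] := h n Logic.I; rewrite mem_box -leqNgt => nz oz.
  by exists z.
have cJ : c <= pr P (\bigcap_n J n).
  have h := @pr_bigcap _ _ _ P _ mJ niJ.
  rewrite -(cvg_lim (@Rhausdorff R) h); apply: limr_ge.
    by apply/cvg_ex; eexists; exact: h.
  exists (pickle o).+1 => // n /= on.
  have oL : o \in box n by rewrite mem_box.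
  apply: (le_trans (hc _ oL)).
  pose s := touching_edges e nb (box n).
  pose A w := escapes (box n) o (fun f => (f \in s) && w f).
  have dA : depends (fun f => f \in s) A.
    move=> w w' ag; rewrite /A; congr (escapes _ o _); apply/funext => f.
    by case: (boolP (f \in s)) => //= /ag.
  have [mA eA] := pr_dep hP (@touching_edges_uniq _ e nb _) dA.
  apply: (@le_trans _ _ (pr P [set w | A w])).
    rewrite eA; apply: expect_le_supp => // w aw; apply: leb_nat.
    apply: escapes_mono => f wf; rewrite wf andbT.
    case: (boolP (f \in s)) => // fs.
    by move: wf; rewrite aw.
  apply: pr_le => // w; rewrite /A /=.
  by apply: escapes_mono => f /andP[].
have mI := measurable_percolates.
have p1 : pr P percolates = 1.
  case: percolates_01 => // p0; move: c0; rewrite ltNge => /negP; case.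
  rewrite -p0; apply: (le_trans cJ); apply: pr_le => //.
  exact: bigcap_measurable.
exists (~` percolates); split => //; first exact: measurableC.
by rewrite probability_setC// prE// p1 subee.
Qed.

(** By the Borel-Cantelli lemma, every cluster is almost surely finite. *)
Lemma not_ae_percolates (K : R) :
  (forall y (r : seq V), uniq r -> \sum_(z <- r) tau p y z <= K) ->
  ~ {ae P, forall w, exists x, infinite_set (Defs.cluster w x)}.
Proof.
move=> hK.
have null x : P.-negligible [set w | infinite_set (Defs.cluster w x)].
  pose F i : set (config e) :=
    if @pickle_inv V i is Some z then [set w | linked predT w x z] else set0.
  have mF i : measurable (F i).
    by rewrite /F; case: pickle_inv => // z; exact: measurable_linked.
  exists (lim_sup_set F); split.
  - apply: bigcap_measurable => // k _; exact: bigcup_measurable.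
  - apply: lim_sup_set_cvg0 => //; apply: (@le_lt_trans _ _ K%:E);
    last exact: ltry.
    apply: lime_le; first exact: is_cvg_nneseries.
    apply: nearW => n.
    rewrite (_ : (\sum_(0 <= i < n) _)%E = (\sum_(z <- box n) tau p x z)%:E).
      by rewrite lee_fin hK// (pmap_uniq (@pickle_invK V)) ?iota_uniq.
    rewrite /box /index_iota subn0; elim: (iota 0 n) => [|i r IH].
      by rewrite !big_nil.
    rewrite big_cons IH /=; rewrite /F; case: pickle_inv => [z|] /=.
      by rewrite big_cons EFinD -pr_linked prE//; exact: measurable_linked.
    by rewrite measure0 add0e.
  - move=> w /infinite_cluster_far h n _; have [z nz xz] := h n.
    by exists (pickle z) => //; rewrite /F pickleK_inv.
move=> [A [mA A0 hA]].
have : P.-negligible [set: config e].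
  apply: (@negligibleS _ _ _ _ (A `|` \bigcup_i
    (if @pickle_inv V i is Some x then [set w | infinite_set (Defs.cluster w
      x)] else set0))).
    move=> w _; case: (pselect (exists x, infinite_set (Defs.cluster w x))) =>
      h.
      by right; case: h => x h; exists (pickle x) => //; rewrite pickleK_inv.
    by left; apply: hA.
  apply: negligibleU; first by exists A; split.
  apply: negligible_bigcup => i; case: pickle_inv => // ;
    exact: negligible_set0.
move=> h0; have e0 : P setT = 0%E by apply/(negligibleP P measurableT).
have := probability_setT P; rewrite e0 => /eqP.
by rewrite eqe eq_sym oner_eq0.
Qed.

End InfiniteClusters.

(** * Symmetries of the tree *)

Section TreeWords.
Variable d : nat.
Implicit Types (x y : tree d) (a i j : 'I_d) (w z : seq 'I_d).

Definition nbr : rel 'I_d := fun i j => i != j.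

Lemma tree_inj x y : val x = val y -> x = y.
Proof. exact: val_inj. Qed.

Lemma tree_sorted x : sorted nbr (val x).
Proof. exact: (svalP x). Qed.

Definition mkT w (h : sorted nbr w) : tree d := exist _ w h.

Lemma tree_adjP x y :
  reflect (exists i, val y = i :: val x \/ val x = i :: val y) (tree_adj x y).
Proof.
apply: (iffP existsP) => -[i]; first by move=> /orP[]/eqP h; exists i;
  [left|right].
by move=> h; exists i; apply/orP; case: h => ->; rewrite eqxx; [left|right].
Qed.

Record tree_aut (g g' : tree d -> tree d) : Prop := TreeAut {
  autK : cancel g g';
  autVK : cancel g' g;
  aut_adj : forall x y, tree_adj (g x) (g y) = tree_adj x y }.

Lemma tree_aut_involution g : involutive g ->
  (forall x y, tree_adj x y -> tree_adj (g x) (g y)) -> tree_aut g g.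
Proof.
move=> gK h; split => // x y; apply/idP/idP; last exact: h.
by move/h; rewrite !gK.
Qed.

Lemma tree_aut_comp g g' h h' : tree_aut g g' -> tree_aut h h' ->
  tree_aut (g \o h) (h' \o g').
Proof.
move=> [gK g'K ag] [hK h'K ah]; split; [exact: can_comp|exact: can_comp|].
by move=> x y /=; rewrite ag ah.
Qed.

(** Left translation by the generator [a] in the free product of [d] copies of
    [Z/2Z]: adjacency modifies the head of a word, translations its other end. *)
Fixpoint append a w : seq 'I_d :=
  if w is x :: s then
    if (s == [::]) && (x == a) then [::] else x :: append a s
  else [:: a].

Lemma append_path a (x : 'I_d) w : path nbr x w -> (w = [::] -> x != a) ->
  path nbr x (append a w).
Proof.
elim: w x => [|y w IH] x /=; first by move=> _ /(_ erefl); rewrite /nbr => ->.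
move=> /andP[xy yw] _; case: ifPn => //= h; rewrite xy; apply: IH => // wE.
by move: h; rewrite wE.
Qed.

Lemma append_sorted a w : sorted nbr w -> sorted nbr (append a w).
Proof.
case: w => //= x w xw; case: ifPn => //= h; apply: append_path => // wE.
by move: h; rewrite wE.
Qed.

Lemma appendK a w : sorted nbr w -> append a (append a w) = w.
Proof.
elim: w => [|x w IH] /=; first by rewrite eqxx.
move=> xw; case: ifPn => [/andP[/eqP-> /eqP->]//|h] /=.
rewrite IH ?(path_sorted xw)//; case: ifPn => // /andP[/eqP wE /eqP xa].
move: h wE xw; case: w {IH} => [|y w] /=; first by rewrite xa eqxx.
by case: ifPn => // /andP[/eqP-> /eqP->] _ _; rewrite /nbr xa eqxx.
Qed.

Definition translate a x : tree d := mkT (append_sorted a (tree_sorted x)).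

Lemma translate_aut a : tree_aut (translate a) (translate a).
Proof.
apply: tree_aut_involution => [x|].
  by apply: tree_inj => /=; apply: appendK; exact: tree_sorted.
suff h x y i : val y = i :: val x -> tree_adj (translate a x) (translate a y).
  move=> x y /tree_adjP[i [/h//|/h]]; by rewrite tree_adjC.
move=> yE; apply/tree_adjP => /=; rewrite yE /=; case: ifPn.
  by move=> /andP[/eqP-> _]; exists a; right.
by move=> _; exists i; left.
Qed.

Lemma append_rcons a w : sorted nbr (rcons w a) -> append a w = rcons w a.
Proof.
elim: w => //= x w IH h; rewrite IH ?(path_sorted h)//.
by case: w h {IH} => //= /andP[/negbTE ->].
Qed.

(** Composing the generators of [w] gives the translation by [w], which is plain
    concatenation on the words [z] that do not cancel with [w]. *)
Lemma translation_exists w : sorted nbr w -> exists g g',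
  tree_aut g g' /\ forall z, sorted nbr (z ++ w) ->
    forall x, val x = z -> val (g x) = z ++ w.
Proof.
elim/last_ind: w => [_|w a IH].
  exists id, id; split; first by split.
  by move=> z _ x ->; rewrite cats0.
move=> wa; have sr t : sorted nbr (rcons t a) -> sorted nbr t.
  by case: t => //= y t; rewrite rcons_path => /andP[].
have [g [g' [ag hg]]] := IH (sr _ wa).
exists (translate a \o g), (g' \o translate a); split.
  by apply: tree_aut_comp => //; exact: translate_aut.
move=> z; rewrite -rcons_cat => zw x xz.
by rewrite /= (hg z (sr _ zw) x xz) append_rcons.
Qed.

(** Permuting by [s] the labels of the branches above the vertex [w].  It is an
    automorphism when [s] fixes the head of [w], the forbidden label there. *)
Definition relabel (s : 'I_d -> 'I_d) w z : seq 'I_d :=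
  if drop (size z - size w) z == w then
    map s (take (size z - size w) z) ++ w else z.

#[local] Arguments relabel : simpl never.

Lemma relabel_cat s w z : relabel s w (z ++ w) = map s z ++ w.
Proof. by rewrite /relabel size_cat addnK drop_size_cat// eqxx take_size_cat.
  Qed.

Lemma size_relabel s w z : size (relabel s w z) = size z.
Proof.
rewrite /relabel; case: ifPn => // /eqP h.
by rewrite -[in RHS](cat_take_drop (size z - size w) z) !size_cat size_map h.
Qed.

Lemma relabelP s w z : (exists2 t, z = t ++ w & relabel s w z = map s t ++ w) \/
  ((forall t, z <> t ++ w) /\ relabel s w z = z).
Proof.
have [h|h] := eqVneq (drop (size z - size w) z) w.
  left; exists (take (size z - size w) z); first by rewrite
    -[LHS](cat_take_drop (size z - size w)) h.
  by rewrite /relabel h eqxx.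
right; rewrite /relabel (negbTE h); split => // t zE; move/eqP: h; apply.
by rewrite zE size_cat addnK drop_size_cat.
Qed.

Lemma relabel_sorted s w z : injective s -> (forall i t, w = i :: t ->
  s i = i) ->
  sorted nbr z -> sorted nbr (relabel s w z).
Proof.
move=> si sw; case: (relabelP s w z) => [[t -> ->]|[_ ->]//].
case: t => //= x t; elim: t x => [|y t IH] x /=; last first.
  by move=> /andP[xy /IH ->]; rewrite andbT /nbr (inj_eq si).
case: w sw => //= y w sw; rewrite /nbr => /andP[xy ->].
by rewrite -(sw y w)// (inj_eq si) xy.
Qed.

Lemma relabelK s w : involutive s -> involutive (relabel s w).
Proof.
move=> sK z; case: (relabelP s w z) => [[t -> ->]|[_ h]]; last by rewrite !h.
by rewrite relabel_cat mapK.
Qed.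

Lemma rotation_exists w i j : sorted nbr (i :: w) -> sorted nbr (j :: w) ->
  exists g g', [/\ tree_aut g g', forall x, size (val (g x)) = size (val x) &
    forall x, val x = i :: w -> val (g x) = j :: w].
Proof.
move=> iw jw; pose s k := if k == i then j else if k == j then i else k.
have sK : involutive s.
  move=> k; rewrite /s; case: (eqVneq k i) => [->|ki].
    by rewrite eqxx; case: eqP.
  by case: (eqVneq k j) => [->|kj]; rewrite ?eqxx// (negbTE ki) (negbTE kj).
have sw k t : w = k :: t -> s k = k.
  move=> wE; move: iw jw; rewrite wE /= /nbr => /andP[ik _] /andP[jk _].
  by rewrite /s ![k == _]eq_sym (negbTE ik) (negbTE jk).
pose g x : tree d := mkT (relabel_sorted (inv_inj sK) sw (tree_sorted x)).
have gE x : val (g x) = relabel s w (val x) by [].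
exists g, g; split.
- apply: tree_aut_involution => [x|].
    by apply: tree_inj => /=; exact: relabelK.
  suff h x y k : val y = k :: val x -> tree_adj (g x) (g y).
    move=> x y /tree_adjP[k [/h//|/h]]; by rewrite tree_adjC.
  move=> yE; apply/tree_adjP; rewrite !gE yE.
  case: (relabelP s w (val x)) => [[t -> ->]|[nx ->]].
    by exists (s k); left; rewrite -cat_cons relabel_cat.
  case: (relabelP s w (k :: val x)) => [[t tE ->]|[_ ->]]; last by exists k;
    left.
  case: t tE => [/= <-|l t [_ /nx//]]; by exists k; left.
- by move=> x; rewrite gE size_relabel.
- by move=> x xE; rewrite gE xE -cat1s relabel_cat /= /s eqxx.
Qed.

(** Rotate around the root, then around each vertex of the branch leading to
    [y]. *)
Lemma sphere_transitive x y : size (val x) = size (val y) -> exists g g',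
  [/\ tree_aut g g', forall t, size (val (g t)) = size (val t) & g x = y].
Proof.
case: x y => w ws [w' ws'] /=; elim: w w' ws ws' =>
  [|i w IH] [|j w'] //= ws ws'.
  by move=> _; exists id, id; split => //; apply: tree_inj.
move=> [sw]; have [g [g' [ag sg gw]]] :=
  IH w' (path_sorted ws) (path_sorted ws') sw.
set x : tree d := exist _ (i :: w) ws; set u : tree d := exist _ w _ in gw.
have : tree_adj (g u) (g x) by rewrite (aut_adj ag); apply/tree_adjP; exists i;
  left.
move=> /tree_adjP[k]; rewrite gw /= => -[gx|gx]; last first.
  by have := sg x; have := congr1 size gx; rewrite /= sw; lia.
have kw : sorted nbr (k :: w') by rewrite -gx; exact: tree_sorted.
have [h [h' [ah sh hx]]] := rotation_exists kw ws'.
exists (h \o g), (g' \o h'); split; first exact: tree_aut_comp.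
  by move=> z /=; rewrite sh sg.
by apply: tree_inj; rewrite /= (hx _ gx).
Qed.

End TreeWords.

Section Spheres.
Variable d : nat.
Hypothesis hd : (3 <= d)%N.
Implicit Types (x y : tree d).

Fixpoint alternating (a b : 'I_d) n : seq 'I_d :=
  if n is n'.+1 then a :: alternating b a n' else [::].

Lemma size_alternating a b n : size (alternating a b n) = n.
Proof. by elim: n a b => //= n IH a b; rewrite IH. Qed.

Lemma sorted_alternating a b n : a != b -> sorted (@nbr d) (alternating a b n).
Proof.
move=> ab; case: n => //= n; elim: n a b ab => //= n IH a b ab.
by rewrite /nbr ab IH// eq_sym.
Qed.

Lemma word_cat_exists m n : exists z w : seq 'I_d,
  [/\ size z = m, size w = n & sorted (@nbr d) (z ++ w)].
Proof.
have d0 : (0 < d)%N by lia. have d1 : (1 < d)%N by lia.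
pose c := alternating (Ordinal d0) (Ordinal d1) (m + n).
exists (take m c), (drop m c); rewrite cat_take_drop.
split; [|by rewrite size_drop size_alternating addKn|exact: sorted_alternating].
by rewrite size_takel// size_alternating leq_addr.
Qed.

Definition letters x : seq 'I_d := [seq i <- enum 'I_d | ohead (val x) != Some
  i].

Definition child x (i : 'I_d) : tree d := insubd x (i :: val x).

Lemma child_val x i : i \in letters x -> val (child x i) = i :: val x.
Proof.
rewrite mem_filter => /andP[h _]; rewrite val_insubd ifT//.
have := tree_sorted x; case: (val x) h => //= j t; rewrite /nbr => ij ->.
by rewrite andbT; apply: contraNneq ij => ->.
Qed.

Lemma size_letters_bounds x : (d.-1 <= size (letters x) <= d)%N.
Proof.
rewrite size_filter; have := count_size (fun i => ohead (val x) != Some i)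
  (enum 'I_d).
rewrite size_enum_ord => h; rewrite h andbT.
have := count_predC (fun i => ohead (val x) == Some i) (enum 'I_d).
rewrite size_enum_ord.
suff : (count (fun i => ohead (val x) == Some i) (enum 'I_d) <= 1)%N.
  have -> : count (predC (fun i => ohead (val x) == Some i)) (enum 'I_d) =
    count (fun i => ohead (val x) != Some i) (enum 'I_d) by [].
  lia.
case: (ohead _) => [j|]; last by rewrite count_pred0.
rewrite (eq_count (a2 := pred1 j)); last by move=> i /=; rewrite eq_sym.
by rewrite count_uniq_mem ?enum_uniq// leq_b1.
Qed.

Lemma size_letters x : val x <> [::] -> size (letters x) = d.-1.
Proof.
case E : (val x) => [|j t]// _; rewrite size_filter.
have := count_predC (pred1 j) (enum 'I_d).
rewrite size_enum_ord count_uniq_mem ?enum_uniq// mem_enum.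
rewrite (eq_count (a2 := (fun i => ohead (val x) != Some i)));
  first by move=> /=; lia.
by move=> i /=; rewrite E eq_sym.
Qed.

Fixpoint sphere n : seq (tree d) :=
  if n is m.+1 then [seq child x i | x <- sphere m, i <- letters x]
  else [:: tree_root d].

Lemma mem_sphere n x : (x \in sphere n) = (size (val x) == n).
Proof.
elim: n x => [|n IH] x /=.
  rewrite inE; apply/eqP/eqP => [->//|/size0nil h]; exact: tree_inj.
apply/allpairsPdep/eqP => [[y [i [yn il ->]]]|h].
  by move: yn; rewrite IH child_val//= => /eqP ->.
case E : (val x) h => [//|i w] /= [sw].
have ws : sorted (@nbr d) (i :: w) by rewrite -E; exact: tree_sorted.
have il : i \in letters (mkT (path_sorted ws)).
  rewrite mem_filter mem_enum andbT /=.
  by case: w ws {E sw} => //= j t; rewrite /nbr => /andP[h _];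
    apply: contraNneq h => -[->].
exists (mkT (path_sorted ws)), i; split => //; first by rewrite IH /= sw.
by apply: tree_inj; rewrite child_val.
Qed.

Lemma uniq_sphere n : uniq (sphere n).
Proof.
elim: n => //= n IH; apply: allpairs_uniq_dep => //.
  by move=> x _; rewrite filter_uniq// enum_uniq.
move=> u v /allpairsPdep[x [i [_ il ->]]] /allpairsPdep[y [j [_ jl ->]]] /=.
move=> /(congr1 val); rewrite !child_val// => -[ij xy].
by rewrite ij (tree_inj xy).
Qed.

Lemma size_sphere_S n : (0 < n)%N -> size (sphere n.+1) = (size (sphere n) *
  d.-1)%N.
Proof.
move=> n0; rewrite /= size_allpairs_dep sumnE big_map.
rewrite (eq_big_seq (fun=> d.-1)) ?big_const_seq ?iter_addn ?addn0 ?count_predT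
  1?mulnC//.
move=> x; rewrite mem_sphere => /eqP xn; apply: size_letters => xE.
by move: n0; rewrite -xn xE.
Qed.

(** The exact size is [d * (d - 1) ^ n.-1] for [n > 0]. *)
Lemma size_sphere_bounds n :
  (d.-1 ^ n <= size (sphere n) <= 2 * d.-1 ^ n)%N.
Proof.
elim: n => // -[_|n IH].
  rewrite /= cats0 size_map expn1; have := size_letters_bounds (tree_root d);
    lia.
by rewrite size_sphere_S// expnSr; have := IH; nia.
Qed.

End Spheres.

(** * The product of the tree and the line *)

Section TreeLine.
Variables (R : realType) (d : nat).
Local Notation V := (tree d * int)%type.
Local Notation e := (@tree_line d).
Implicit Types (x y : tree d) (k l : int) (u v : V).

Lemma tree_line_sym : symmetric e.
Proof.
move=> u v; rewrite /tree_line /cartesian_product /line_adj.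
by rewrite eq_sym distrC tree_adjC [u.2 == _]eq_sym.
Qed.

Lemma tree_line_irr : irreflexive e.
Proof.
by move=> u; rewrite /tree_line /cartesian_product /line_adj tree_adj_irr subrr
  normr0 andbF.
Qed.

Definition nbT x : seq (tree d) := sval (cid (tree_regular x)).

Lemma nbTP x y : (y \in nbT x) = tree_adj x y.
Proof. by rewrite /nbT; case: cid => s [_ _ ->]. Qed.

Lemma size_nbT x : size (nbT x) = d.
Proof. by rewrite /nbT; case: cid => s []. Qed.

Definition nb u : seq V :=
  [:: (u.1, u.2 + 1), (u.1, u.2 - 1) & [seq (y, u.2) | y <- nbT u.1]].

Lemma nbP u v : (v \in nb u) = e u v.
Proof.
case: u v => [x k] [y l]; rewrite /tree_line /cartesian_product /line_adj /=.
rewrite !inE orbA; congr orb.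
  by rewrite !xpair_eqE -andb_orr eq_sym /=; congr andb; apply/idP/idP; lia.
apply/mapP/andP => /= [[z zx [-> ->]]|[xy /eqP->]]; first by rewrite -nbTP eqxx.
by exists y; rewrite ?nbTP.
Qed.

Lemma size_nb u : size (nb u) = d.+2.
Proof. by rewrite /= size_map size_nbT. Qed.

Lemma aut_lift g g' : @tree_aut d g g' ->
  is_aut e (fun u => (g u.1, u.2)) (fun u => (g' u.1, u.2)).
Proof.
move=> [gK g'K ag]; split => [[x k]|[x k]|[x k] [y l]] /=; rewrite ?gK ?g'K//.
by rewrite /tree_line /cartesian_product /= ag (can_eq gK).
Qed.

Definition reflection (c : int) u : V := (u.1, c - u.2).

Lemma aut_reflection c : is_aut e (reflection c) (reflection c).
Proof.
split => [[x k]|[x k]|[x k] [y l]]; rewrite /reflection /= ?subKr//.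
rewrite /tree_line /cartesian_product /line_adj /=; congr (_ && _ || _ && _).
  by apply/idP/idP; lia.
by apply/eqP/eqP; lia.
Qed.

Definition origin : V := (tree_root d, 0).

Lemma vertex_transitive v : exists g g', is_aut e g g' /\ g origin = v.
Proof.
case: v => x c; have [g [g' [ag hg]]] := translation_exists (tree_sorted x).
exists (reflection c \o (fun u => (g u.1, u.2))),
  ((fun u => (g' u.1, u.2)) \o reflection c); split.
  by apply: is_aut_comp; [exact: aut_reflection|exact: aut_lift].
rewrite /reflection /= subr0; congr pair; apply: tree_inj.
by rewrite (hg [::])//=; exact: tree_sorted.
Qed.

Lemma reach_origin v : exists n, reach e n origin v.
Proof.
have vert x (n : nat) : exists m, reach e m (x, 0) (x, n%:Z) /\
    reach e m (x, 0) (x, - n%:Z).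
  elim: n => [|n [m [h1 h2]]].
    by exists 0%N; rewrite oppr0; split; exists [::].
  exists (m + 1)%N; split.
    apply: reach_trans h1 _; exists [:: (x, n.+1%:Z)]; rewrite /= andbT;
      split => //.
    by rewrite /tree_line /cartesian_product /line_adj /= eqxx; lia.
  apply: reach_trans h2 _; exists [:: (x, - n.+1%:Z)]; rewrite /= andbT;
    split => //.
  by rewrite /tree_line /cartesian_product /line_adj /= eqxx; lia.
have hor w (ws : sorted (@nbr d) w) : exists m, reach e m origin (mkT ws, 0).
  elim: w ws => [|i w IH] ws.
    by exists 0%N, [::]; split => //; congr pair; apply: tree_inj.
  have [m hm] := IH (path_sorted ws); exists (m + 1)%N.
  apply: reach_trans hm _; exists [:: (mkT ws, 0)]; rewrite /= andbT;
    split => //.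
  rewrite /tree_line /cartesian_product /= eqxx andbT; apply/orP; right.
  by apply/tree_adjP; exists i; left.
case: v => x k; have [m hm] := hor _ (tree_sorted x).
have [m' [h1 h2]] := vert x `|k|%N.
have -> : x = mkT (tree_sorted x) by exact: tree_inj.
exists (m + m')%N; apply: reach_trans hm _.
by have [k0|k0] := leP 0 k; [move: h1|move: h2]; congr reach;
  rewrite /=; congr pair; (try exact: tree_inj); lia.
Qed.

Lemma reach_size n x k : reach e n origin (x, k) -> (size (val x) <= n)%N.
Proof.
move=> [q [pq lq sq]]; apply: leq_trans sq.
have -> : x = (last origin q).1 by rewrite lq.
have -> : size q = (size (val origin.1) + size q)%N by [].
elim: q origin pq {lq} => [|v q IH] u /=; first by rewrite addn0.
move=> /andP[uv /IH h]; apply: (leq_trans h).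
rewrite addnS -addSn leq_add2r.
case/orP: uv => /andP[]; first by move=> /eqP ->.
move=> /tree_adjP[i [->|->]] _ //=; exact: (leq_trans (leqnSn _) (leqnSn _)).
Qed.

Section ConnectionProbabilities.
Hypothesis hd : (3 <= d)%N.
Variable p : R.
Hypothesis p01 : 0 <= p <= 1.
Local Notation tau := (two_point e p).

Lemma two_point_reflect c x y k l : tau (x, c - k) (y, c - l) = tau (x, k) (y,
  l).
Proof.
exact: (two_point_aut tree_line_sym tree_line_irr (x, k) (y,
  l) p01 (aut_reflection c)).
Qed.

Lemma two_point_shift c x y k l : tau (x, k + c) (y, l + c) = tau (x, k) (y, l).
Proof.
rewrite -(two_point_reflect 0 x y k l) -(two_point_reflect c x y (0 - k)).
by congr two_point; congr pair; lia.
Qed.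

Lemma two_point_tree_aut g g' x y k l : @tree_aut d g g' ->
  tau (g x, k) (g y, l) = tau (x, k) (y, l).
Proof.
move=> ag.
exact: (two_point_aut tree_line_sym tree_line_irr (x, k) (y,
  l) p01 (aut_lift ag)).
Qed.

(** The two-point function in polar coordinates, read at one vertex of the sphere
    of radius [n]; by [two_pointE] the choice does not matter. *)
Definition polar (n : nat) k : R :=
  tau origin (nth (tree_root d) (sphere d n) 0, k).

Lemma two_pointE x k : tau origin (x, k) = polar (size (val x)) k.
Proof.
rewrite /polar; set y := nth _ _ _.
have ys : y \in sphere d (size (val x)).
  apply: mem_nth; have /andP[h _] := size_sphere_bounds hd (size (val x)).
  apply: leq_trans h; rewrite expn_gt0; lia.
have [g [g' [ag sg gx]]] : exists g g', [/\ @tree_aut d g g',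
    forall t, size (val (g t)) = size (val t) & g x = y].
  by apply: sphere_transitive; move: ys; rewrite mem_sphere => /eqP.
rewrite -(two_point_tree_aut _ _ _ _ ag) gx; congr two_point; congr pair.
by apply: tree_inj; apply: size0nil; rewrite sg.
Qed.

Lemma polar_ge0 n k : 0 <= polar n k. Proof. exact: two_point_ge0. Qed.
Lemma polar_le1 n k : polar n k <= 1. Proof. exact: two_point_le1. Qed.

(** Concatenate a connection to a word [w] of length [m] with the translate by
    [w] of a connection to a word [z] of length [n]. *)
Lemma polar_mul m n k l : polar m k * polar n l <= polar (n + m) (k + l).
Proof.
have [z [w [zn wm zw]]] := word_cat_exists hd n m.
have ws : sorted (@nbr d) w.
  by elim: z {zn} zw => //= i z IH h; apply: IH; exact: path_sorted h.
have zs : sorted (@nbr d) z.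
  case: z {zn} zw => //= i z; rewrite cat_path; by case/andP.
have [g [g' [ag hg]]] := translation_exists ws.
have e1 : polar m k = tau origin (mkT ws, k) by rewrite two_pointE wm.
have e2 : polar n l = tau (mkT ws, k) (mkT zw, k + l).
  rewrite -[in LHS]zn -[z]/(val (mkT zs)) -two_pointE -(two_point_tree_aut _ _
    _ _ ag).
  rewrite -(two_point_shift k) add0r (addrC l); congr two_point; congr pair;
    apply: tree_inj.
    by rewrite (hg [::]).
  by rewrite (hg z).
have e3 : polar (n + m) (k + l) = tau origin (mkT zw, k + l).
  by rewrite two_pointE /= size_cat zn wm.
by rewrite e1 e2 e3; exact: two_point_mul.
Qed.

Lemma polar_opp n k : polar n (- k) = polar n k.
Proof. by rewrite /polar -[RHS](two_point_reflect 0) !sub0r oppr0. Qed.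

(** A connection followed by its reflection in a horizontal level ends at height
    [0], twice as far in the tree. *)
Lemma polar_sqr n k : polar n k ^+ 2 <= polar (n + n) 0.
Proof. by rewrite expr2 -{2}polar_opp -(subrr k); exact: polar_mul. Qed.

(** A connection to height [k], followed by its mirror image with respect to
    this height, comes back above the root. *)
Lemma polar_sqr_line n k : polar n k ^+ 2 <= polar 0 (k + k).
Proof.
rewrite expr2 {2}/polar -(two_point_reflect (k + k)) subr0 addrK two_pointC.
rewrite -[X in _ <= polar X _]/(size (val (tree_root d))) -two_pointE.
exact: two_point_mul.
Qed.

End ConnectionProbabilities.
End TreeLine.

(** * Climbing along the line *)

(** The probability [1 - q ^+ n] that one of [n] edges is open is at most
    [1 - q ^+ M] when [0 < n <= M]; otherwise [n / M >= 1] and the right-hand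
    side is at least [1]. *)
Lemma survival_bound (R : realType) (q : R) M n : 0 <= q <= 1 -> (0 < M)%N ->
  1 - q ^+ n <= (1 - q ^+ M) * (n != 0)%:R + q ^+ M * (n%:R / M%:R).
Proof.
move=> /andP[q0 q1] M0; case: n => [|n].
  by rewrite expr0 subrr mulr0 mul0r mulr0 addr0.
have t0 : 0 <= n.+1%:R / M%:R :> R by rewrite divr_ge0.
have t1 : (M < n.+1)%N -> 1 <= n.+1%:R / M%:R :> R.
  by move=> Mn; rewrite ler_pdivlMr ?ltr0n// mul1r ler_nat ltnW.
have c0 : 0 <= q ^+ M by rewrite exprn_ge0.
have a0 : 0 <= q ^+ n.+1 by rewrite exprn_ge0.
have ac : (n.+1 <= M)%N -> q ^+ M <= q ^+ n.+1 by move=> *; apply: ler_wiXn2l.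
rewrite mulr1; move: t0 t1 c0 a0 ac.
move: (n.+1%:R / M%:R : R) (q ^+ M) (q ^+ n.+1) => t c a t0 t1 c0 a0 ac.
have ct0 := mulr_ge0 c0 t0.
have [/ac|/t1 t1'] := leqP n.+1 M; first lra.
have := ler_wpM2l c0 t1'; lra.
Qed.

Lemma affine_recurrence (R : realType) (q c : R) (D : nat -> R) :
  0 <= q <= 1 -> 0 <= c -> D 0%N <= 1 ->
  (forall j, D j.+1 <= (1 - q) * D j + q * c) ->
  forall j, D j <= (1 - q) ^+ j + c.
Proof.
move=> /andP[q0 q1] c0 D0 DS; elim=> [|j IH]; first by rewrite expr0; lra.
apply: (le_trans (DS j)); rewrite exprS.
have q1' : 0 <= 1 - q by lra.
have := ler_wpM2l q1' IH; lra.
Qed.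

Lemma line_crossing (j : nat) (k l : int) :
  `|k - l| == 1 -> k <= j%:Z -> ~~ (l <= j%:Z) -> k = j%:Z /\ l = j.+1%:Z.
Proof. lia. Qed.

Section HalfSpace.
Variables (R : realType) (d : nat).
Local Notation V := (tree d * int)%type.
Local Notation e := (@tree_line d).
Local Notation origin := (origin d).
Implicit Types (x y : tree d) (k l : int) (u v : V).
Implicit Types (s : seq (edge e)) (w : edge e -> bool) (B : seq (tree d)).
Variable p : R.
Hypothesis p01 : 0 <= p <= 1.
Hypothesis p1 : p < 1.
Let q01 : 0 <= 1 - p <= 1.
Proof. by rewrite subr_ge0 ltW//= lerBlDr lerDl; case/andP: p01. Qed.

Let cl0 : edge e -> bool := @closed_config (edge e).
Local Notation tau := (two_point e p).
Local Notation A := (polar d p).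

Lemma vertical_edge (j : nat) x :
  exists f : edge e, ends f (x, j%:Z) (x, j.+1%:Z).
Proof.
apply: (edge_ends (@tree_line_sym d) (@tree_line_irr d)).
by rewrite /tree_line /cartesian_product /line_adj /= eqxx; lia.
Qed.

Let up j x : edge e := sval (cid (vertical_edge j x)).

Let up_ends j x : ends (up j x) (x, j%:Z) (x, j.+1%:Z).
Proof. exact: (svalP (cid (vertical_edge j x))). Qed.

Let up_inj j : injective (up j).
Proof.
move=> x y E; have := up_ends j x; rewrite E => /orP[] /eqP expect;
  case/orP: (up_ends j y) => /eqP; rewrite expect => -[]; (try by []); lia.
Qed.

Let below (j : nat) : pred V := fun u => u.2 <= j%:Z.

Variables (s : seq (edge e)) (us : uniq s).

(** This list contains the tree coordinates that an open path from the origin can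
    visit when only the edges of [s] may be open. *)
Let base : seq (tree d) :=
  undup (tree_root d :: [seq (val f).1.1 | f <- s] ++ [seq (val f).2.1 | f <-
    s]).

Let base_root : tree_root d \in base.
Proof. by rewrite mem_undup mem_head. Qed.

Let base_ends f u v : f \in s -> ends f u v -> u.1 \in base.
Proof.
move=> fs fuv; rewrite mem_undup inE mem_cat; apply/orP; right; apply/orP.
by case/orP: fuv => /eqP E; [left|right]; apply/mapP; exists f; rewrite ?E.
Qed.

Let T j w := [seq x <- base | linked (below j) w origin (x, j%:Z)].

Let T_depends j B : depends (inside (below j)) (fun w => T j w == B).
Proof.
move=> w w' ag; congr (_ == B); apply: eq_filter => x; exact: linked_depends.
Qed.

Let supp w := agree [pred f | f \notin s] w cl0.

Let supp_s w f : supp w -> w f -> f \in s.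
Proof. by move=> sw wf; apply: contraT => fs; move: wf; rewrite sw. Qed.

(** A path in the next half-space first leaves the lower one through a vertical
    edge, and its part before this edge stays below level [j]. *)
Let T_step j w : supp w -> T j.+1 w != [::] ->
  exists2 x, x \in T j w & w (up j x).
Proof.
move=> sw; case E : (T j.+1 w) => [//|x r] _.
have : x \in T j.+1 w by rewrite E mem_head.
rewrite mem_filter => /andP[h _].
have b0 : below j origin by [].
have b1 : ~~ below j (x, j.+1%:Z) by rewrite /below lez_nat ltnn.
have [u [v [ou uv v1 v2 _]]] := linked_exit h b0 b1.
have [_ /andP[_ u2]] := linked_ends ou.
case/open_adjP: uv => f fuv wf.
have euv := ends_adj (@tree_line_sym d) fuv.
case: u v ou v1 v2 u2 fuv euv => [y k] [z l] ou /=;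
  rewrite /below /= => v1 v2 u2 fuv.
rewrite /tree_line /cartesian_product /line_adj /= => /orP[/andP[/eqP yz kl]|];
  last first.
  by move=> /andP[_ /eqP kl]; move: v2; rewrite -kl u2.
have [kE lE] := line_crossing kl u2 v2; subst z k l; exists y.
  rewrite mem_filter (base_ends (supp_s sw wf) fuv) andbT.
  by apply: linked_sub ou => // z /andP[].
by rewrite -(ends_inj fuv (up_ends j y)).
Qed.

Let D j : R := expect p s (fun w => (T j w != [::])%:R) cl0.

Variable K : R.
Hypothesis hK : forall (k : int) B, uniq B -> \sum_(x <- B) tau origin (x,
  k) <= K.

Let up_closed j B : uniq B -> (1 - p) ^+ size B <=
  expect p s (fun w => \prod_(f <- map (up j) B) (1 - (w f)%:R)) cl0.
Proof.
move=> uB; rewrite -(size_map (up j)); apply: expect_prod => //.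
- by rewrite map_inj_uniq//; exact: up_inj.
- by rewrite subr_ge0 ltW.
- by move=> f w; rewrite subr_ge0 natb_le1.
- by move=> f w w' ag; rewrite (ag f)//=.
move=> f _; rewrite (_ : (fun w => _) = fun w => (fun=> 1) w - (w f)%:R)//.
rewrite expectB expect_cst expect_edge//; case: ifP => _ //=.
by rewrite lerD2l lerN2 /=; case/andP: p01.
Qed.

Let size_T j : expect p s (fun w => (size (T j w))%:R) cl0 <= K.
Proof.
apply: le_trans (hK j%:Z (undup_uniq _)).
apply: (@le_trans _ _ (expect p s (fun w => \sum_(x <- base)
    (linked predT w origin (x, j%:Z))%:R) cl0)).
  apply: expect_le => // w; rewrite /T -sum1_size big_filter natr_sum
    big_mkcond /=.
  apply: ler_sum => x _; case: ifP => // h.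
  by rewrite (_ : linked predT w _ _ = true)//; apply: linked_sub h.
rewrite expect_sum; apply: ler_sum => x _; exact: two_point_fin_le.
Qed.

(** Condition on [T j], which is decided by the edges below level [j]; the edges
    above it are fresh, and [survival_bound] averages to an affine recurrence
    since [T j] has at most [K] points on average. *)
Let D_step j M : (0 < M)%N ->
  D j.+1 <= (1 - (1 - p) ^+ M) * D j + (1 - p) ^+ M * (K / M%:R).
Proof.
move=> M0; have q0 : 0 <= (1 - p) ^+ M.
  by rewrite exprn_ge0//; case/andP: q01.
pose Pi j B w : R := \prod_(f <- map (up j) B) (1 - (w f)%:R).
have Pi1 B w : Pi j B w <= 1.
  rewrite /Pi; elim: (map _ B) => [|f r IH]; first by rewrite big_nil.
  rewrite big_cons; case: (w f); rewrite ?subrr ?mul0r//.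
  by rewrite subr0 mul1r.
apply: (@le_trans _ _ (expect p s (fun w => \sum_(B <- sublists base)
   (T j w == B)%:R * (1 - Pi j B w)) cl0)).
  apply: expect_le_supp => // w sw; rewrite /T sum_sublists -/(T j w).
  case: (boolP (_ != _)) => [/(T_step sw)[x xT wx]|_]; last by rewrite subr_ge0.
  rewrite /Pi (big_rem (up j x)) ?map_f//= wx subrr mul0r subr0//.
rewrite expect_sum.
apply: (@le_trans _ _ (expect p s (fun w => \sum_(B <- sublists base)
   (T j w == B)%:R * ((1 - (1 - p) ^+ M) * (size B != 0)%:R +
      (1 - p) ^+ M * ((size B)%:R / M%:R))) cl0)); last first.
  rewrite (_ : (fun w => _) = fun w => (1 - (1 - p) ^+ M) * (T j w != [::])%:R +
      ((1 - p) ^+ M / M%:R) * (size (T j w))%:R); last first.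
    apply/funext => w.
    rewrite /T (sum_sublists _ _ (fun B => (1 - (1 - p) ^+ M) * (size B !=
      0)%:R +
      (1 - p) ^+ M * ((size B)%:R / M%:R))) size_eq0 -/(T j w).
    by rewrite mulrA mulrAC.
  rewrite expectD !expectZ lerD2l [leRHS]mulrA [leRHS]mulrAC ler_wpM2l//.
  by rewrite divr_ge0// ler0n.
rewrite expect_sum big_seq [leRHS]big_seq; apply: ler_sum => B Bb.
have uB : uniq B.
  move: Bb; rewrite mem_undup => /mapP[m _ ->]; by apply: mask_uniq;
    exact: undup_uniq.
rewrite (@expect_indep _ _ p s (inside (below j)) (fun w => (T j w == B)%:R)
  (fun w => 1 - Pi j B w)); last first.
- move=> w w' ag; congr (1 - _); rewrite /Pi !big_map; apply: eq_bigr => x _.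
  by rewrite (ag (up j x))//= (ends_inside _ (up_ends j x)) /below !lez_nat
    ltnn andbF.
- by move=> w w' ag; rewrite (T_depends B ag).
rewrite (@expect_indep _ _ p s (inside (below j)) (fun w => (T j w == B)%:R)
  (fun w => _)); last first.
- by [].
- by move=> w w' ag; rewrite (T_depends B ag).
rewrite ler_wpM2l ?expect_ge0// expect_cst expectB expect_cst.
apply: le_trans (survival_bound (size B) q01 M0); rewrite lerD2l lerN2.
exact: up_closed.
Qed.

Let D_bound j M : (0 < M)%N -> D j <= (1 - (1 - p) ^+ M) ^+ j + K / M%:R.
Proof.
move=> M0; apply: affine_recurrence => [||| {}j].
- case/andP: q01 => q0 q1; by rewrite exprn_ge0//= exprn_ile1.
- rewrite divr_ge0 ?ler0n//.
  by have := hK 0 (isT : uniq [::]); rewrite big_nil.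
- by apply: expect_le1 => // w; exact: natb_le1.
- exact: D_step.
Qed.

Let two_point_fin_D (j : nat) : two_point_fin p s origin (tree_root d, j%:Z) <=
  D j.
Proof.
apply: expect_le_supp => // w sw; apply: leb_nat => h.
suff [x xT] : exists x, x \in T j w by apply: contraTneq xT => ->.
case: j h => [|j] h.
  exists (tree_root d); rewrite mem_filter base_root andbT.
  by apply: linked_refl; rewrite /below.
have b0 : below j origin by [].
have b1 : ~~ below j (tree_root d, j.+1%:Z) by rewrite /below lez_nat ltnn.
have [u [v [ou uv _ v2 _]]] := linked_exit h b0 b1.
have [_ /andP[_ u2]] := linked_ends ou.
case/open_adjP: (uv) => f fuv wf.
have euv := ends_adj (@tree_line_sym d) fuv.
have v1 : v.2 = j.+1%:Z.
  case/orP: euv => /andP[]; last by move=> _ /eqP kl; case/negP: v2;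
    rewrite /below -kl.
  by move=> _ /line_crossing/(_ u2 v2)[].
exists v.1; rewrite mem_filter (@base_ends f v u) ?(supp_s sw wf)// 1?endsC//
  andbT -v1.
rewrite -surjective_pairing; apply: (@linked_step _ _ _ _ _ u) => //.
  by apply: linked_sub ou => // z /andP[_ /le_trans]; apply; rewrite lez_nat.
by rewrite /below v1.
Qed.

(** Taking first [M] and then [j] large makes the bound small, uniformly in the
    finite list of edges [s]. *)
Lemma two_point_fin_line_le (j M : nat) : (0 < M)%N ->
  two_point_fin p s origin (tree_root d, j%:Z) <= (1 - (1 - p) ^+ M) ^+ j + K /
    M%:R.
Proof. by move=> M0; apply: le_trans (two_point_fin_D j) (D_bound j M0). Qed.

End HalfSpace.

(** * Large cylinders *)

Lemma geometric_sum_le (R : realType) (r : R) m n : 0 <= r < 1 ->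
  \sum_(m <= i < n) r ^+ i <= r ^+ m / (1 - r).
Proof.
move=> /andP[r0 r1]; have q0 : 0 < 1 - r by rewrite subr_gt0.
rewrite ler_pdivlMr//; have [mn|nm] := leqP m n; last first.
  by rewrite big_geq 1?ltnW// mul0r exprn_ge0.
suff -> : (\sum_(m <= i < n) r ^+ i) * (1 - r) = r ^+ m - r ^+ n.
  by rewrite lerBlDr lerDl exprn_ge0.
rewrite -[RHS]opprB -(telescope_sumr (fun i => r ^+ i) mn) -sumrN mulr_suml.
apply: eq_bigr => i _.
by rewrite exprS; ring.
Qed.

Lemma exprn_small (R : realType) (r eps : R) : 0 <= r < 1 -> 0 < eps ->
  exists N, forall n, (N <= n)%N -> r ^+ n < eps.
Proof.
move=> /andP[r0 r1] e0.
have h : (fun n => r ^+ n) @ \oo --> (0 : R) by apply: cvg_expr;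
  rewrite ger0_norm.
have [N _ hN] := cvgr0_norm_lt _ h _ e0; exists N => n /hN.
by rewrite ger0_norm// exprn_ge0.
Qed.

(** Each vertex is the inner end of at most [D] boundary edges. *)
Lemma sum_bdry_le (R : realType) (V : countType) (e : rel V) (nb : V -> seq V)
    (D : nat) (L B : seq V) (g : V -> R) :
  (forall x y, (y \in nb x) = e x y) -> symmetric e ->
  (forall x, size (nb x) <= D)%N -> (forall x, 0 <= g x) ->
  {in bdry e nb L, forall f, inner L f \in B} ->
  \sum_(f <- bdry e nb L) g (inner L f) <= D%:R * \sum_(z <- B) g z.
Proof.
move=> nbP e_sym nbD g0 inB.
pose h (f : edge e) := (inner L f, outer L f).
have -> : \sum_(f <- bdry e nb L) g (inner L f) = \sum_(q <- map h (bdry e nb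
  L)) g q.1.
  by rewrite big_map.
apply: (@le_trans _ _ (\sum_(q <- [seq (z, y) | z <- B, y <- nb z]) g q.1)).
  apply: ler_sum_sub => //.
    rewrite map_inj_in_uniq ?bdry_uniq// => f f' fb fb' [E1 E2].
    have [_ _ h1] := bdryP nbP e_sym fb; have [_ _ h2] := bdryP nbP e_sym fb'.
    by rewrite -E1 -E2 in h2; exact: ends_inj h1 h2.
  move=> _ /mapP[f fb ->]; apply/allpairsPdep; exists (inner L f), (outer L f).
  split => //; first exact: inB.
  by have [_ _ h1] := bdryP nbP e_sym fb; rewrite nbP (ends_adj e_sym h1).
rewrite big_allpairs_dep mulr_sumr; apply: ler_sum => z _ /=.
rewrite big_const_seq count_predT iter_addr addr0 -[leLHS]mulr_natl.
by rewrite ler_wpM2r// ler_nat.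
Qed.

Lemma heights_bound (J i : nat) (k : int) : (i < (2 * J).+1)%N ->
  k = i%:Z - J%:Z ->
  (`|k| <= J)%N.
Proof. lia. Qed.

Lemma heights_index (J : nat) (k : int) : (`|k| <= J)%N ->
  (absz (k + J%:Z)%R < (2 * J).+1)%N /\ k = (absz (k + J%:Z)%R)%:Z - J%:Z.
Proof. lia. Qed.

Lemma height_exit (J : nat) (k l : int) : `|k - l| == 1 -> (`|k| <= J)%N ->
  ~~ (`|l| <= J)%N ->
  k = J%:Z \/ k = - J%:Z.
Proof. lia. Qed.

Section Box.
Variables (R : realType) (d : nat).
Hypothesis hd : (3 <= d)%N.
Local Notation V := (tree d * int)%type.
Local Notation e := (@tree_line d).
Local Notation origin := (origin d).
Implicit Types (x y : tree d) (k l : int) (u v : V).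

Definition ball N : seq (tree d) := flatten [seq sphere d n | n <- iota 0 N.+1].

Lemma mem_ball N x : (x \in ball N) = (size (val x) <= N)%N.
Proof.
apply/flatten_mapP/idP => [[n]|xN].
  by rewrite mem_iota add0n ltnS mem_sphere => /= nN /eqP ->.
by exists (size (val x)); rewrite ?mem_sphere// mem_iota add0n ltnS.
Qed.

Lemma sum_ball N (F : nat -> R) :
  \sum_(x <- ball N) F (size (val x)) =
  \sum_(0 <= n < N.+1) (size (sphere d n))%:R * F n.
Proof.
rewrite big_flatten big_map /index_iota subn0; apply: eq_bigr => n _.
rewrite (eq_big_seq (fun=> F n)); last by move=> x;
  rewrite mem_sphere => /eqP ->.
by rewrite big_const_seq count_predT iter_addr addr0 mulr_natl.
Qed.

Definition heights (J : nat) : seq int := [seq i%:Z - J%:Z | i <- iota 0 (2 *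
  J).+1].

Lemma mem_heights J k : (k \in heights J) = (`|k| <= J)%N.
Proof.
apply/mapP/idP => [[i]|kJ].
  by rewrite mem_iota add0n => /= h1 h2; exact: heights_bound h1 h2.
have [h1 h2] := heights_index kJ.
by exists (absz (k + J%:Z)%R); rewrite // mem_iota add0n.
Qed.

Definition cylinder N J : seq V := [seq (x, k) | x <- ball N, k <- heights J].

Lemma mem_cylinder N J u :
  (u \in cylinder N J) = (size (val u.1) <= N)%N && (`|u.2| <= J)%N.
Proof.
apply/allpairsP/andP => [[[x k] /= [xN kJ ->]]|[h1 h2]].
  by rewrite -mem_ball -mem_heights.
by exists u; rewrite mem_ball mem_heights -surjective_pairing.
Qed.

Definition cylinder_side N J : seq V :=
  [seq (x, J%:Z) | x <- ball N] ++ [seq (x, - J%:Z) | x <- ball N] ++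
  [seq (x, k) | x <- sphere d N, k <- heights J].

(** An edge leaving the cylinder is vertical at the top or at the bottom, or
    horizontal at the lateral side. *)
Lemma cylinder_inn N J :
  {in bdry e (@nb d) (cylinder N J), forall f, inner (cylinder N J) f \in
    cylinder_side N J}.
Proof.
move=> f /(bdryP (@nbP d) (@tree_line_sym d)).
case: (inner _ f) (outer _ f) => [x k] [y l] []; rewrite !mem_cylinder /=.
move=> /andP[xN kJ] nyl /(ends_adj (@tree_line_sym d)) /orP[] /andP[] /=;
  rewrite /cylinder_side !mem_cat.
  move=> /eqP xy kl; rewrite -xy xN /= in nyl.
  have xb : x \in ball N by rewrite mem_ball.
  have [->|->] := height_exit kl kJ nyl; rewrite (map_f (fun x => (x, _)) xb)//.
  by rewrite orbT.
move=> xy /eqP kl; rewrite -kl kJ andbT -ltnNge in nyl.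
apply/orP; right; apply/orP; right.
apply/allpairsP; exists (x, k); rewrite mem_heights mem_sphere; split => //.
rewrite /= eqn_leq xN /=; case/tree_adjP: xy nyl => i [->|->] /=; first by [].
by move=> h; rewrite ltnW// (ltn_trans h).
Qed.

Variable p : R.
Hypothesis p01 : 0 <= p <= 1.
Local Notation tau := (two_point e p).
Local Notation A := (polar d p).

Let pred_natr : d%:R - 1 = d.-1%:R :> R.
Proof. by rewrite -[in LHS](prednK (ltnW (ltnW hd))) -natr1 addrK. Qed.

Lemma sphere_le n : (size (sphere d n))%:R <= 2 * (d%:R - 1) ^+ n :> R.
Proof.
have /andP[_ h] := size_sphere_bounds hd n.
by rewrite pred_natr -natrX -natrM ler_nat.
Qed.

Variable r : R.
Hypothesis r0 : 0 <= r.
Hypothesis r1 : (d%:R - 1) * r < 1.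
Hypothesis Ar : forall n k, A n k <= r ^+ n.
Let rho := (d%:R - 1) * r.

Let rho01 : 0 <= rho < 1.
Proof. by rewrite r1 andbT mulr_ge0// subr_ge0 ler1n; lia. Qed.

Let sphere_A n k : (size (sphere d n))%:R * A n k <= 2 * rho ^+ n.
Proof.
rewrite exprMn mulrA; apply: ler_pM => //; [exact: polar_ge0|exact: sphere_le].
Qed.

Let level_sum k (B : seq (tree d)) : uniq B ->
  \sum_(x <- B) tau origin (x, k) <= 2 / (1 - rho).
Proof.
move=> uB; pose N := \max_(x <- B) size (val x).
apply: (@le_trans _ _ (\sum_(x <- ball N) A (size (val x)) k)).
  under eq_bigr do rewrite (two_pointE hd p01).
  apply: ler_sum_sub => //; last by move=> x; exact: polar_ge0.
  by move=> x xB; rewrite mem_ball; exact: (@leq_bigmax_seq _ _ predT (fun x :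
    tree d => size (val x)) x xB).
rewrite (sum_ball N (fun n => A n k)).
apply: (@le_trans _ _ (\sum_(0 <= n < N.+1) 2 * rho ^+ n)).
  by apply: ler_sum => n _.
rewrite -mulr_sumr ler_pM2l//.
by have := geometric_sum_le 0 N.+1 rho01; rewrite expr0 mul1r.
Qed.

Lemma line_decay eps : p < 1 -> 0 < eps -> exists J : nat, forall j, (J <=
  j)%N ->
  A 0 j%:Z <= eps.
Proof.
move=> p1 e0; pose K := 2 / (1 - rho).
have K0 : 0 <= K by have := level_sum 0 (isT : uniq [::]); rewrite big_nil.
pose M := (Num.truncn (K / (eps / 2))).+1.
have M0 : (0 < M)%N by [].
have KM : K / M%:R <= eps / 2.
  rewrite ler_pdivrMr ?ltr0n// mulrC -ler_pdivrMr ?divr_gt0// ltW//.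
  exact: truncnS_gt.
have q01 : 0 <= 1 - (1 - p) ^+ M < 1.
  have /andP[p0 _] := p01; have q0 : 0 < 1 - p by rewrite subr_gt0.
  rewrite subr_ge0 exprn_ile1 ?(ltW q0) ?lerBlDr ?lerDl//=.
  by rewrite ltrBlDr ltrDl exprn_gt0.
have [J hJ] := exprn_small q01 (divr_gt0 e0 (ltr0n R 2)).
exists J => j /hJ hj.
have -> : A 0 j%:Z = tau origin (tree_root d, j%:Z) by rewrite two_pointE.
apply: two_point_le => s us; apply: le_trans (two_point_fin_line_le p01 p1 us
  level_sum j M0) _.
by rewrite [leRHS]splitr lerD// ltW.
Qed.

(** The height [J] is chosen first: by [polar_sqr_line] and [line_decay] every
    single [A n J] is small, and the geometric bound controls the sum over [n]
    uniformly in the radius.  The radius [N] is chosen next, so that the lateral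
    side, which carries at most [(2 J + 1) * 2 rho ^ N], is negligible. *)
Lemma cylinder_exit_sum_lt1 : p < 1 -> exists2 L : seq V,
  origin \in L & exit_sum e (@nb d) p L origin < 1.
Proof.
move=> p1; have D0 : 0 < d.+2%:R :> R by [].
pose eta : R := (4 * d.+2%:R)^-1.
have eta0 : 0 < eta by rewrite invr_gt0 mulr_gt0.
have /andP[rho0 rho1] := rho01.
have q0 : 0 < 1 - rho by rewrite subr_gt0.
have e1 : 0 < eta / 2 * (1 - rho) / 2 by rewrite divr_gt0// mulr_gt0// divr_gt0.
have [n0 hn0] := exprn_small rho01 e1.
pose C : R := \sum_(0 <= n < n0) (size (sphere d n))%:R.
have C0 : 0 <= C by apply: sumr_ge0.
pose delta := eta / 2 / (C + 1).
have delta0 : 0 < delta by rewrite !divr_gt0// ltr_wpDl.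
have [J hJ] := line_decay p1 (exprn_gt0 2 delta0).
have AJ n : A n J%:Z <= delta.
  rewrite -(@ler_pXn2r _ 2)// ?nnegrE ?polar_ge0 ?(ltW delta0)//.
  apply: le_trans (polar_sqr_line hd p01 n J%:Z) _; rewrite -PoszD; apply: hJ.
  exact: leq_addr.
have e2 : 0 < eta / (2 * (2 * J).+1%:R) by rewrite divr_gt0// mulr_gt0.
have [m hm] := exprn_small rho01 e2.
pose N := (n0 + m)%N.
have top : \sum_(x <- ball N) tau origin (x, J%:Z) <= eta.
  under eq_bigr do rewrite (two_pointE hd p01).
  rewrite (sum_ball N (fun n => A n J%:Z)) (big_cat_nat (n := n0))//=;
    last first.
    by rewrite /N -addnS leq_addr.
  rewrite [leRHS]splitr; apply: lerD.
    apply: (@le_trans _ _ (C * delta)).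
      by rewrite mulr_suml; apply: ler_sum => n _; apply: ler_wpM2l.
    apply: (@le_trans _ _ ((C + 1) * delta)).
      by rewrite ler_wpM2r ?ltW// ltrDl.
    by rewrite /delta mulrC divfK// gt_eqF// ltr_wpDl.
  apply: (@le_trans _ _ (\sum_(n0 <= n < N.+1) 2 * rho ^+ n)).
    by apply: ler_sum => n _.
  rewrite -mulr_sumr -ler_pdivlMl//.
  apply: le_trans (geometric_sum_le n0 N.+1 rho01) _.
  rewrite ler_pdivrMr// ltW//.
  have -> : 2^-1 * (eta / 2) * (1 - rho) = eta / 2 * (1 - rho) / 2 by ring.
  exact: hn0.
have bottom : \sum_(x <- ball N) tau origin (x, - J%:Z) <= eta.
  rewrite (eq_bigr (fun x => tau origin (x, J%:Z)))// => x _.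
  by rewrite !(two_pointE hd p01) polar_opp.
have side : \sum_(x <- sphere d N) \sum_(k <- heights J) tau origin (x, k) <=
  eta.
  rewrite exchange_big /=.
  apply: (@le_trans _ _ (\sum_(k <- heights J) 2 * rho ^+ N)).
    apply: ler_sum => k _; apply: le_trans (sphere_A N k).
    rewrite (eq_big_seq (fun=> A N k)); last first.
      by move=> x; rewrite mem_sphere (two_pointE hd p01) => /eqP ->.
    by rewrite big_const_seq count_predT iter_addr addr0 mulr_natl.
  rewrite big_const_seq count_predT iter_addr addr0 size_map size_iota
    -[leLHS]mulr_natl.
  have := ltW (hm N (leq_addl _ _)); rewrite ler_pdivlMr ?mulr_gt0//.
  by congr (_ <= _); ring.
exists (cylinder N J); first by rewrite mem_cylinder.
apply: (@le_lt_trans _ _ (\sum_(f <- bdry e (@nb d) (cylinder N J)) tau origin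
  (inner (cylinder N J) f))).
  apply: ler_sum => f _; rewrite -[leRHS]mul1r; have [p0 p1'] := andP p01.
  by apply: ler_pM => //; [exact: two_point_in_ge0|exact: two_point_in_le].
apply: le_lt_trans (sum_bdry_le (D := d.+2) (@nbP d) (@tree_line_sym d) _ _
  (@cylinder_inn N J)) _.
- by move=> u; rewrite size_nb.
- by move=> u; exact: two_point_ge0.
rewrite /cylinder_side !big_cat !big_map big_allpairs.
apply: (@le_lt_trans _ _ (d.+2%:R * (eta + (eta + eta)))).
  by rewrite ler_pM2l// !lerD.
have De : d.+2%:R * eta = 4^-1 by rewrite /eta invfM mulrCA divff ?mulr1//
  gt_eqF.
by rewrite !mulrDr De; lra.
Qed.

End Box.

(** * The exponential rate along the tree *)

Lemma bernoulli_ineq (R : realType) (x : R) k :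
  - 1 <= x -> 1 + k%:R * x <= (1 + x) ^+ k.
Proof.
move=> x1; elim: k => [|k IH]; first by rewrite mul0r addr0 expr0.
have x0 : 0 <= 1 + x by lra.
rewrite exprS; apply: le_trans (ler_wpM2l x0 IH).
have : 0 <= k%:R * x ^+ 2 by rewrite mulr_ge0// sqr_ge0.
rewrite -natr1; nra.
Qed.

Lemma powers_bounded_le1 (R : realType) (x K : R) :
  (forall k, x ^+ k <= K) -> x <= 1.
Proof.
move=> h; rewrite leNgt; apply/negP => x1.
pose y := x - 1; have y0 : 0 < y by rewrite subr_gt0.
pose k := (Num.truncn (K / y)).+1.
have : K / y < k%:R by exact: truncnS_gt.
rewrite ltr_pdivrMr// => hk.
have y1 : - 1 <= y by lra.
have := le_trans (bernoulli_ineq k y1) _; move=> /(_ K);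
  rewrite /y addrC subrK => /(_ (h k)).
rewrite -/y => hh; lra.
Qed.

Lemma powR_inv_cvg1 (R : realType) (c : R) : 0 < c ->
  (fun n : nat => c `^ n%:R^-1) @ \oo --> (1 : R).
Proof.
move=> c0; have -> : (fun n : nat => c `^ n%:R^-1) = (fun n : nat =>
  expR (n%:R^-1 * ln c)).
  by apply/funext => n; rewrite /powR gt_eqF.
have h : (fun n : nat => n%:R^-1 * ln c) @ \oo --> (0 : R).
  rewrite -[0](mul0r (ln c)); apply: cvgM; last exact: cvg_cst.
  have hn : \forall n \near \oo, 0 < (n%:R : R).
    by near=> n; rewrite ltr0n; near: n; exact: nbhs_infty_gt.
  exact: ((@gtr0_cvgV0 R nat \oo _ (fun n => n%:R) hn).2 (@cvgr_idn R)).
rewrite -[X in _ --> X](@expR0 R); exact: (@continuous_cvg _ _ _ _ _ _ expR 0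
  (@continuous_expR R 0) h).
Unshelve. all: by end_near.
Qed.

Lemma root_le (R : realType) (a t : R) n : (0 < n)%N -> 0 <= t -> 0 <= a ->
  a <= t ^+ n ->
  a `^ n%:R^-1 <= t.
Proof.
move=> n0 t0 a0 h; apply: (@le_trans _ _ ((t ^+ n) `^ n%:R^-1)).
  by apply: ge0_ler_powR; rewrite ?nnegrE ?invr_ge0// exprn_ge0.
by rewrite -powR_mulrn// -powRrM divff ?powRr1// pnatr_eq0 -lt0n.
Qed.

Lemma rootK (R : realType) (a : R) n : (0 < n)%N -> 0 <= a ->
  (a `^ n%:R^-1) ^+ n = a.
Proof.
move=> n0 a0; rewrite -powR_mulrn ?powR_ge0// -powRrM mulVf ?powRr1//.
by rewrite pnatr_eq0 -lt0n.
Qed.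

(** Fekete's lemma in multiplicative form.  Writing [n = q m + r], one has
    [a n >= a m ^+ q * a 1 ^+ r], so that every root [a m `^ m^-1] is a lower
    bound in the limit, up to a factor that tends to [1]. *)
Lemma root_limit (R : realType) (a : nat -> R) : a 0%N = 1 ->
  (forall n, 0 < a n <= 1) -> (forall m n, a m * a n <= a (m + n)%N) ->
  exists L, [/\ (fun n : nat => a n `^ n%:R^-1) @ \oo --> L, 0 <= L &
    forall n, a n <= L ^+ n].
Proof.
move=> a0 a01 aM; pose u n := a n `^ n%:R^-1.
have age0 n : 0 <= a n by case/andP: (a01 n) => /ltW.
have ale1 n : a n <= 1 by case/andP: (a01 n).
pose S := [set u n | n in [set n | (0 < n)%N]].
have hS : has_sup S.
  split; first by exists (u 1%N); exists 1%N.
  by exists 1 => _ [n n0 <-]; apply: root_le => //; rewrite expr1n.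
have uS n : (0 < n)%N -> u n <= sup S.
  by move=> n0; apply: sup_upper_bound => //; exists n.
have L0 : 0 <= sup S by apply: le_trans (uS 1%N isT); exact: powR_ge0.
exists (sup S); split => //; last first.
  case=> [|n]; first by rewrite a0 expr0.
  by rewrite -(rootK (ltn0Sn n) (age0 _)) lerXn2r ?nnegrE ?powR_ge0// uS.
have aX m q : a m ^+ q <= a (q * m)%N.
  elim: q => [|q IH]; first by rewrite expr0 a0.
  by rewrite exprS mulSn; apply: le_trans (aM _ _); apply: ler_wpM2l.
have key m n : (0 < m)%N -> (0 < n)%N -> u m * (a 1%N ^+ m) `^ n%:R^-1 <= u n.
  move=> m0 n0; have m0' : (m%:R : R) != 0 by rewrite pnatr_eq0 -lt0n.
  have n0' : (n%:R : R) != 0 by rewrite pnatr_eq0 -lt0n.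
  have -> : u m = (a m `^ (n%:R / m%:R)) `^ n%:R^-1.
    by rewrite -powRrM mulrAC divff// mul1r.
  rewrite -powRM ?powR_ge0 ?exprn_ge0//.
  apply: ge0_ler_powR; rewrite ?nnegrE ?invr_ge0 ?mulr_ge0 ?powR_ge0
    ?exprn_ge0//.
  rewrite [in leRHS](divn_eq n m); apply: le_trans (aM _ _).
  apply: ler_pM; rewrite ?powR_ge0 ?exprn_ge0//.
    apply: le_trans (aX m (n %/ m)%N); rewrite -powR_mulrn//.
    apply: ger_powR; rewrite ?a01// ler_pdivlMr ?ltr0n//.
    by rewrite -natrM ler_nat leq_trunc_div.
  apply: (@le_trans _ _ (a 1%N ^+ (n %% m)%N)).
    by apply: ler_wiXn2l => //; rewrite ltnW// ltn_mod.
  by have := aX 1%N (n %% m)%N; rewrite muln1.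
apply/cvgrPdist_le => eps eps0.
have [|_ [m /= m0 <-] um] := @sup_gt _ S (sup S - eps / 2) hS.1.
  by rewrite ltrBlDr ltrDl divr_gt0.
have c0 : 0 < a 1%N ^+ m by rewrite exprn_gt0//; case/andP: (a01 1%N).
have hv : (fun n : nat => u m * (a 1%N ^+ m) `^ n%:R^-1) @ \oo --> u m.
  rewrite -[X in _ --> X]mulr1; apply: cvgM; first exact: cvg_cst.
  exact: powR_inv_cvg1.
have e2 : 0 < eps / 2 by rewrite divr_gt0.
near=> n.
have n0 : (0 < n)%N by near: n; exact: nbhs_infty_gt.
have h1 : `|u m - u m * (a 1%N ^+ m) `^ n%:R^-1| <= eps / 2.
  by near: n; move/cvgrPdist_le: hv; apply.
rewrite -/(u n) ger0_norm ?subr_ge0 ?uS//.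
have h2 := key m n m0 n0; move: h1; rewrite ler_norml => /andP[_]; lra.
Unshelve. all: by end_near.
Qed.

Lemma expect_p0 (R : realType) (E : eqType) (s : seq E) (F : (E -> bool) -> R) :
  expect 0 s F (@closed_config E) = F (@closed_config E).
Proof.
elim: s => //= f s IH; rewrite mul0r add0r subr0 mul1r -[RHS]IH; congr expect.
by rewrite -[RHS](upd_id _ f).
Qed.

Lemma expect_p1 (R : realType) (E : eqType) (s : seq E) (F : (E -> bool) ->
  R) w :
  expect 1 s F w = F (fun f => (f \in s) || w f).
Proof.
elim: s w => //= f s IH w; rewrite mul1r subrr mul0r addr0 IH; congr F.
apply/funext => g; rewrite /upd inE; case: eqP => // ->; by rewrite orbT.
Qed.

Lemma linked_closed (V : countType) (e : rel V) x y :
  linked predT (@closed_config (edge e)) x y -> x = y.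
Proof.
move=> h; apply: (linked_ind (P := fun z => x = z) h) => // u v _ _.
by case/open_adjP.
Qed.

Section Rate.
Variables (R : realType) (d : nat).
Hypothesis hd : (3 <= d)%N.
Local Notation V := (tree d * int)%type.
Local Notation e := (@tree_line d).
Local Notation origin := (origin d).

Lemma reach_seq (L : seq V) : exists n, {in L, forall x, reach e n origin x}.
Proof.
elim: L => [|v L [n hn]]; first by exists 0%N.
have [m hm] := reach_origin v; exists (maxn m n) => x.
rewrite inE => /orP[/eqP->|/hn h].
  exact: reach_leq (leq_maxl _ _) hm.
exact: reach_leq (leq_maxr _ _) h.
Qed.

Lemma size_dist (x : tree d) n : graph_dist (@tree_adj d) (tree_root d) x n ->
  size (val x) = n.
Proof.
move=> [[q [pq lq sq]] hmin]; apply/eqP; rewrite eqn_leq; apply/andP; split.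
  apply: (@reach_size d _ _ 0); exists [seq (y, 0) | y <- q]; split.
  - rewrite path_map; apply: sub_path pq => y z yz /=.
    by rewrite /tree_line /cartesian_product /= yz eqxx orbT.
  - by rewrite last_map lq.
  - by rewrite size_map sq.
suff [r [pr lr <-]] : exists r, [/\ path (@tree_adj d) (tree_root d) r,
    last (tree_root d) r = x & size r = size (val x)] by exact: hmin.
case: x {lq hmin} => w; elim: w => [|i w IH] ws.
  by exists [::]; split => //; exact: tree_inj.
have [r [pr lr sr]] := IH (path_sorted ws).
exists (rcons r (exist _ (i :: w) ws)); split.
- by rewrite rcons_path pr lr; apply/tree_adjP; exists i; left.
- by rewrite last_rcons.
- by rewrite size_rcons sr.
Qed.

Section FixedP.
Variable p : R.
Hypothesis p01 : 0 <= p <= 1.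
Local Notation A := (polar d p).

Lemma polar00 : A 0 0 = 1.
Proof.
apply/eqP; rewrite eq_le polar_le1//=.
have -> : A 0 0 = two_point e p origin origin by rewrite (two_pointE hd p01).
apply: le_trans (@two_point_fin_le _ _ _ _ p01 [::] _ _ isT).
by rewrite /two_point_fin /= linked_refl.
Qed.

Lemma polar_mul0 m n : A m 0 * A n 0 <= A (m + n) 0.
Proof. by have := polar_mul hd p01 m n 0 0; rewrite addr0 addnC. Qed.

Lemma polar_exp n k : A n 0 ^+ k <= A (k * n) 0.
Proof.
elim: k => [|k IH]; first by rewrite expr0 mul0n polar00.
rewrite exprS mulSn; apply: le_trans (polar_mul0 _ _).
by apply: ler_wpM2l => //; exact: polar_ge0.
Qed.

Lemma polar1_ge : p <= A 1 0.
Proof.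
pose i : 'I_d := Ordinal (ltnW (ltnW hd)).
pose x : tree d := exist _ [:: i] isT.
have -> : A 1 0 = two_point e p origin (x, 0) by rewrite (two_pointE hd p01).
have adj : e origin (x, 0).
  apply/orP; right; rewrite eqxx andbT.
  by apply/tree_adjP; exists i; left.
have [f fe] := edge_ends (@tree_line_sym d) (@tree_line_irr d) adj.
apply: le_trans (@two_point_fin_le _ _ _ _ p01 [:: f] _ _ isT).
rewrite /two_point_fin /= (_ : linked _ (upd _ f true) _ _); last first.
  apply: linked_adj; apply/open_adjP; exists f => //; exact: upd_same.
rewrite mulr1 lerDl mulr_ge0// subr_ge0; by case/andP: p01.
Qed.

Lemma polar_gt0 n : 0 < p -> 0 < A n 0.
Proof.
move=> p0; have := polar_exp 1 n; rewrite muln1; apply: lt_le_trans.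
by rewrite exprn_gt0// (lt_le_trans p0 polar1_ge).
Qed.

(** On the sphere of radius [n], [two_point_sum_decay] gives
    [(d - 1) ^+ n * A n 0 <= C * psi ^+ n] with [psi < 1]; supermultiplicativity
    then removes the constant [C]. *)
Lemma polar_subcritical (L : seq V) : origin \in L ->
  exit_sum e (@nb d) p L origin < 1 ->
  exists t, [/\ 0 < t, t < (d%:R - 1)^-1 & forall n, A n 0 <= t ^+ n].
Proof.
move=> oL ph1; have ph0 := @exit_sum_ge0 R _ e (@nb d) p L origin p01.
set f := exit_sum e (@nb d) p L origin in ph1 ph0.
have d1 : 0 < d%:R - 1 :> R by rewrite subr_gt0 ltr1n ltnW.
have [r hr] := reach_seq L; pose Q := r.+1.
(* [psi ^+ Q >= g >= f] by Bernoulli's inequality, so that [psi] is the decay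
   per unit of length when [f] is the decay per step of length [Q]. *)
pose g := (1 + f) / 2; pose psi := 1 + - ((1 - g) / Q%:R).
have g1 : g < 1 by rewrite /g; lra.
have g0 : 2^-1 <= g by rewrite /g; lra.
have fg : f <= g by rewrite /g; lra.
have Q1 : 1 <= Q%:R :> R by rewrite ler1n.
have gQ : 0 < (1 - g) / Q%:R <= 2^-1.
  rewrite divr_gt0 ?subr_gt0 ?ltr0n//= ler_pdivrMr ?ltr0n//.
  by apply: (@le_trans _ _ 2^-1); [lra|rewrite ler_peMr].
have psi0 : 0 < psi by rewrite /psi; case/andP: gQ; lra.
have psi1 : psi < 1 by rewrite /psi; case/andP: gQ; lra.
have psiQ : g <= psi ^+ Q.
  apply: le_trans (bernoulli_ineq Q _); last by case/andP: gQ; lra.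
  by rewrite mulrN mulrC divfK ?pnatr_eq0//; lra.
pose K : R := (size L)%:R / (1 - f).
have K0 : 0 <= K by rewrite divr_ge0// subr_ge0 ltW.
pose t := psi / (d%:R - 1).
have t0 : 0 < t by rewrite divr_gt0.
exists t; split => //; first by rewrite /t ltr_pdivrMr// mulVf ?gt_eqF.
have bound n : A n 0 <= K / psi ^+ Q * t ^+ n.
  pose m := (n.-1 %/ Q)%N.
  have A0n : 0 <= A n 0 by exact: polar_ge0.
  have h1 : (d%:R - 1) ^+ n * A n 0 <= f ^+ m * K.
    have [n0|n0] := posnP n.
      rewrite /m n0 div0n !expr0 !mul1r.
      rewrite polar00 /K ler_pdivlMr ?subr_gt0// mul1r lerBlDr ler_wpDr//.
      by rewrite ler1n; case: (L) oL.
    have us : uniq [seq (x, 0 : int) | x <- sphere d n].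
      by rewrite map_inj_uniq ?uniq_sphere// => x y [].
    have far : {in [seq (x, 0 : int) | x <- sphere d n], forall z,
        ~ reach e (m * r.+1) origin z}.
      move=> _ /mapP[x xn ->] /reach_size; move: xn;
        rewrite mem_sphere => /eqP ->.
      have : (m * Q <= n.-1)%N by exact: leq_trunc_div.
      by move=> h1 h2; move: (leq_trans h2 h1); rewrite leqNgt prednK// leqnn.
    have := two_point_sum_decay (@nbP d) (@tree_line_sym d) (@tree_line_irr d)
      p01
      (@vertex_transitive d) oL ph1 hr us far.
    rewrite big_map; apply: le_trans.
    rewrite (eq_big_seq (fun=> A n 0)); last first.
      by move=> x; rewrite mem_sphere (two_pointE hd p01) => /eqP ->.
    rewrite big_const_seq count_predT iter_addr addr0 -[leRHS]mulr_natl.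
    apply: ler_wpM2r => //; have /andP[h _] := size_sphere_bounds hd n.
    have -> : d%:R - 1 = d.-1%:R :> R.
      by rewrite -[in LHS](prednK (ltnW (ltnW hd))) -natr1 addrK.
    by rewrite -natrX ler_nat.
  have h2 : f ^+ m * psi ^+ Q <= psi ^+ n.
    apply: (@le_trans _ _ ((psi ^+ Q) ^+ m * psi ^+ Q)).
      apply: ler_wpM2r; first by rewrite exprn_ge0// ltW.
      rewrite lerXn2r ?nnegrE ?exprn_ge0 ?(ltW psi0)//.
      exact: le_trans fg psiQ.
    rewrite -exprM -exprD; apply: ler_wiXn2l; rewrite ?(ltW psi0) ?(ltW psi1)//.
    have := ltn_ceil n.-1 (ltn0Sn r); rewrite -/Q -/m mulSn mulnC addnC.
    by case: (n).
  rewrite /t expr_div_n mulrA ler_pdivlMr ?exprn_gt0// mulrC.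
  apply: (le_trans h1); rewrite mulrC -[leRHS]mulrA; apply: ler_wpM2l => //.
  by rewrite ler_pdivlMl ?exprn_gt0// mulrC.
move=> n; rewrite -[leRHS]mul1r -ler_pdivrMr ?exprn_gt0//.
apply: (@powers_bounded_le1 _ _ (K / psi ^+ Q)) => k.
rewrite expr_div_n -exprM ler_pdivrMr ?exprn_gt0//.
by apply: le_trans (polar_exp n k) _; rewrite mulnC; exact: bound.
Qed.

Lemma polar_p0 n : p = 0 -> (0 < n)%N -> A n 0 = 0.
Proof.
move=> p0 n0; apply/eqP; rewrite eq_le polar_ge0// andbT;
  apply: two_point_le => s _.
rewrite /two_point_fin p0 expect_p0; case: (boolP (linked _ _ _ _)) =>
  // /linked_closed [E].
have := congr1 (size \o val) E; set y := nth _ _ _.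
have : y \in sphere d n.
  apply: mem_nth; have /andP[+ _] := size_sphere_bounds hd n.
  by apply: leq_trans; rewrite expn_gt0 -subn1 subn_gt0 ltnW.
by rewrite mem_sphere /= => /eqP -> n0'; move: n0; rewrite -n0'.
Qed.

Lemma polar_rate : exists L, [/\ (fun n : nat => A n 0 `^ n%:R^-1) @ \oo --> L,
  0 <= L &
    forall n, A n 0 <= L ^+ n].
Proof.
have /andP[+ p1] := p01; rewrite le_eqVlt => /orP[/eqP/esym p0|p0].
  exists 0; split => //; last first.
    by case=> [|n]; [rewrite polar00 expr0|rewrite polar_p0// expr0n].
  apply: cvg_near_cst; exists 1%N => // n /= n1.
  by rewrite polar_p0// powR0// invr_eq0 pnatr_eq0 -lt0n.
apply: root_limit; first exact: polar00.
  by move=> n; rewrite polar_gt0//= polar_le1.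
exact: polar_mul0.
Qed.

End FixedP.
End Rate.

(** * The critical probability *)

Section MainSteps.
Variables (R : realType) (d : nat).
Hypothesis hd : (3 <= d)%N.
Local Notation V := (tree d * int)%type.
Local Notation e := (@tree_line d).
Local Notation origin := (origin d).
Local Notation A := (@polar R d).
Variable P : R -> probability (config (@tree_line d)) R.
Hypothesis hP : forall p : R, 0 <= p <= 1 -> bernoulli_percolation p (P p).
Variable v : nat -> tree d.
Hypothesis hv : forall n : nat, graph_dist (@tree_adj d) (tree_root d) (v n) n.

Let pc : R := critical_probability P.
Let alpha : R -> R := connection_rate P v.
Let beta : R := (d%:R - 1)^-1.

Definition supercritical (p : R) := 0 <= p <= 1 /\
  {ae P p, forall w, exists x, infinite_set (Defs.cluster w x)}.

Lemma rate_spec p : 0 <= p <= 1 ->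
  [/\ 0 <= alpha p, forall n, A p n 0 <= alpha p ^+ n &
    forall t, 0 <= t -> (forall n, (0 < n)%N -> A p n 0 <= t ^+ n) ->
      alpha p <= t].
Proof.
move=> p01; have [L [cL L0 hL]] := polar_rate hd p01.
have E : (fun n : nat => fine (P p [set w | open_connected w (tree_root d,
  0) (v n, 0)])
    `^ n%:R^-1) = (fun n : nat => A p n 0 `^ n%:R^-1).
  apply/funext => n; congr (_ `^ _).
  have := pr_open_connected (@nbP d) (@tree_line_sym d) p01 (hP p01) origin (v
    n, 0).
  by rewrite /pr => ->; rewrite (two_pointE hd p01) (size_dist (hv n)).
have -> : alpha p = L by rewrite /alpha /connection_rate E; exact: cvg_lim.
split => // t t0 ht; rewrite -(cvg_lim (@Rhausdorff R) cL).
apply: limr_le; first by apply/cvg_ex; exists L.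
exists 1%N => // n /= n1; apply: root_le => //; first exact: polar_ge0.
exact: ht.
Qed.

Lemma supercritical_of_exit_sum p0 p1 : 0 <= p0 -> p0 < p1 -> p1 <= 1 ->
  (forall L : seq V, origin \in L -> 1 <= exit_sum e (@nb d) p0 L origin) ->
  supercritical p1.
Proof.
move=> p00 p01 p11 h; have p1b : 0 <= p1 <= 1 by apply/andP; split; lra.
split => //.
have c0 : 0 < (p1 - p0) / (1 + (p1 - p0)) by rewrite divr_gt0; lra.
apply: (ae_percolates (@nbP d) (@tree_line_sym d) p1b (hP p1b) c0 (o :=
  origin)).
move=> L oL; exact: (theta_ge (@nbP d) (@tree_line_sym d) p00 p01 p11 oL h).
Qed.

Lemma not_supercritical p (L : seq V) : origin \in L ->
  exit_sum e (@nb d) p L origin < 1 -> ~ supercritical p.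
Proof.
move=> oL ph [p01]; apply: (not_ae_percolates (@nbP d) (@tree_line_sym d) p01
  (hP p01)
  (K := (size L)%:R / (1 - exit_sum e (@nb d) p L origin))).
move=> y r ur.
exact: (two_point_sum_bound (@nbP d) (@tree_line_sym d) (@tree_line_irr d) p01
  (@vertex_transitive d) oL ph y ur).
Qed.

Lemma supercritical1 : supercritical 1.
Proof.
have p01 : 0 <= (1 : R) <= 1 by apply/andP; split; [exact: ler01|exact: lexx].
split => //; apply: (ae_percolates (@nbP d) (@tree_line_sym d) p01 (hP p01)
  ltr01 (o := origin)).
move=> L oL; rewrite /theta expect_p1.
pose w1 (f : edge e) := (f \in touching_edges e (@nb d) L) || closed_config f.
suff h1 : escapes L origin w1 by rewrite [escapes _ _ _]h1.
pose k := (\max_(u <- L) `|u.2|%N).+1.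
have zL : ((tree_root d, k%:Z) : V) \notin L.
  apply/negP => zL.
  have := @leq_bigmax_seq _ _ predT (fun u : V => `|u.2|%N) _ zL isT.
  by rewrite /= -/k ltnn.
have [n [q [pq lq _]]] := @reach_origin d (tree_root d, k%:Z).
have h : linked predT (fun _ : edge e => true) origin (tree_root d, k%:Z).
  apply/asboolP; exists q; split => //; last by apply/allP.
  apply: sub_path pq => x y xy.
  have [f fxy] := edge_ends (@tree_line_sym d) (@tree_line_irr d) xy.
  by apply/open_adjP; exists f.
have [u [x [ou ux _ xL _]]] := linked_exit (b := mem L) h oL zL.
have [_ /andP[_ uL]] := linked_ends ou.
apply: (@escapes_linked _ _ _ _ x); last exact: escapes_notin.
case/open_adjP: ux => f fux _; apply: (@linked_step _ _ _ _ _ u) => //.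
  apply: linked_sub ou => // g /andP[gL _] _.
  by rewrite /w1 (mem_touching_edges (@nbP d) (@tree_line_sym d)) /touch;
    apply/orP; left; apply/orP; left.
apply/open_adjP; exists f => //.
rewrite /w1 (mem_touching_edges (@nbP d) (@tree_line_sym d)) (ends_touch _ fux).
by apply/orP; left; apply/orP; left.
Qed.

Let pc_le p : supercritical p -> pc <= p.
Proof.
move=> hp; apply: ge_inf => //; exists 0 => q [/andP[]] //.
Qed.

Lemma critical_probability01 : 0 <= pc <= 1.
Proof.
rewrite pc_le ?andbT; last exact: supercritical1.
apply: lb_le_inf; first by exists 1; exact: supercritical1.
by move=> q [/andP[]].
Qed.

Let pc01 := critical_probability01.

Let pc_near eps : 0 < eps -> exists2 p, supercritical p & p < pc + eps.
Proof.
move=> e0; have hi : has_inf supercritical.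
  by split; [exists 1; exact: supercritical1|exists 0 => q [/andP[]]].
by have [p hp pe] := inf_adherent e0 hi; exists p.
Qed.

Let subcritical_bound p : 0 <= p -> p < pc ->
  exists t, [/\ 0 < t, t < beta & forall n, A p n 0 <= t ^+ n].
Proof.
move=> p0 ppc; have p01 : 0 <= p <= 1.
  by rewrite p0 (le_trans (ltW ppc))//; case/andP: pc01.
suff [L oL ph] : exists2 L : seq V, origin \in L & exit_sum e (@nb d) p L
  origin < 1.
  exact: polar_subcritical oL ph.
apply: contrapT => h.
have pq : p < (p + pc) / 2 by lra.
have qpc : (p + pc) / 2 < pc by lra.
have q1 : (p + pc) / 2 <= 1 by case/andP: pc01 => _; lra.
suff /pc_le : supercritical ((p + pc) / 2) by rewrite leNgt qpc.
apply: (supercritical_of_exit_sum p0 pq q1) => L oL.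
 rewrite leNgt; apply/negP => ph; by apply: h; exists L.
Qed.

Let beta_gt0 : 0 < beta.
Proof. by rewrite invr_gt0 subr_gt0 ltr1n ltnW. Qed.

Let beta_lt1 : beta < 1.
Proof.
have h : 3 <= d%:R :> R by rewrite ler_nat.
by rewrite invf_lt1; lra.
Qed.

(** The inequality is strict, which makes [alpha] take the value [beta] at most
    at the end point of [[0, pc]]. *)
Lemma alpha_lt p : 0 <= p -> p < pc -> alpha p < beta.
Proof.
move=> p0 ppc; have [t [t0 tb ht]] := subcritical_bound p0 ppc.
have p01 : 0 <= p <= 1.
  by rewrite p0 (le_trans (ltW ppc))//; case/andP: pc01.
have [_ _ h] := rate_spec p01; apply: le_lt_trans tb; apply: h => //.
exact: ltW.
Qed.

(** Left-continuity: the inequality [A pc n 0 > beta ^+ n] would be witnessed by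
    finitely many edges, hence would hold for some [p < pc] as well; it also
    fails at [pc = 0], where no edge is open. *)
Lemma alpha_pc_le : alpha pc <= beta.
Proof.
have [_ _ h] := rate_spec pc01; apply: h => [|n n0]; first exact: ltW.
rewrite leNgt; apply/negP => hn.
have [s us hs] := two_point_lt pc01 hn.
pose x : V := (nth (tree_root d) (sphere d n) 0, 0).
have cs := @continuous_expect R _ s (fun w => (linked predT w origin x)%:R)
  (@closed_config (edge e)) us pc.
have /cvgrPdist_lt/(_ (two_point_fin pc s origin x - beta ^+ n)) := cs.
rewrite subr_gt0 => /(_ hs) [del /= del0 hdel].
have [pc0|pc0] := leP pc 0.
  have e0 : pc = 0 by apply/eqP; rewrite eq_le pc0; case/andP: pc01.
  by move: hn; rewrite e0 polar_p0 ?lexx//= ltNge exprn_ge0// ltW.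
pose p := Num.max 0 (pc - del / 2).
have p0 : 0 <= p by rewrite le_max lexx.
have ppc : p < pc by rewrite gt_max pc0/= ltrBlDr ltrDl divr_gt0.
have p01 : 0 <= p <= 1.
  by rewrite p0 (le_trans (ltW ppc))//; case/andP: pc01.
have pd : `|pc - p| < del.
  rewrite ger0_norm ?subr_ge0 ?(ltW ppc)//.
  have : pc - del / 2 <= p by rewrite le_max lexx orbT.
  lra.
have h1 : beta ^+ n < two_point_fin p s origin x.
  have := hdel p pd; rewrite -!/(two_point_fin _ s origin x) ltr_norml =>
    /andP[_]; lra.
have [t [t0 tb ht]] := subcritical_bound p0 ppc.
have h2 : two_point_fin p s origin x <= A p n 0.
  exact: two_point_fin_le.
have h3 : t ^+ n <= beta ^+ n by rewrite lerXn2r ?nnegrE ?(ltW t0) ?(ltW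
  beta_gt0)// ltW.
have := ht n; lra.
Qed.

(** Otherwise some cylinder has [phi < 1] at [pc], hence also at some
    supercritical parameter close to [pc], by continuity. *)
Lemma alpha_pc_ge : beta <= alpha pc.
Proof.
rewrite leNgt; apply/negP => ab.
have [a0 aA _] := rate_spec pc01.
have pc1 : pc < 1.
  rewrite lt_neqAle; apply/andP; split; last by case/andP: pc01.
  apply/eqP => e1; have := aA 1%N; have := polar1_ge hd pc01.
  rewrite {1}e1 expr1; have := beta_lt1; lra.
have [L oL ph] : exists2 L : seq V, origin \in L & exit_sum e (@nb d) pc L
  origin < 1.
  apply: (cylinder_exit_sum_lt1 hd pc01 a0) => //.
    by rewrite mulrC -ltr_pdivlMr ?mul1r// subr_gt0 ltr1n ltnW.
  move=> n k; rewrite -(@ler_pXn2r _ 2)// ?nnegrE ?polar_ge0 ?exprn_ge0//.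
  apply: le_trans (polar_sqr hd pc01 n k) _.
  by rewrite -exprM muln2 -addnn; exact: aA.
have /cvgrPdist_lt/(_ (1 - exit_sum e (@nb d) pc L origin)) :=
  @continuous_exit_sum R V e (@nb d) L origin pc.
rewrite subr_gt0 => /(_ ph) [del /= del0 hdel].
have [p hp ppc] := pc_near del0.
apply: (not_supercritical oL _ hp).
have pd : `|pc - p| < del.
  by rewrite distrC ger0_norm ?subr_ge0 ?pc_le// ltrBlDl.
have := hdel p pd; rewrite ltr_norml => /andP[h1 _]; lra.
Qed.

End MainSteps.

Theorem theorem1p8 (R : realType) (d : nat) (hd : (3 <= d)%N)
    (P : R -> probability (config (@tree_line d)) R)
    (hP : forall p : R, 0 <= p <= 1 -> bernoulli_percolation p (P p))
    (v : nat -> tree d)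
    (hv : forall n : nat, graph_dist (@tree_adj d) (tree_root d) (v n) n) :
  let pc : R := critical_probability P in
  let alpha : R -> R := connection_rate P v in
  let alpha_inv : R -> R := 'pinv_(fun=> -1) `[0, pc] alpha in
  (d%:R - 1)^-1 \in `[0, alpha pc] /\ pc = alpha_inv (d%:R - 1)^-1.
Proof.
move=> pc alpha alpha_inv.
have apc : alpha pc = (d%:R - 1)^-1.
  by apply/eqP; rewrite eq_le (alpha_pc_le hd hP hv) (alpha_pc_ge hd hP hv).
have b0 : 0 <= (d%:R - 1)^-1 :> R by rewrite invr_ge0 subr_ge0 ler1n; lia.
have /andP[pc0 _] : 0 <= pc <= 1 := critical_probability01 hP.
split; first by rewrite apc in_itv /= b0 lexx.
have im : (d%:R - 1)^-1 \in alpha @` `[0, pc].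
  by rewrite inE; exists pc => //=; rewrite in_itv /= pc0 lexx.
have aK : alpha (alpha_inv (d%:R - 1)^-1) = (d%:R - 1)^-1 by exact: (@pinvK _ _
  (fun=> -1) `[0, pc]%classic alpha _ im).
have sb : set_surj `[0, pc] [set (d%:R - 1)^-1] alpha.
  by move=> _ ->; rewrite -inE.
have : `[0, pc]%classic (alpha_inv (d%:R - 1)^-1).
  by apply: (surjpinv_image_sub sb); exists (d%:R - 1)^-1.
rewrite /= in_itv /= => /andP[x0]; rewrite le_eqVlt => /orP[/eqP->//|xpc].
by have := alpha_lt hd hP hv x0 xpc; rewrite -/alpha aK ltxx.
Qed.
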